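(* (1) Let $\Omega=\{z\in\mathbb{C}^n \mid r(z)<0\}$ be a bounded domain with $C^2$-smooth boundary, where $r$ is a $C^2$ defining function with $dr\ne0$ on $b\Omega$. If there exist constants $C>0$ and $\alpha>1/2$ such that \[ F^K_\Omega(z,X)\ge C\frac{|\langle\partial r(z),X\rangle|}{|r(z)|^{\alpha}} \] for all $z\in\Omega$ and all $X\in\mathbb{C}^n$, then $\Omega$ is pseudoconvex. (2) Conversely, if $\Omega=\{z\in\mathbb{C}^n \mid r(z)<0\}$ is a bounded pseudoconvex domain with $C^3$-smooth boundary, where $r$ is a $C^3$ defining function with $dr\ne 0$ on $b\Omega$, then there exists a constant $C>0$ such that \[ F^K_\Omega(z,X)\ge C\frac{|\langle\partial r(z),X\rangle|}{|r(z)|^{2/3}} \] for all $z\in\Omega$ and all $X\in\mathbb{C}^n$.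
   Context: $\langle\partial r(z),X\rangle=\sum_{j=1}^n \frac{\partial r}{\partial z_j}(z)X_j$. For a domain $\Omega\subset\mathbb{C}^n$, $z\in\Omega$ and $X\in\mathbb{C}^n$, the Kobayashi(–Royden) metric is $F^K_\Omega(z,X)=\inf\{1/\lambda \mid \exists f\colon D\to\Omega \text{ holomorphic},\ f(0)=z,\ f'(0)=\lambda X,\ \lambda>0\}$, where $D$ is the unit disc in $\mathbb{C}$. *)

(* Defs.v *)
From HB Require Import structures.
From mathcomp Require Import all_boot all_order all_algebra.
From mathcomp Require Import all_classical all_reals all_analysis.
From mathcomp Require Import complex.
Import Order.TTheory GRing.Theory Num.Theory.
Import numFieldNormedType.Exports.

Set Implicit Arguments.
Unset Strict Implicit.
Unset Printing Implicit Defensive.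

Local Open Scope ring_scope.
Local Open Scope classical_set_scope.

(* R[i] as a normed module over itself (standard topology given by the
   complex modulus); this lets us speak of complex derivatives. *)
HB.instance Definition _ (R : rcfType) := NormedModule.copy R[i] (R[i])^o.

Definition xdir {R : realType} {n : nat} (j : 'I_n) : 'rV[R[i]]_n :=
  \row_k (if k == j then 1 else 0).
Definition ydir {R : realType} {n : nat} (j : 'I_n) : 'rV[R[i]]_n :=
  \row_k (if k == j then 'i%C else 0).

Definition along {R : realType} {n : nat} (r : 'rV[R[i]]_n -> R)
  (v z : 'rV[R[i]]_n) : R -> R := fun t : R => r (z + (t%:C)%C *: v).

Definition pderiv {R : realType} {n : nat} (r : 'rV[R[i]]_n -> R)
  (v : 'rV[R[i]]_n) : 'rV[R[i]]_n -> R :=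
  fun z => 'D_1 (along r v z) 0.

Definition coord_dir {R : realType} {n : nat} (v : 'rV[R[i]]_n) : Prop :=
  exists j : 'I_n, v = xdir j \/ v = ydir j.

Fixpoint Ck {R : realType} {n : nat} (k : nat) (r : 'rV[R[i]]_n -> R) : Prop :=
  match k with
  | 0 => continuous r
  | k'.+1 => continuous r /\
      forall v : 'rV[R[i]]_n, coord_dir v ->
        (forall z, derivable (along r v z) 0 1) /\ Ck k' (pderiv r v)
  end.

Definition bdry {R : realType} {n : nat} (Om : set 'rV[R[i]]_n) :=
  closure Om `\` Om.

Definition defining_function {R : realType} {n : nat} (k : nat)
  (Om : set 'rV[R[i]]_n) (r : 'rV[R[i]]_n -> R) : Prop :=
  [/\ Ck k r, Om = [set z | r z < 0] &
      forall p, bdry Om p -> exists v : 'rV[R[i]]_n, pderiv r v p != 0].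

Definition dz_r {R : realType} {n : nat} (r : 'rV[R[i]]_n -> R) (j : 'I_n)
  (z : 'rV[R[i]]_n) : R[i] :=
  (((pderiv r (xdir j) z)%:C)%C - 'i%C * ((pderiv r (ydir j) z)%:C)%C) / 2%:R.

Definition dr_pair {R : realType} {n : nat} (r : 'rV[R[i]]_n -> R)
  (z X : 'rV[R[i]]_n) : R[i] :=
  \sum_(j < n) dz_r r j z * X 0 j.

(* d^2 r / dz_j d zbar_k
   = (1/4) (d/dx_j - i d/dy_j)(d/dx_k + i d/dy_k) r. *)
Definition levi_coef {R : realType} {n : nat} (r : 'rV[R[i]]_n -> R)
  (j k : 'I_n) (z : 'rV[R[i]]_n) : R[i] :=
  let d2 a b := pderiv (pderiv r b) a z in
  (((d2 (xdir j) (xdir k) + d2 (ydir j) (ydir k))%:C)%C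
   + 'i%C * ((d2 (xdir j) (ydir k) - d2 (ydir j) (xdir k))%:C)%C) / 4%:R.

Definition levi_form {R : realType} {n : nat} (r : 'rV[R[i]]_n -> R)
  (z X : 'rV[R[i]]_n) : R[i] :=
  \sum_(j < n) \sum_(k < n) levi_coef r j k z * X 0 j * (X 0 k)^*%C.

Definition pseudoconvex {R : realType} {n : nat} (Om : set 'rV[R[i]]_n) : Prop :=
  exists r : 'rV[R[i]]_n -> R, defining_function 2 Om r /\
    forall p, bdry Om p -> forall X : 'rV[R[i]]_n,
      dr_pair r p X = 0 -> 0 <= Re (levi_form r p X).

Definition holo_disc {R : realType} {n : nat} (f : R[i] -> 'rV[R[i]]_n) : Prop :=
  forall w : R[i], `|w| < 1 -> derivable f w 1.

Definition kobayashi {R : realType} {n : nat} (Om : set 'rV[R[i]]_n)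
  (z X : 'rV[R[i]]_n) : \bar R :=
  ereal_inf [set (lam^-1)%:E | lam in
    [set lam : R | 0 < lam /\
       exists f : R[i] -> 'rV[R[i]]_n,
         [/\ holo_disc f, (forall w : R[i], `|w| < 1 -> Om (f w)),
             f 0 = z & 'D_1 f 0 = (lam%:C)%C *: X]]].

Definition cabs {R : realType} (w : R[i]) : R := ComplexField.Normc.normc w.

(* Main.v *)
(* (1) If the Levi form of [r] is negative at a boundary point in a complex tangent
   direction [X], then for [z] in the domain close to that point the quadratic disc
   [z + w (c X + s V) + w^2 Q V], with [V] normal and [Q] chosen to kill the
   pluriharmonic part of the Hessian, stays in the domain as soon as
   [s = k |r z|^(1/2)]; hence the metric grows at most like [|r z|^(-1/2)] in the
   normal direction.

   (2) Let [f] be a disc in the domain with [f 0 = z], [Y = f' 0], [dl = - r z] and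
   [a = |<dr z, Y>|].  Cauchy estimates give [f w = z + w Y + w^2 b + O(w^3)] with
   uniform constants.  Adding the expansions of [r (f w)] and [r (f (i w))] cancels
   [b] and the pluriharmonic part of the Hessian; with the right argument of [w],
   [|w| ~ t], both values being negative yields
   [0 > - 2 dl + c a t + L(Y) t^2 - C t^3].  Pseudoconvexity at the boundary and
   class C^3 give [L(Y) >= - C (dl + a)], and [t ~ dl^(1/3)] gives
   [a <= C dl^(2/3)].

   Cauchy estimates are obtained without Cauchy's formula: Goursat's bisection on
   logarithmic rectangles gives the mean value property, hence the maximum principle,
   which bounds difference quotients and makes isolated singularities removable. *)
Require Import Defs.
From HB Require Import structures.
From mathcomp Require Import all_boot all_order all_algebra.
From mathcomp Require Import all_classical all_reals all_analysis.
From mathcomp Require Import complex.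
From mathcomp Require Import ring lra.
Import Order.TTheory GRing.Theory Num.Theory.
Import numFieldNormedType.Exports.
Local Open Scope ring_scope.
Local Open Scope classical_set_scope.

Set Implicit Arguments.
Unset Strict Implicit.
Unset Printing Implicit Defensive.

(** * Goursat's lemma for divergence free fields *)

(** Why two points in part (2): in the expansion of one value [r (f w)] the coefficient [b]
    contributes a term of order [t^2] and of unknown sign, as large as the Levi term. It would force
    [t ~ dl^(1/2)] and yield only the exponent 1/2, which pseudoconvexity does not improve until
    that term is gone. A second obstacle lies in the hypothesis: pseudoconvexity gives the Levi
    condition for some C^2 defining function, while the bound concerns the given [r]. The quotient
    of two such functions is in general only C^1, so the usual computation with a factor is replaced
    by a comparison of both functions along parabolas tangent to the boundary. The lower bound for
    [L(Y)] inside the domain comes from a boundary point [p] at distance [O(dl)] and from the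
    projection of [Y] to the complex tangent space at [p]; Lipschitz second derivatives are what
    makes the error [O(dl)]. Since [dr] may vanish inside the domain, interior points are treated
    apart, where [|r|] is bounded below, and the local constants are glued by compactness of the
    closure. *)

Definition intv {R : realType} (a b : R) (f : R -> R) : R :=
  Rintegral (@lebesgue_measure R) `[a, b] f.

Lemma integrable_seg (R : realType) (a b : R) (f : R -> R) :
  (forall x, a <= x <= b -> {for x, continuous f}) ->
  (@lebesgue_measure R).-integrable `[a, b] (EFin \o f).
Proof.
move=> cf; apply: continuous_compact_integrable; first exact: segment_compact.
apply: continuous_in_subspaceT => x; rewrite inE /= in_itv /= => xab; exact: (cf x xab).
Qed.

Lemma intv_split (R : realType) (a m b : R) (f : R -> R) :
  a <= m -> m <= b -> (forall x, a <= x <= b -> {for x, continuous f}) ->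
  intv a b f = intv a m f + intv m b f.
Proof.
move=> am mb cf; have itf := integrable_seg cf.
have := @Rintegral_itvB R f (BLeft a) (BRight b) m itf.
rewrite !bnd_simp => /(_ am mb); rewrite /intv => h.
rewrite -(@Rintegral_itv_obnd_cbnd _ m); first by rewrite -h addrC subrK.
by apply: integrableS itf => //; apply: subset_itvr; rewrite bnd_simp.
Qed.

Lemma intv_diff_le (R : realType) (a b k : R) (f g : R -> R) : a <= b ->
  (forall x, a <= x <= b -> {for x, continuous f}) ->
  (forall x, a <= x <= b -> {for x, continuous g}) ->
  (forall x, a <= x <= b -> f x - g x <= k) ->
  intv a b f - intv a b g <= k * (b - a).
Proof.
move=> ab cf cg h.
have mD : measurable (`[a, b]%classic : set R) by [].
have icst : (@lebesgue_measure R).-integrable `[a, b] (EFin \o fun _ : R => k).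
  by apply: integrable_seg => x _; exact: cst_continuous.
have itf := integrable_seg cf; have itg := integrable_seg cg.
have mu_ab : fine (lebesgue_measure (`[a, b]%classic : set R)) = b - a.
  by rewrite lebesgue_measure_itv /= lte_fin; case: ltgtP ab => // -> _; rewrite subrr.
rewrite /intv -RintegralB// -mu_ab -Rintegral_cst//.
apply: le_Rintegral => //.
by apply: integrable_seg => x xab; apply: cvgB; [exact: cf|exact: cg].
Qed.

Lemma intv_diff_bound (R : realType) (a b k e : R) (f g : R -> R) : a <= b ->
  (forall x, a <= x <= b -> {for x, continuous f}) ->
  (forall x, a <= x <= b -> {for x, continuous g}) ->
  (forall x, a <= x <= b -> `|f x - g x - k| <= e) ->
  `|intv a b f - intv a b g - k * (b - a)| <= e * (b - a).
Proof.
move=> ab cf cg h.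
have h1 := intv_diff_le (k := k + e) ab cf cg.
have h2 := intv_diff_le (k := e - k) ab cg cf.
have {}h1 : intv a b f - intv a b g <= (k + e) * (b - a).
  by apply: h1 => x /h; rewrite ler_norml; lra.
have {}h2 : intv a b g - intv a b f <= (e - k) * (b - a).
  by apply: h2 => x /h; rewrite ler_norml; lra.
by rewrite ler_norml; apply/andP; split; lra.
Qed.

Lemma eq_intv (R : realType) (a b : R) (f g : R -> R) :
  f =1 g -> intv a b f = intv a b g.
Proof. by move=> /funext ->. Qed.

(** Real differentiability at one point, with partial derivatives [A] and [B]. No continuity of the
    partials is asked: this is the generality that Goursat's argument handles. *)
Definition diff2 {R : realType} (u : R -> R -> R) (x y A B : R) : Prop :=
  forall e : R, 0 < e -> exists2 d : R, 0 < d &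
    forall s t : R, `|s| < d -> `|t| < d ->
      `|u (x + s) (y + t) - u x y - A * s - B * t| <= e * (`|s| + `|t|).

Lemma diff2_contl (R : realType) (u : R -> R -> R) (x y A B : R) :
  diff2 u x y A B -> {for x, continuous (u ^~ y)}.
Proof.
move=> h; apply/cvgrPdist_lt => e e0.
have [d d0 hd] := h 1 ltr01.
pose K := 1 + `|A|.
have K0 : 0 < K by rewrite /K ltr_pwDl.
apply/nbhs_ballP; exists (Num.min d (e / K)).
  by rewrite /= lt_min d0 divr_gt0.
move=> x' /=; rewrite /ball /= lt_min distrC => /andP[xd xe].
have := hd (x' - x) 0 xd.
rewrite normr0 => /(_ d0); rewrite [x + _]addrC subrK !addr0 mulr0 subr0 mul1r => h1.
rewrite distrC.
have -> : u x' y - u x y = (u x' y - u x y - A * (x' - x)) + A * (x' - x) by ring.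
apply: (le_lt_trans (ler_normD _ _)); rewrite normrM.
apply: (@le_lt_trans _ _ (K * `|x' - x|)); first by rewrite /K mulrDl mul1r lerD2r.
by rewrite mulrC -ltr_pdivlMr.
Qed.

Lemma diff2_contr (R : realType) (u : R -> R -> R) (x y A B : R) :
  diff2 u x y A B -> {for y, continuous (u x)}.
Proof.
move=> h; apply: (@diff2_contl _ (fun y x => u x y) y x B A) => e /h [d d0 hd].
exists d => // s t sd td; rewrite [_ + `|t|]addrC.
by have := hd t s td sd; rewrite addrAC.
Qed.

Lemma nested_segments (R : realType) (a b : nat -> R) :
  (forall k, a k <= a k.+1) -> (forall k, b k.+1 <= b k) ->
  (forall k, a k <= b k) -> exists x, forall k, a k <= x <= b k.
Proof.
move=> ha hb hab.
have am : {homo a : m n / (m <= n)%N >-> m <= n} by exact/nondecreasing_seqP.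
have bm : {homo b : m n / (m <= n)%N >-> n <= m} by exact/nonincreasing_seqP.
have ub m : ubound (range a) (b m).
  move=> _ [k _ <-]; apply: (le_trans (am _ _ (leq_maxl k m))).
  exact: (le_trans (hab _) (bm _ _ (leq_maxr k m))).
exists (sup (range a)) => k; apply/andP; split; last first.
  by apply: ge_sup; [exists (a 0%N), 0%N|exact: ub].
by apply: ub_le_sup; [exists (b 0%N); exact: ub|exists k].
Qed.

(** The side lengths are fixed in advance and only the lower left corner is chosen, so a bisection
    argument reduces to its single step. *)
Lemma nested_rectangles (R : realType) (P : nat -> R -> R -> Prop)
    (l w : nat -> R) (x0 y0 : R) :
  (forall k, 0 <= l k) -> (forall k, 0 <= w k) -> P 0%N x0 y0 ->
  (forall k x y, P k x y -> exists x' y', [/\ P k.+1 x' y',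
     x <= x' /\ x' + l k.+1 <= x + l k & y <= y' /\ y' + w k.+1 <= y + w k]) ->
  exists X Y, forall k, exists x y,
    [/\ P k x y, x <= X <= x + l k & y <= Y <= y + w k].
Proof.
move=> l0 w0 P0 step.
have step' (kp : nat * (R * R)) : exists q : R * R, P kp.1 kp.2.1 kp.2.2 ->
    [/\ P kp.1.+1 q.1 q.2,
     kp.2.1 <= q.1 /\ q.1 + l kp.1.+1 <= kp.2.1 + l kp.1 &
     kp.2.2 <= q.2 /\ q.2 + w kp.1.+1 <= kp.2.2 + w kp.1].
  case: kp => k [x y] /=; have [Pk|nPk] := pselect (P k x y); last by exists (0, 0).
  by have [x' [y' h]] := step _ _ _ Pk; exists (x', y').
have [F FP] := choice step'.
pose s := fix s k := if k is k'.+1 then F (k', s k') else (x0, y0).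
have sP k : P k (s k).1 (s k).2 by elim: k => //= k /(FP (k, s k)) [].
have sS k := FP (k, s k) (sP k).
have [|||X hX] := @nested_segments _ (fun k => (s k).1) (fun k => (s k).1 + l k).
- by move=> k; have [_ []] := sS k.
- by move=> k; have [_ []] := sS k.
- by move=> k; rewrite lerDl.
have [|||Y hY] := @nested_segments _ (fun k => (s k).2) (fun k => (s k).2 + w k).
- by move=> k; have [_ _ []] := sS k.
- by move=> k; have [_ _ []] := sS k.
- by move=> k; rewrite lerDl.
by exists X, Y => k; exists (s k).1, (s k).2.
Qed.

Section Goursat.
Variables (R : realType) (u v : R -> R -> R).

(** Outward flux of the field [(u, - v)], whose divergence is [u_x - v_y]. The predicate [divfree]
    below is the Cauchy-Riemann equation [u_x = v_y], with common value [A]. *)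
Let flux (a b c d : R) : R :=
  (intv c d (u b) - intv c d (u a)) -
  (intv a b (v ^~ d) - intv a b (v ^~ c)).

Let divfree (x y : R) := exists A B C : R, diff2 u x y A B /\ diff2 v x y C A.

Let flux_splitx (a m b c d : R) : a <= m -> m <= b -> c <= d ->
  (forall x y, a <= x <= b -> c <= y <= d -> divfree x y) ->
  flux a b c d = flux a m c d + flux m b c d.
Proof.
move=> am mb cd h; rewrite /flux.
rewrite !(@intv_split _ a m b)//; first by ring.
  move=> x xab; have [|A [B [C [_ /diff2_contl]]]] := h x c xab; last by apply.
  by rewrite lexx.
move=> x xab; have [|A [B [C [_ /diff2_contl]]]] := h x d xab; last by apply.
by rewrite lexx andbT.
Qed.

Let flux_splity (a b c m d : R) : a <= b -> c <= m -> m <= d ->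
  (forall x y, a <= x <= b -> c <= y <= d -> divfree x y) ->
  flux a b c d = flux a b c m + flux a b m d.
Proof.
move=> ab cm md h; rewrite /flux.
rewrite !(@intv_split _ c m d)//; first by ring.
  move=> y ycd; have [|A [B [C [/diff2_contr + _]]]] := h a y _ ycd; last by apply.
  by rewrite lexx.
move=> y ycd; have [|A [B [C [/diff2_contr + _]]]] := h b y _ ycd; last by apply.
by rewrite lexx andbT.
Qed.

(** The affine parts of [u] and [v] contribute [A (b - a) (d - c)] with opposite signs, so only the
    two remainders, integrated over the four sides, survive. *)
Let flux_small (a b c d x y e : R) : a <= x <= b -> c <= y <= d ->
  (forall x y, a <= x <= b -> c <= y <= d -> divfree x y) ->
  forall A B C r : R,
  (forall s t : R, `|s| < r -> `|t| < r ->
      `|u (x + s) (y + t) - u x y - A * s - B * t| <= e * (`|s| + `|t|)) ->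
  (forall s t : R, `|s| < r -> `|t| < r ->
      `|v (x + s) (y + t) - v x y - C * s - A * t| <= e * (`|s| + `|t|)) ->
  0 <= e -> b - a < r -> d - c < r ->
  `|flux a b c d| <= 2 * e * ((b - a) + (d - c)) ^+ 2.
Proof.
move=> xab ycd h A B C r hu hv e0 bar dcr.
have ab : a <= b by move/andP: xab => [/le_trans]; apply.
have cd : c <= d by move/andP: ycd => [/le_trans]; apply.
have mon s t : `|s| <= b - a -> `|t| <= d - c ->
    e * (`|s| + `|t|) <= e * ((b - a) + (d - c)).
  by move=> hs ht; rewrite ler_wpM2l// lerD.
have bu x' y' : a <= x' <= b -> c <= y' <= d ->
    `|u x' y' - u x y - A * (x' - x) - B * (y' - y)| <= e * ((b - a) + (d - c)).
  move=> x'ab y'cd.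
  have s1 : `|x' - x| <= b - a by rewrite ler_norml; lra.
  have t1 : `|y' - y| <= d - c by rewrite ler_norml; lra.
  have := hu (x' - x) (y' - y) (le_lt_trans s1 bar) (le_lt_trans t1 dcr).
  rewrite (addrC x) (addrC y) !subrK => /le_trans; apply; exact: mon.
have bv x' y' : a <= x' <= b -> c <= y' <= d ->
    `|v x' y' - v x y - C * (x' - x) - A * (y' - y)| <= e * ((b - a) + (d - c)).
  move=> x'ab y'cd.
  have s1 : `|x' - x| <= b - a by rewrite ler_norml; lra.
  have t1 : `|y' - y| <= d - c by rewrite ler_norml; lra.
  have := hv (x' - x) (y' - y) (le_lt_trans s1 bar) (le_lt_trans t1 dcr).
  rewrite (addrC x) (addrC y) !subrK => /le_trans; apply; exact: mon.
have aab : a <= a <= b by rewrite lexx.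
have bab : a <= b <= b by rewrite ab lexx.
have ccd : c <= c <= d by rewrite lexx.
have dcd : c <= d <= d by rewrite cd lexx.
have E1 : `|intv c d (u b) - intv c d (u a) - A * (b - a) * (d - c)| <=
    2 * e * ((b - a) + (d - c)) * (d - c).
  apply: intv_diff_bound => // [y' yc|y' yc|y' yc].
  - by have [A' [B' [C' [/diff2_contr]]]] := h b y' bab yc.
  - by have [A' [B' [C' [/diff2_contr]]]] := h a y' aab yc.
  have := bu b y' bab yc; have := bu a y' aab yc.
  rewrite !ler_norml; lra.
have E2 : `|intv a b (v ^~ d) - intv a b (v ^~ c) - A * (d - c) * (b - a)| <=
    2 * e * ((b - a) + (d - c)) * (b - a).
  apply: intv_diff_bound => // [x' xa|x' xa|x' xa].
  - by have [A' [B' [C' [_ /diff2_contl]]]] := h x' d xa dcd.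
  - by have [A' [B' [C' [_ /diff2_contl]]]] := h x' c xa ccd.
  have := bv x' d xa dcd; have := bv x' c xa ccd.
  rewrite !ler_norml; lra.
rewrite /flux; move: E1 E2; rewrite !ler_norml.
set X := intv _ _ _ - _; set Y := intv _ _ _ - _.
move=> /andP[? ?] /andP[? ?]; apply/andP; split; nra.
Qed.


Lemma goursat (a b c d : R) : a < b -> c < d ->
  (forall x y, a <= x <= b -> c <= y <= d -> divfree x y) ->
  intv c d (u b) - intv c d (u a) = intv a b (v ^~ d) - intv a b (v ^~ c).
Proof.
move=> ab cd h; apply/eqP; rewrite -subr_eq0 -/(flux a b c d); apply/negPn/negP => flux0.
(* Flux per unit area. By additivity some quarter keeps at least this density at each bisection,
   whereas [flux_small] makes the density small near the limit point. *)
pose K := `|flux a b c d| / ((b - a) * (d - c)).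
have K0 : 0 < K by rewrite divr_gt0 ?normr_gt0// mulr_gt0 ?subr_gt0.
pose l k := (b - a) / 2 ^+ k; pose w k := (d - c) / 2 ^+ k.
have l0 k : 0 < l k by rewrite divr_gt0 ?subr_gt0// exprn_gt0.
have w0 k : 0 < w k by rewrite divr_gt0 ?subr_gt0// exprn_gt0.
have lS k : l k = l k.+1 + l k.+1 by rewrite /l exprS invfM; field; rewrite expf_neq0.
have wS k : w k = w k.+1 + w k.+1 by rewrite /w exprS invfM; field; rewrite expf_neq0.
pose P k x y := [/\ a <= x /\ x + l k <= b, c <= y /\ y + w k <= d &
  K * (l k * w k) <= `|flux x (x + l k) y (y + w k)|].
have [||||X [Y XY]] := @nested_rectangles R P l w a c.
- by move=> k; exact: ltW.
- by move=> k; exact: ltW.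
- rewrite /P /l /w expr0 !divr1 (addrC a) (addrC c) !subrK !lexx; split => //.
  by rewrite /K divfK// mulf_neq0// subr_eq0 gt_eqF.
- move=> k x y [[ax xb] [cy yd]]; rewrite lS wS => KP.
  have L0 := l0 k.+1; have W0 := w0 k.+1.
  move: xb yd KP; rewrite lS wS; set L := l k.+1; set W := w k.+1 => xb yd KP.
  rewrite -/L -/W in L0 W0.
  rewrite !addrA in xb yd KP *.
  have hin x' y' : x <= x' <= x + L + L -> y <= y' <= y + W + W -> divfree x' y'.
    move=> /andP[? ?] /andP[? ?]; apply: h; apply/andP; split.
    - exact: le_trans ax _.
    - exact: le_trans xb.
    - exact: le_trans cy _.
    - exact: le_trans yd.
  have xx : x <= x + L by rewrite lerDl ltW.
  have xx' : x + L <= x + L + L by rewrite lerDl ltW.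
  have yy : y <= y + W by rewrite lerDl ltW.
  have yy' : y + W <= y + W + W by rewrite lerDl ltW.
  have xb' := le_trans xx' xb; have yd' := le_trans yy' yd.
  have ax' := le_trans ax xx; have cy' := le_trans cy yy.
  have sx x' y' : x' <= x + L + L -> x + L <= x' -> y <= y' <= y + W + W -> divfree x' y'.
    by move=> ? h1 ?; apply: hin => //; rewrite (le_trans xx h1).
  move: KP; rewrite (@flux_splitx x (x + L))//; last exact: le_trans yy'.
  rewrite (@flux_splity x (x + L) y (y + W) (y + W + W))//; last first.
    by move=> ? ? /andP[? h1] ?; apply: hin => //; apply/andP; split => //; exact: le_trans
      h1 xx'.
  rewrite (@flux_splity (x + L) (x + L + L) y (y + W) (y + W + W))//; last first.
    by move=> ? ? /andP[? ?] ?; exact: sx.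
  move=> KP.
  have [h1|h1] := leP (K * (L * W)) `|flux x (x + L) y (y + W)|.
    by exists x, y; rewrite /P -/L -/W.
  have [h2|h2] := leP (K * (L * W)) `|flux x (x + L) (y + W) (y + W + W)|.
    by exists x, (y + W); rewrite /P -/L -/W.
  have [h3|h3] := leP (K * (L * W)) `|flux (x + L) (x + L + L) y (y + W)|.
    by exists (x + L), y; rewrite /P -/L -/W.
  have [h4|h4] := leP (K * (L * W)) `|flux (x + L) (x + L + L) (y + W) (y + W + W)|.
    by exists (x + L), (y + W); rewrite /P -/L -/W.
  exfalso; move: KP; apply/negP; rewrite -ltNge.
  apply: (le_lt_trans (ler_normD _ _)).
  apply: (le_lt_trans (lerD (ler_normD _ _) (ler_normD _ _))).
  have -> : K * ((L + L) * (W + W)) = (K * (L * W) + K * (L * W)) +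
    (K * (L * W) + K * (L * W)) by ring.
  by apply: ltrD; apply: ltrD.
have [x00 [y00 [[[? ?] [? ?] _] /andP[? ?] /andP[? ?]]]] := XY 0%N.
have Xab : a <= X <= b by lra.
have Ycd : c <= Y <= d by lra.
have [A [B [C [hu hv]]]] := h X Y Xab Ycd.
pose S := (b - a) + (d - c).
have S0 : 0 < S by rewrite addr_gt0// subr_gt0.
(* Tuned so that the bound of [flux_small] is exactly half of the flux [K * (l k * w k)] that the
   small rectangle retains. *)
pose e := K * ((b - a) * (d - c)) / (4 * S ^+ 2).
have e0 : 0 < e.
  apply: divr_gt0; last by apply: mulr_gt0 => //; exact: exprn_gt0.
  by apply: mulr_gt0 => //; apply: mulr_gt0; rewrite subr_gt0.
have [r1 r10 hr1] := hu e e0; have [r2 r20 hr2] := hv e e0.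
pose r := Num.min r1 r2.
have r0 : 0 < r by rewrite lt_min r10 r20.
have [k kr] : exists k, S / 2 ^+ k < r.
  exists (Num.bound (S / r)); rewrite ltr_pdivrMr ?exprn_gt0// mulrC -ltr_pdivrMr//.
  exact: upper_nthrootP.
have [x [y [[[ax xb] [cy yd] KP] xX yY]]] := XY k.
move: KP; apply/negP; rewrite -ltNge.
apply: (@le_lt_trans _ _ (2 * e * (l k + w k) ^+ 2)).
  have := @flux_small x (x + l k) y (y + w k) X Y e xX yY _ A B C r _ _ (ltW e0).
  rewrite ![_ + _ - _]addrAC !subrr !add0r; apply.
  - move=> x' y' /andP[? ?] /andP[? ?]; apply: h; apply/andP; split.
    + exact: le_trans ax _.
    + exact: le_trans xb.
    + exact: le_trans cy _.
    + exact: le_trans yd.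
  - by move=> s t; rewrite !lt_min => /andP[? _] /andP[? _]; exact: hr1.
  - by move=> s t; rewrite !lt_min => /andP[_ ?] /andP[_ ?]; exact: hr2.
  - by apply: le_lt_trans kr; rewrite /l ler_pM2r ?invr_gt0 ?exprn_gt0// lerDl subr_ge0 ltW.
  - by apply: le_lt_trans kr; rewrite /w ler_pM2r ?invr_gt0 ?exprn_gt0// lerDr subr_ge0 ltW.
have -> : l k + w k = S / 2 ^+ k by rewrite /l /w -mulrDl.
have -> : 2 * e * (S / 2 ^+ k) ^+ 2 = K * (l k * w k) / 2.
  by rewrite /e /l /w; field; rewrite expf_neq0//= gt_eqF.
have M0 : 0 < K * (l k * w k) by apply: mulr_gt0 => //; exact: mulr_gt0.
by rewrite ltr_pdivrMr// ltr_pMr// ltr1n.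
Qed.

End Goursat.

(** * Complex derivatives in epsilon-delta form *)

Section NormC.
Variable R : realType.
Implicit Types z w : R[i].
Notation nc := (@cabs R).

Lemma cabs_ge0 z : 0 <= nc z.
Proof. by case: z => a b; rewrite /cabs /= sqrtr_ge0. Qed.

Lemma cabs0 : nc 0 = 0. Proof. exact: ComplexField.Normc.normc0. Qed.

Lemma cabs1 : nc 1 = 1. Proof. exact: ComplexField.Normc.normc1. Qed.

Lemma cabs_eq0 z : (nc z == 0) = (z == 0).
Proof.
by apply/eqP/eqP => [/ComplexField.Normc.eq0_normc//|->]; rewrite cabs0.
Qed.

Lemma cabs_gt0 z : (0 < nc z) = (z != 0).
Proof. by rewrite lt_def cabs_ge0 andbT cabs_eq0. Qed.

Lemma cabsM z w : nc (z * w) = nc z * nc w.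
Proof. exact: ComplexField.Normc.normcM. Qed.

Lemma cabsV z : nc z^-1 = (nc z)^-1.
Proof. exact: ComplexField.Normc.normcV. Qed.

Lemma cabsX z n : nc (z ^+ n) = nc z ^+ n.
Proof. by elim: n => [|n IH]; rewrite ?expr0 ?cabs1// !exprS cabsM IH. Qed.

Lemma cabsN z : nc (- z) = nc z.
Proof. by case: z => a b; rewrite /cabs /= !sqrrN. Qed.

Lemma cabsD z w : nc (z + w) <= nc z + nc w.
Proof. exact: le_normcD. Qed.

Lemma cabsB z w : nc (z - w) <= nc z + nc w.
Proof. by rewrite -[nc w]cabsN; exact: cabsD. Qed.

Lemma cabsC z w : nc (z - w) = nc (w - z).
Proof. by rewrite -cabsN opprB. Qed.

Lemma cabsR (x : R) : nc x%:C%C = `|x|.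
Proof. by rewrite /cabs /= expr0n/= addr0 sqrtr_sqr. Qed.

Lemma sqr_cabs z : nc z ^+ 2 = complex.Re z ^+ 2 + complex.Im z ^+ 2.
Proof. by case: z => a b; rewrite /cabs /= sqr_sqrtr// addr_ge0 ?sqr_ge0. Qed.

Lemma abs_Re_le z : `|complex.Re z| <= nc z.
Proof. by rewrite -ler_sqr ?nnegrE ?cabs_ge0// sqr_cabs real_normK ?num_real// lerDl
  sqr_ge0. Qed.

Lemma abs_Im_le z : `|complex.Im z| <= nc z.
Proof. by rewrite -ler_sqr ?nnegrE ?cabs_ge0// sqr_cabs real_normK ?num_real// lerDr
  sqr_ge0. Qed.

Lemma cabs_le_ReIm z : nc z <= `|complex.Re z| + `|complex.Im z|.
Proof.
rewrite -ler_sqr ?nnegrE ?cabs_ge0 ?addr_ge0// sqr_cabs sqrrD !real_normK ?num_real//.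
by rewrite addrAC lerDl mulrn_wge0// mulr_ge0.
Qed.

Lemma cabs_dist_le z w : nc z - nc w <= nc (z - w).
Proof. by rewrite lerBlDr -{1}(subrK w z); exact: cabsD. Qed.

Lemma ReD z w : complex.Re (z + w) = complex.Re z + complex.Re w. Proof. by case: z w => ?
  ? []. Qed.
Lemma ImD z w : complex.Im (z + w) = complex.Im z + complex.Im w. Proof. by case: z w => ?
  ? []. Qed.
Lemma ReN z : complex.Re (- z) = - complex.Re z. Proof. by case: z. Qed.
Lemma ImN z : complex.Im (- z) = - complex.Im z. Proof. by case: z. Qed.
Lemma cReM z w : complex.Re (z * w) = complex.Re z * complex.Re w - complex.Im z *
  complex.Im w.
Proof. by case: z w => ? ? []. Qed.
Lemma cImM z w : complex.Im (z * w) = complex.Re z * complex.Im w + complex.Im z *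
  complex.Re w.
Proof. by case: z w => ? ? []. Qed.

End NormC.

(** The norm of [R[i]] takes values in [R[i]]; with [cabs] all radii and error bounds are real
    numbers. *)
Definition cder {R : realType} (h : R[i] -> R[i]) (w c : R[i]) : Prop :=
  forall e : R, 0 < e -> exists2 d : R, 0 < d &
    forall k, cabs k < d -> cabs (h (w + k) - h w - c * k) <= e * cabs k.

Section Cder.
Variable R : realType.
Implicit Types (f g h : R[i] -> R[i]) (w c : R[i]).

Lemma cder_lip h w c : cder h w c ->
  exists2 d : R, 0 < d &
    forall k, cabs k < d -> cabs (h (w + k) - h w) <= (cabs c + 1) * cabs k.
Proof.
move=> /(_ 1 ltr01) [d d0 hd]; exists d => // k /hd; rewrite mul1r => hk.
have -> : h (w + k) - h w = (h (w + k) - h w - c * k) + c * k by rewrite subrK.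
by apply: (le_trans (cabsD _ _)); rewrite cabsM mulrDl mul1r addrC lerD2l.
Qed.

Lemma cder_cts h w c : cder h w c -> forall e : R, 0 < e ->
  exists2 d : R, 0 < d & forall k, cabs k < d -> cabs (h (w + k) - h w) <= e.
Proof.
move=> /cder_lip[d d0 hd] e e0.
have c1 : 0 < cabs c + 1 by rewrite ltr_wpDl ?cabs_ge0.
exists (Num.min d (e / (cabs c + 1))); first by rewrite lt_min d0 divr_gt0.
move=> k; rewrite lt_min => /andP[/hd /le_trans + ke]; apply.
by rewrite mulrC -ler_pdivlMr// ltW.
Qed.

Lemma cder_cst c w : cder (fun=> c) w 0.
Proof.
move=> e e0; exists 1 => // k _.
by rewrite mul0r !subrr cabs0 mulr_ge0 ?cabs_ge0// ltW.
Qed.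

Lemma cder_id w : cder id w 1.
Proof.
move=> e e0; exists 1 => // k _.
by rewrite /= mul1r addrAC addrK subrr cabs0 mulr_ge0 ?cabs_ge0// ltW.
Qed.

Lemma cderD f g w c c' : cder f w c -> cder g w c' ->
  cder (fun z => f z + g z) w (c + c').
Proof.
move=> hf hg e e0.
have e20 : 0 < e / 2 by rewrite divr_gt0.
have [d d0 hd] := hf _ e20; have [d' d'0 hd'] := hg _ e20.
exists (Num.min d d'); first by rewrite lt_min d0.
move=> k; rewrite lt_min => /andP[/hd h1 /hd' h2].
have -> : f (w + k) + g (w + k) - (f w + g w) - (c + c') * k =
  (f (w + k) - f w - c * k) + (g (w + k) - g w - c' * k) by ring.
by apply: (le_trans (cabsD _ _)); lra.
Qed.

Lemma cderM f g w c c' : cder f w c -> cder g w c' ->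
  cder (fun z => f z * g z) w (c * g w + f w * c').
Proof.
move=> hf hg e e0.
have [d3 d30 hl] := cder_lip hg.
pose K := cabs c' + 1; pose A := cabs (g w) + 1; pose B := cabs (f w) + 1.
pose C := cabs c + 1.
have K0 : 0 < K by rewrite ltr_wpDl ?cabs_ge0.
have A0 : 0 < A by rewrite ltr_wpDl ?cabs_ge0.
have B0 : 0 < B by rewrite ltr_wpDl ?cabs_ge0.
have C0 : 0 < C by rewrite ltr_wpDl ?cabs_ge0.
have [d1 d10 h1] : exists2 d : R, 0 < d & forall k, cabs k < d ->
    cabs (f (w + k) - f w - c * k) <= (e / 3 / A) * cabs k.
  by apply: hf; rewrite !divr_gt0.
have [d2 d20 h2] : exists2 d : R, 0 < d & forall k, cabs k < d ->
    cabs (g (w + k) - g w - c' * k) <= (e / 3 / B) * cabs k.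
  by apply: hg; rewrite !divr_gt0.
have [d4 d40 h4] := cder_cts hg ltr01.
have e5 : 0 < e / 3 / C by rewrite !divr_gt0.
have [d5 d50 h5] := cder_cts hg e5.
exists (Num.min d1 (Num.min d2 (Num.min d4 d5))); first by rewrite !lt_min d10 d20 d40.
move=> k; rewrite !lt_min => /and4P[/h1 {}h1 /h2 {}h2 /h4 {}h4 /h5 {}h5].
have -> : f (w + k) * g (w + k) - f w * g w - (c * g w + f w * c') * k =
  (f (w + k) - f w - c * k) * g (w + k) + c * k * (g (w + k) - g w) +
  f w * (g (w + k) - g w - c' * k) by ring.
apply: (le_trans (cabsD _ _)); apply: (le_trans (lerD (cabsD _ _) (lexx _))).
rewrite !cabsM; set n := cabs k.
have n0 : 0 <= n by exact: cabs_ge0.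
have gA : cabs (g (w + k)) <= A.
  by have := cabs_dist_le (g (w + k)) (g w); rewrite /A; lra.
have -> : e * n = (e / 3 / A * n) * A + C * n * (e / 3 / C) + B * (e / 3 / B * n).
  by field; rewrite !gt_eqF.
apply: lerD; first apply: lerD.
- by rewrite ler_pM ?cabs_ge0.
- by rewrite ler_pM ?mulr_ge0 ?cabs_ge0// ler_wpM2r// /C lerDl.
- by rewrite ler_pM ?cabs_ge0// /B lerDl.
Qed.

Lemma cderX f n w c : cder f w c -> exists c', cder (fun z => f z ^+ n) w c'.
Proof.
move=> hf; elim: n => [|n [c' IH]].
  exists 0; have -> : (fun z => f z ^+ 0) = fun=> 1 by apply/funext => z; rewrite expr0.
  exact: cder_cst.
eexists; have -> : (fun z => f z ^+ n.+1) = (fun z => f z * f z ^+ n).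
  by apply/funext => z; rewrite exprS.
exact: cderM hf IH.
Qed.

Lemma cder_invB (a w : R[i]) : w != a ->
  cder (fun z => (z - a)^-1) w (- (w - a) ^- 2).
Proof.
move=> wa; have b0 : w - a != 0 by rewrite subr_eq0.
set b := w - a in b0 *; move=> e e0.
have B0 : 0 < cabs b by rewrite cabs_gt0.
exists (Num.min (cabs b / 2) (e * cabs b ^+ 3 / 2)).
  by rewrite lt_min divr_gt0//= divr_gt0// mulr_gt0// exprn_gt0.
move=> k; rewrite lt_min => /andP[k1 k2].
have hbk : cabs b / 2 <= cabs (b + k).
  by have := cabs_dist_le b (- k); rewrite opprK cabsN; lra.
have bk0 : b + k != 0 by rewrite -cabs_gt0 (lt_le_trans _ hbk)// divr_gt0.
have -> : (w + k - a)^-1 - b^-1 - - b ^- 2 * k = k * k / (b ^+ 2 * (b + k)).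
  have -> : w + k - a = b + k by rewrite addrAC.
  by field; apply/andP.
rewrite !cabsM cabsV cabsM cabsX ler_pdivrMr; last first.
  by rewrite mulr_gt0// ?exprn_gt0// (lt_le_trans _ hbk)// divr_gt0.
rewrite [e * _]mulrC -mulrA ler_wpM2l ?cabs_ge0//.
apply: (le_trans (ltW k2)); have -> : e * cabs b ^+ 3 / 2 = e * (cabs b ^+ 2 * (cabs b / 2)).
  by field.
by rewrite !ler_wpM2l// ?exprn_ge0 ?cabs_ge0// ltW.
Qed.

Lemma cderB f g w c c' : cder f w c -> cder g w c' ->
  cder (fun z => f z - g z) w (c - c').
Proof.
move=> hf hg; have := cderD hf (cderM (cder_cst (-1) w) hg).
rewrite mul0r add0r mulN1r; congr cder.
by apply/funext => z; rewrite mulN1r.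
Qed.

End Cder.

(** * Mean values over circles *)

Lemma is_derive_approx (K : numFieldType) (V : normedModType K) (f : K -> V)
    (x : K) (l : V) : is_derive x 1 f l ->
  forall e : K, 0 < e -> exists2 d : K, 0 < d &
    forall s, `|s| < d -> `|f (x + s) - f x - s *: l| <= e * `|s|.
Proof.
move=> [df fl] e e0; have {fl}df : h^-1 *: (f (h *: 1 + x) - f x) @[h --> 0^'] --> l.
  by rewrite -fl; exact: df.
have /cvgrPdist_le /(_ _ e0) := df; rewrite /dnbhs /within /= => /nbhs_ballP[d /= d0 hd].
exists d => // s sd; have [->|s0] := eqVneq s 0.
  by rewrite addr0 subrr scale0r subr0 !normr0 mulr0.
have := hd s; rewrite /ball /= sub0r normrN => /(_ sd s0).
rewrite distrC -(ler_pM2l (_ : 0 < `|s|)) ?normr_gt0// -normrZ scalerBr scalerA.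
by rewrite mulfV// scale1r [s *: 1]mulr1 mulrC addrC [s + x]addrC [- _ + _]addrC.
Qed.

(** The complex exponential of [x + i y]: [x] is the logarithm of the radius and [y] the angle. *)
Definition polar {R : realType} (x y : R) : R[i] :=
  ((expR x * cos y) +i* (expR x * sin y))%C.

Section Polar.
Variable R : realType.

Lemma cabs_polar (x y : R) : cabs (polar x y) = expR x.
Proof.
apply/eqP; rewrite -(@eqrXn2 _ 2) ?cabs_ge0 ?expR_ge0// sqr_cabs /=.
by rewrite !exprMn -mulrDr cos2Dsin2 mulr1.
Qed.

Lemma polarD (x y s t : R) : polar (x + s) (y + t) = polar x y * polar s t.
Proof.
by rewrite /polar expRD cosD sinD; apply/eqP; rewrite eq_complex /=; apply/andP;
  split; apply/eqP; ring.
Qed.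

Lemma polar_period (x y : R) : polar x (y + 2 * pi) = polar x y.
Proof. by rewrite /polar mulr_natl cosD2pi sinD2pi. Qed.

Lemma polar0_approx (e : R) : 0 < e -> exists2 d : R, 0 < d &
  forall s t, `|s| < d -> `|t| < d ->
    cabs (polar s t - 1 - (s +i* t)%C) <= e * (`|s| + `|t|).
Proof.
(* The four error terms below add up to at most [8 e' (|s| + |t|)]; the bound [e' <= 1] controls the
   products. *)
move=> e0; pose e' := Num.min 1 (e / 8).
have e'0 : 0 < e' by rewrite lt_min ltr01 divr_gt0.
have e'1 : e' <= 1 by rewrite ge_min lexx.
have e'e : e' * 8 <= e by rewrite -ler_pdivlMr// ge_min lexx orbT.
clearbody e'.
have [d1 d10 h1] := is_derive_approx (@is_derive_expR R 0) e'0.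
have [d2 d20 h2] := is_derive_approx (@is_derive_cos R 0) e'0.
have [d3 d30 h3] := is_derive_approx (@is_derive_sin R 0) e'0.
exists (Num.min e' (Num.min d1 (Num.min d2 d3))); first by rewrite !lt_min e'0 d10 d20 d30.
move=> s t; rewrite !lt_min => /and4P[se' /h1 hs _ _] /and4P[te' _ /h2 hc /h3 hn].
apply: (le_trans (cabs_le_ReIm _)) => /=; move: hs hc hn.
rewrite !add0r expR0 cos0 sin0 oppr0 scaler0 !(subr0, addr0) /GRing.scale /= !mulr1 => hs
  hc hn.
have es : e' * `|s| <= `|s| by rewrite ler_piMl.
have et : e' * `|t| <= `|t| by rewrite ler_piMl.
set E := expR s in hs *; set c := cos t in hc *; set n := sin t in hn *.
have E2 : `|E - 1| <= 2 * `|s|.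
  have -> : E - 1 = (E - 1 - s) + s by ring.
  by apply: (le_trans (ler_normD _ _)); lra.
have E3 : `|E| <= 3.
  have -> : E = (E - 1) + 1 by ring.
  by apply: (le_trans (ler_normD _ _)); rewrite normr1; lra.
have n2 : `|n| <= 2 * `|t|.
  have -> : n = (n - t) + t by ring.
  by apply: (le_trans (ler_normD _ _)); lra.
have -> : E * c - 1 - s = (E - 1 - s) + E * (c - 1) by ring.
have -> : E * n - t = (n - t) + (E - 1) * n by ring.
have s0 := normr_ge0 s; have t0 := normr_ge0 t.
apply: (le_trans (lerD (ler_normD _ _) (ler_normD _ _))); rewrite !normrM.
have m1 : `|E| * `|c - 1| <= 3 * (e' * `|t|) by rewrite ler_pM.
have m2 : `|E - 1| * `|n| <= (2 * e') * (2 * `|t|).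
  by rewrite ler_pM// (le_trans E2)// ler_wpM2l// ltW.
have : e' * 8 * (`|s| + `|t|) <= e * (`|s| + `|t|) by rewrite ler_wpM2r// addr_ge0.
have := mulr_ge0 (ltW e'0) s0; have := mulr_ge0 (ltW e'0) t0.
lra.
Qed.

(** Chain rule through the exponential: the derivative is [D * polar x y]. Its real part is both the
    [x]-derivative of the real part and the [y]-derivative of the imaginary part, which is the
    divergence condition of [goursat]. *)
Lemma diff2_polar (g : R[i] -> R[i]) (c D : R[i]) (x y : R) :
  cder g (c + polar x y) D ->
  diff2 (fun x y => complex.Re (g (c + polar x y))) x y
    (complex.Re (D * polar x y)) (- complex.Im (D * polar x y)) /\
  diff2 (fun x y => complex.Im (g (c + polar x y))) x y
    (complex.Im (D * polar x y)) (complex.Re (D * polar x y)).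
Proof.
move=> hg; set P := polar x y.
suff key e : 0 < e -> exists2 d : R, 0 < d & forall s t, `|s| < d -> `|t| < d ->
    cabs (g (c + polar (x + s) (y + t)) - g (c + P) - D * P * (s +i* t)%C)
      <= e * (`|s| + `|t|).
  split=> e /key[d d0 hd]; exists d => // s t sd td;
    apply: le_trans (hd s t sd td).
    apply: le_trans (abs_Re_le _); rewrite le_eqVlt; apply/orP; left; apply/eqP.
    rewrite !(ReD, ReN) -/P; have -> : complex.Re (D * P * (s +i* t)%C) = complex.Re (D *
      P) * s - complex.Im (D * P) * t.
      by case: (D * P).
    by set a := complex.Re (D * P); set b := complex.Im (D * P); congr `| _ |; ring.
  apply: le_trans (abs_Im_le _); rewrite le_eqVlt; apply/orP; left; apply/eqP.
  rewrite !(ImD, ImN) -/P; have -> : complex.Im (D * P * (s +i* t)%C) = complex.Re (D * P)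
    * t + complex.Im (D * P) * s.
    by case: (D * P).
  by set a := complex.Re (D * P); set b := complex.Im (D * P); congr `| _ |; ring.
move=> e0; set E := expR x.
have E0 : 0 < E by exact: expR_gt0.
pose e1 := e / 4 / E; have e10 : 0 < e1 by rewrite !divr_gt0.
have [d1 d10 h1] := hg _ e10.
pose D1 := cabs D + 1; have D10 : 0 < D1 by rewrite ltr_wpDl ?cabs_ge0.
pose e2 := Num.min 1 (e / 2 / E / D1).
have e20 : 0 < e2 by rewrite lt_min ltr01 !divr_gt0.
have e21 : e2 <= 1 by rewrite ge_min lexx.
have e22 : e2 * (E * D1) <= e / 2.
  by rewrite -ler_pdivlMr ?mulr_gt0// invfM mulrA ge_min lexx orbT.
clearbody e2.
have [d2 d20 h2] := polar0_approx e20.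
pose d3 := d1 / (4 * E).
have d30 : 0 < d3 by rewrite divr_gt0// mulr_gt0.
exists (Num.min d2 d3); first by rewrite lt_min d20.
move=> s t; rewrite !lt_min => /andP[sd2 sd3] /andP[td2 td3].
have {h2} := h2 s t sd2 td2; set st := (s +i* t)%C => h2.
have nst : cabs st <= `|s| + `|t| by exact: (cabs_le_ReIm st).
have st0 : 0 <= `|s| + `|t| by rewrite addr_ge0.
have np : cabs (polar s t - 1) <= 2 * (`|s| + `|t|).
  have -> : polar s t - 1 = (polar s t - 1 - st) + st by rewrite subrK.
  apply: (le_trans (cabsD _ _)).
  by have := ler_wpM2r st0 e21; lra.
pose k := P * (polar s t - 1).
have nk : cabs k <= E * (2 * (`|s| + `|t|)).
  by rewrite cabsM cabs_polar ler_wpM2l// ltW.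
have kd : cabs k < d1.
  apply: (le_lt_trans nk); rewrite mulrA -ltr_pdivlMl ?mulr_gt0//.
  have -> : (E * 2)^-1 * d1 = d3 + d3 by rewrite /d3; field; rewrite gt_eqF.
  exact: ltrD.
have := h1 k kd.
have -> : c + P + k = c + polar (x + s) (y + t) by rewrite polarD /k -/P; ring.
set G := g _; set G0 := g _ => hG.
have -> : G - G0 - D * P * st = (G - G0 - D * k) + D * P * (polar s t - 1 - st).
  by rewrite /k; ring.
apply: (le_trans (cabsD _ _)); rewrite !cabsM cabs_polar -/E.
have a1 : cabs (G - G0 - D * k) <= e / 2 * (`|s| + `|t|).
  apply: (le_trans hG); have -> : e / 2 * (`|s| + `|t|) = e1 * (E * (2 * (`|s| + `|t|))).
    by rewrite /e1; field; rewrite gt_eqF.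
  by rewrite ler_wpM2l// ltW.
have a2 : cabs D * E * cabs (polar s t - 1 - st) <= e / 2 * (`|s| + `|t|).
  apply: (@le_trans _ _ (e2 * (E * D1) * (`|s| + `|t|))); last by rewrite ler_wpM2r.
  rewrite [leRHS](_ : _ = (D1 * E) * (e2 * (`|s| + `|t|))); last by ring.
  by rewrite ler_pM ?mulr_ge0 ?cabs_ge0 ?(ltW E0)// ler_wpM2r ?(ltW E0)// lerDl.
lra.
Qed.

(* Integrating over logarithmic rectangles [x0,x1] x [0,2pi], the horizontal
   sides cancel by periodicity, so circular means do not depend on the radius. *)
Lemma mean_value_gt (g : R[i] -> R[i]) (c : R[i]) (s k : R) : 0 < s -> 0 < k ->
  (forall w, cabs (w - c) <= s -> exists D, cder g w D) ->
  exists2 w, cabs (w - c) = s & complex.Re (g c) - k < complex.Re (g w).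
Proof.
move=> s0 k0 hg; apply: contrapT => hn.
have hle w : cabs (w - c) = s -> complex.Re (g w) <= complex.Re (g c) - k.
  by move=> ws; rewrite leNgt; apply/negP => lt; apply: hn; exists w.
have [|D /cder_cts] := hg c; first by rewrite subrr cabs0 ltW.
have k2 : 0 < k / 2 by rewrite divr_gt0.
move=> /(_ _ k2)[d d0 hd].
pose s' := Num.min s d / 2.
have s'0 : 0 < s' by rewrite divr_gt0// lt_min s0.
have s's : s' < s by rewrite ltr_pdivrMr// gt_min ltr_pMr// ltr1n.
have s'd : s' < d by rewrite ltr_pdivrMr// gt_min [X in _ || X]ltr_pMr// ltr1n orbT.
have x01 : ln s' < ln s by rewrite ltr_ln ?posrE.
pose u x y := complex.Re (g (c + polar x y)).
pose v x y := complex.Im (g (c + polar x y)).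
have df x y : x <= ln s -> exists A B C : R, diff2 u x y A B /\ diff2 v x y C A.
  move=> xs; have [|D' /diff2_polar[hu hv]] := hg (c + polar x y).
    by rewrite addrAC subrr add0r cabs_polar -ler_ln ?posrE ?expR_gt0// expRK.
  by do 3 eexists; split; [exact: hu|exact: hv].
have pi2 : 0 < 2 * pi :> R by rewrite mulr_gt0// pi_gt0.
have flux0 := goursat x01 pi2 (fun x y hx _ => df x y (proj2 (andP hx))).
have vE : intv (ln s') (ln s) (v ^~ (2 * pi)) = intv (ln s') (ln s) (v ^~ 0).
  by apply: eq_intv => x; rewrite /v -[2 * pi]add0r polar_period.
(* The real part is at most [Re (g c) - k] on the outer circle and at least [Re (g c) - k / 2] on
   the small inner one, so the two integrals differ, against [goursat]. *)
suff : intv 0 (2 * pi) (u (ln s)) - intv 0 (2 * pi) (u (ln s')) < 0.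
  by rewrite flux0 vE subrr ltxx.
have cts x y : x <= ln s -> {for y, continuous (u x)}.
  by move=> /(df _ y)[A [B [C [/diff2_contr]]]].
apply: (@le_lt_trans _ _ ((- (k / 2)) * (2 * pi - 0))); last first.
  by rewrite subr0 mulNr oppr_lt0 mulr_gt0.
apply: intv_diff_le; first exact: ltW.
- by move=> y _; exact: cts.
- by move=> y _; apply: cts; exact: ltW.
move=> y _; rewrite /u.
have h1 : complex.Re (g (c + polar (ln s) y)) <= complex.Re (g c) - k.
  by apply: hle; rewrite addrAC subrr add0r cabs_polar lnK ?posrE.
have : `|complex.Re (g (c + polar (ln s') y) - g c)| <= k / 2.
  by apply: (le_trans (abs_Re_le _)); apply: hd; rewrite cabs_polar lnK ?posrE.
rewrite ReD ReN ler_norml lerBrDl => /andP[h2 _].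
by apply: (le_trans (lerB h1 h2)); rewrite le_eqVlt; apply/orP; left; apply/eqP; field.
Qed.

End Polar.

(** * Maximum principle *)

Definition ccts {R : realType} (F : R[i] -> R) (w : R[i]) : Prop :=
  forall e : R, 0 < e -> exists2 d : R, 0 < d &
    forall k, cabs k < d -> `|F (w + k) - F w| <= e.

Lemma cctsD (R : realType) (F G : R[i] -> R) (w : R[i]) :
  ccts F w -> ccts G w -> ccts (fun z => F z + G z) w.
Proof.
move=> hF hG e e0; have e2 : 0 < e / 2 by rewrite divr_gt0.
have [d d0 hd] := hF _ e2; have [d' d'0 hd'] := hG _ e2.
exists (Num.min d d'); first by rewrite lt_min d0.
move=> k; rewrite lt_min => /andP[/hd + /hd'].
by rewrite !ler_norml => /andP[? ?] /andP[? ?]; apply/andP; split; lra.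
Qed.

Lemma ccts_sqr (R : realType) (h : R[i] -> R[i]) (w : R[i]) :
  (forall e : R, 0 < e -> exists2 d : R, 0 < d &
     forall k, cabs k < d -> cabs (h (w + k) - h w) <= e) ->
  ccts (fun z => cabs (h z) ^+ 2) w.
Proof.
move=> hh e e0; pose K := 2 * cabs (h w) + 1.
have K0 : 0 < K by rewrite ltr_wpDl ?mulr_ge0 ?cabs_ge0.
pose e' := Num.min 1 (e / K).
have e'0 : 0 < e' by rewrite lt_min ltr01 divr_gt0.
have e'1 : e' <= 1 by rewrite ge_min lexx.
have e'K : e' * K <= e by rewrite -ler_pdivlMr// ge_min lexx orbT.
have [d d0 hd] := hh _ e'0; exists d => // k /hd {}hd.
have h1 := cabs_dist_le (h (w + k)) (h w).
have h2 := cabs_dist_le (h w) (h (w + k)); rewrite cabsC in h2.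
have a0 := cabs_ge0 (h w); have b0 := cabs_ge0 (h (w + k)).
rewrite subr_sqr normrM.
have n1 : `|cabs (h (w + k)) - cabs (h w)| <= e' by rewrite ler_norml; lra.
have n2 : `|cabs (h (w + k)) + cabs (h w)| <= K by rewrite ger0_norm ?addr_ge0// /K; lra.
by apply: le_trans e'K; rewrite ler_pM.
Qed.

(** The disc is parametrised by a closed subset of a square in [R * R], where the extreme value
    theorem applies. *)
Lemma disc_max (R : realType) (F : R[i] -> R) (rho : R) : 0 <= rho ->
  (forall w, cabs w <= rho -> ccts F w) ->
  exists2 c, cabs c <= rho & forall w, cabs w <= rho -> F w <= F c.
Proof.
move=> rho0 cF.
pose A : set (R * R) := [set p | p.1 ^+ 2 + p.2 ^+ 2 <= rho ^+ 2].
pose phi (p : R * R) : R[i] := (p.1 +i* p.2)%C.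
have Aphi p : A p <-> cabs (phi p) <= rho.
  by rewrite -ler_sqr ?nnegrE ?cabs_ge0// sqr_cabs.
have cA : compact A.
  apply: (@subclosed_compact _ _ (`[- rho, rho] `*` `[- rho, rho])).
  - have -> : A = (fun p : R * R => p.1 ^+ 2 + p.2 ^+ 2) @^-1` [set x | x <= rho ^+ 2] by [].
    apply: closed_comp; last exact: closed_le.
    move=> p _; apply: cvgD.
      by apply: (@continuous_comp _ _ _ fst (fun x : R => x ^+ 2)); [exact: cvg_fst|exact:
        exprn_continuous].
    by apply: (@continuous_comp _ _ _ snd (fun x : R => x ^+ 2)); [exact: cvg_snd|exact:
      exprn_continuous].
  - by apply: compact_setX; exact: segment_compact.
  - move=> [x y] /Aphi h /=; rewrite !in_itv /= -!ler_norml; split.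
      exact: (le_trans (abs_Re_le (phi (x, y)))).
    exact: (le_trans (abs_Im_le (phi (x, y)))).
have A0 : A !=set0 by exists (0, 0); rewrite /A /= expr0n /= addr0 sqr_ge0.
have [|[x y] /set_mem /Aphi Ac hc] := @compact_EVT_max _ R (F \o phi) A A0 cA.
  apply: continuous_in_subspaceT => -[x y] /set_mem /Aphi Ap.
  apply/cvgrPdist_le => e /(cF _ Ap)[d d0 hd].
  have d2 : 0 < d / 2 by rewrite divr_gt0.
  exists (ball x (d / 2), ball y (d / 2)).
    by split; apply/nbhs_ballP; exists (d / 2).
  move=> [x' y'] [/= xx' yy'].
  have := hd (phi (x', y') - phi (x, y)); rewrite [phi (x, y) + _]addrC subrK distrC; apply.
  apply: (le_lt_trans (cabs_le_ReIm _)) => /=.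
  by rewrite [`|x' - x|]distrC [`|y' - y|]distrC (splitr d) ltrD.
exists (phi (x, y)) => // w hw.
have := hc (complex.Re w, complex.Im w); rewrite /phi /=.
have -> : (complex.Re w +i* complex.Im w)%C = w by case: (w).
by apply; apply/mem_set/Aphi; rewrite /phi /=; case: (w) hw.
Qed.

Section MaxPrinciple.
Variable R : realType.

(** This is [|z - w|^2 >= 0] expanded. It bounds the squared modulus from below by the real part of
    a function that is holomorphic in [z], to which [mean_value_gt] applies. *)
Lemma sqr_cabs_ge (z w : R[i]) :
  complex.Re (2 * (w^*)%C * z) - cabs w ^+ 2 <= cabs z ^+ 2.
Proof.
rewrite -subr_ge0; have -> : cabs z ^+ 2 - (complex.Re (2 * (w^*)%C * z) - cabs w ^+ 2) =
    (complex.Re z - complex.Re w) ^+ 2 + (complex.Im z - complex.Im w) ^+ 2.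
  by rewrite !sqr_cabs; case: z w => [a b] [c d] /=; ring.
by rewrite addr_ge0 ?sqr_ge0.
Qed.

(* The perturbation [eta |w|^2] makes the maximum strictly violate the mean value
   inequality, which avoids any unique continuation argument. *)
Lemma maximum_principle (H : R[i] -> R[i]) (rho M : R) : 0 <= rho -> 0 <= M ->
  (forall w, cabs w <= rho -> forall e : R, 0 < e -> exists2 d : R, 0 < d &
     forall k, cabs k < d -> cabs (H (w + k) - H w) <= e) ->
  (forall c, cabs c < rho -> H c != 0 -> exists2 s : R, 0 < s &
     forall w, cabs (w - c) <= s -> exists D, cder H w D) ->
  (forall w, cabs w = rho -> cabs (H w) <= M) ->
  forall w, cabs w <= rho -> cabs (H w) <= M.
Proof.
move=> rho0 M0 ctsH dH HM w0 w0rho; rewrite leNgt; apply/negP => Mw0.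
pose Delta := cabs (H w0) ^+ 2 - M ^+ 2.
have D0 : 0 < Delta by rewrite subr_gt0 ltrXn2r ?nnegrE ?cabs_ge0.
have [eta [eta0 eta1 etaD]] : exists eta : R, [/\ 0 < eta, eta <= 1 & eta * (rho ^+ 2 + 1)
  <= Delta].
  have r1 : 0 < rho ^+ 2 + 1 by rewrite ltr_wpDl ?sqr_ge0.
  exists (Num.min 1 (Delta / (rho ^+ 2 + 1))); split.
  - by rewrite lt_min ltr01 divr_gt0.
  - by rewrite ge_min lexx.
  - by rewrite -ler_pdivlMr// ge_min lexx orbT.
have eta2 : eta ^+ 2 * rho ^+ 2 < Delta.
  apply: (@le_lt_trans _ _ (eta * rho ^+ 2)).
    by rewrite ler_wpM2r ?sqr_ge0// expr2 ler_piMl// ltW.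
  by apply: lt_le_trans etaD; rewrite mulrDr mulr1 ltrDl.
pose F w := cabs (H w) ^+ 2 + cabs (eta%:C%C * w) ^+ 2.
have FE w : F w = cabs (H w) ^+ 2 + eta ^+ 2 * cabs w ^+ 2.
  by rewrite /F cabsM cabsR exprMn real_normK ?num_real.
have [c crho cmax] : exists2 c, cabs c <= rho & forall w, cabs w <= rho -> F w <= F c.
  apply: disc_max => // w wrho; apply: cctsD; apply: ccts_sqr; first exact: ctsH.
  exact: cder_cts (cderM (cder_cst _ _) (cder_id _)).
have Fw0 := cmax _ w0rho.
have F0 : M ^+ 2 + eta ^+ 2 * rho ^+ 2 < F c.
  apply: lt_le_trans Fw0; rewrite FE; apply: (@lt_le_trans _ _ (cabs (H w0) ^+ 2)).
    by rewrite -ltrBrDl.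
  by rewrite lerDl mulr_ge0 ?sqr_ge0.
move: crho; rewrite le_eqVlt => /predU1P[crho|crho].
  move: F0; rewrite FE crho ltrD2r; apply/negP; rewrite -leNgt.
  by rewrite ler_sqr ?nnegrE ?cabs_ge0// HM.
(* At a zero of [H] only the perturbation is left, which is too small to be the maximum. This is why
   differentiability is requested where [H] does not vanish. *)
have Hc0 : H c != 0.
  apply/eqP => Hc; move: F0; rewrite FE Hc cabs0 expr0n add0r; apply/negP; rewrite -leNgt.
  apply: (@le_trans _ _ (eta ^+ 2 * rho ^+ 2)); last by rewrite lerDr sqr_ge0.
  by rewrite ler_wpM2l ?sqr_ge0// ler_sqr ?nnegrE ?cabs_ge0// ltW.
have [s1 s10 hs1] := dH c crho Hc0.
pose s := Num.min s1 (rho - cabs c).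
have s0 : 0 < s by rewrite lt_min s10 subr_gt0.
have k0 : 0 < eta ^+ 2 * s ^+ 2 by rewrite mulr_gt0 ?exprn_gt0.
(* The real part of [g] linearises [F] at [c], with [Re (g c) = 2 F c]. On the circle of radius [s]
   the square [|w|^2] exceeds its linearisation by exactly [s^2]; this gain [eta^2 s^2] offsets the
   slack of [mean_value_gt] and gives [F w > F c]. *)
pose g w := 2 * ((H c)^*)%C * H w + (eta ^+ 2)%:C%C * (2 * (c^*)%C) * w.
have [|w ws] := @mean_value_gt R g c s _ s0 k0.
  move=> w ws; have [|D hD] := hs1 w; first by rewrite (le_trans ws)// ge_min lexx.
  by eexists; apply: cderD; [exact: cderM (cder_cst _ _) hD|exact: cderM (cder_cst _ _)
    (cder_id _)].
have wrho : cabs w <= rho.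
  have := cabsD c (w - c); rewrite addrC subrK ws => /le_trans; apply.
  by rewrite -lerBrDl ge_min lexx orbT.
apply/negP; rewrite -leNgt.
have := cmax _ wrho; rewrite !FE.
have := sqr_cabs_ge (H w) (H c); have := sqr_cabs_ge w c.
have -> : complex.Re (g w) = complex.Re (2 * ((H c)^*)%C * H w) + eta ^+ 2 * complex.Re (2
  * (c^*)%C * w).
  by rewrite /g ReD; congr (_ + _); case: (w) => ? ?; case: (c) => ? ? /=; ring.
have -> : complex.Re (g c) = 2 * cabs (H c) ^+ 2 + eta ^+ 2 * (2 * cabs c ^+ 2).
  by rewrite /g ReD !sqr_cabs; case: (H c) => ? ?; case: (c) => ? ? /=; ring.
have ww : cabs w ^+ 2 = complex.Re (2 * (c^*)%C * w) - cabs c ^+ 2 + s ^+ 2.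
  rewrite -ws !sqr_cabs !(ReD, ImD, ReN, ImN); case: (w) => ? ?; case: (c) => ? ? /=; ring.
rewrite ww; set x := complex.Re (2 * (c^*)%C * w); set y := complex.Re (_ * H w).
set p := cabs (H c) ^+ 2; set q := cabs c ^+ 2; set r := cabs (H w) ^+ 2.
lra.
Qed.

End MaxPrinciple.

(** * Taylor expansion of bounded holomorphic functions *)

(** Otherwise [(x / y)^n] grows at least linearly by Bernoulli's inequality and passes [k^-1]. *)
Lemma le_of_exprn_le (R : realType) (x y k : R) : 0 < y -> 0 < k ->
  (forall n, x ^+ n * k <= y ^+ n) -> x <= y.
Proof.
move=> y0 k0 h; rewrite leNgt; apply/negP => yx.
pose t := x / y - 1.
have t0 : 0 < t by rewrite subr_gt0 ltr_pdivlMr// mul1r.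
have bern n : 1 + n%:R * t <= (x / y) ^+ n.
  have -> : x / y = 1 + t by rewrite addrC subrK.
  elim: n => [|n IH]; first by rewrite mul0r addr0 expr0.
  rewrite exprS; apply: (@le_trans _ _ ((1 + t) * (1 + n%:R * t))).
    rewrite -natr1; have : 0 <= n%:R * t * t by rewrite !mulr_ge0// ltW.
    lra.
  by rewrite ler_wpM2l// ltW// addr_gt0.
have bnd n : n%:R * t <= k^-1.
  apply: (@le_trans _ _ ((x / y) ^+ n)); first by have := bern n; lra.
  rewrite -[k^-1]div1r ler_pdivlMr// expr_div_n mulrAC ler_pdivrMr ?exprn_gt0// mul1r.
  exact: h.
have k1 : 0 <= k^-1 / t by rewrite divr_ge0// ?invr_ge0 ltW.
have := archi_boundP k1; set n := Num.bound _.
by rewrite ltr_pdivrMr// ltNge bnd.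
Qed.

Definition bounded_on_punctured_disc {R : realType} (h : R[i] -> R[i]) (M : R) : Prop :=
  forall w, 0 < cabs w < 1 -> (exists D, cder h w D) /\ cabs (h w) <= M.

Section Removable.
Variable R : realType.
Implicit Types (h : R[i] -> R[i]) (M : R).

(* The maximum principle is applied to [q^N w (w - a)] with
   [q w = (h w - h a) / (w - a)], and [N] tends to infinity. *)
Lemma punctured_disc_lipschitz h M : 0 < M -> bounded_on_punctured_disc h M ->
  forall a w, 0 < cabs a < 1 / 4 -> 0 < cabs w <= 1 / 2 ->
    cabs (h w - h a) <= 8 * M * cabs (w - a).
Proof.
move=> M0 hM a w0 /andP[a0 a4] /andP[w0' w02].
have [->|wa] := eqVneq w0 a; first by rewrite !subrr cabs0 mulr0.
have hb w : 0 < cabs w < 1 -> cabs (h w) <= M by move=> /hM[].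
have aM : cabs (h a) <= M by apply: hb; rewrite a0; lra.
have hd w : cabs w <= 1 / 2 -> w != 0 -> exists D, cder h w D.
  by move=> w2; rewrite -cabs_gt0 => w00; have [|//] := hM w; rewrite w00; lra.
pose q w := (h w - h a) * (w - a)^-1.
have qE w : cabs (q w) = cabs (h w - h a) / cabs (w - a) by rewrite cabsM cabsV.
have hdiff w : 0 < cabs w < 1 -> cabs (h w - h a) <= 2 * M.
  by move=> /hb ?; apply: (le_trans (cabsB _ _)); lra.
(* The factor [w * (w - a)] makes [H N] vanish continuously at [0] and at [a], where [q] is bounded
   nearby but may take an arbitrary value. *)
pose H N w := q w ^+ N * (w * (w - a)).
have HE N w : cabs (H N w) = cabs (q w) ^+ N * (cabs w * cabs (w - a)).
  by rewrite /H cabsM cabsX (cabsM w).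
have dH N w : cabs w <= 1 / 2 -> w != 0 -> w != a -> exists D, cder (H N) w D.
  move=> w2 wn0 wna; have [D hD] := hd w w2 wn0.
  have [D' hD'] := cderX N (cderM (cderB hD (cder_cst (h a) w)) (cder_invB wna)).
  eexists; exact: cderM hD' (cderM (cder_id w) (cderB (cder_id w) (cder_cst a w))).
have H0 N : H N 0 = 0 by rewrite /H mul0r mulr0.
have Ha N : H N a = 0 by rewrite /H subrr !mulr0.
have small N c K r : H N c = 0 -> 0 < r -> 0 <= K ->
    (forall k, cabs k < r -> cabs (H N (c + k)) <= K * cabs k) ->
    forall e : R, 0 < e -> exists2 d : R, 0 < d &
     forall k, cabs k < d -> cabs (H N (c + k) - H N c) <= e.
  move=> Hc r0 K0 hK e e0; exists (Num.min r (e / (K + 1))).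
    by rewrite lt_min r0 divr_gt0// ltr_wpDl.
  move=> k; rewrite lt_min => /andP[/hK {}hK ke]; rewrite Hc subr0.
  apply: (le_trans hK); apply: (@le_trans _ _ ((K + 1) * cabs k)).
    by rewrite ler_wpM2r ?cabs_ge0// lerDl.
  by rewrite mulrC -ler_pdivlMr ?ltW// ltr_wpDl.
have ctsH N w : cabs w <= 1 / 2 -> forall e : R, 0 < e -> exists2 d : R, 0 < d &
     forall k, cabs k < d -> cabs (H N (w + k) - H N w) <= e.
  move=> w2; have [->|wn0] := eqVneq w 0.
    pose K := 2 * M / (cabs a / 2).
    have K0 : 0 <= K by rewrite !(divr_ge0, mulr_ge0)// ltW.
    apply: (@small N 0 (K ^+ N) (cabs a / 2)) => //; rewrite ?divr_gt0 ?exprn_ge0//.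
    move=> k ka; rewrite add0r; have [->|kn0] := eqVneq k 0.
      by rewrite H0 cabs0 mulr0.
    have k0 : 0 < cabs k by rewrite cabs_gt0.
    have kaa : cabs a / 2 <= cabs (k - a) by have := cabs_dist_le a k; rewrite cabsC; lra.
    have ka1 : cabs (k - a) <= 1 by apply: (le_trans (cabsB _ _)); lra.
    rewrite HE ler_pM ?exprn_ge0 ?mulr_ge0 ?cabs_ge0//; last first.
      by rewrite ler_piMr// cabs_ge0.
    rewrite lerXn2r ?nnegrE ?cabs_ge0// qE ler_pM ?cabs_ge0 ?invr_ge0 ?cabs_ge0//.
      by apply: hdiff; rewrite k0; lra.
    by rewrite lef_pV2 ?posrE ?divr_gt0// (lt_le_trans _ kaa)// divr_gt0.
  have [->|wna] := eqVneq w a.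
    have an0 : a != 0 by rewrite -cabs_gt0.
    have [|D /cder_lip[d d0 hL]] := hd a _ an0; first by lra.
    have K0 : 0 <= cabs D + 1 by rewrite addr_ge0// cabs_ge0.
    apply: (@small N a ((cabs D + 1) ^+ N) (Num.min d (1 / 4))) => //; rewrite ?lt_min ?d0
      ?divr_gt0 ?exprn_ge0//.
    move=> k; rewrite lt_min => /andP[/hL {}hL k4]; have [->|kn0] := eqVneq k 0.
      by rewrite addr0 Ha cabs0 mulr0.
    have k0 : 0 < cabs k by rewrite cabs_gt0.
    have E : a + k - a = k by rewrite addrAC subrr add0r.
    rewrite HE qE E ler_pM ?exprn_ge0 ?divr_ge0 ?mulr_ge0 ?cabs_ge0//.
      by rewrite lerXn2r ?nnegrE ?divr_ge0 ?cabs_ge0// ler_pdivrMr.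
    rewrite ler_piMl ?cabs_ge0//; apply: (le_trans (cabsD _ _)); lra.
  by have [D /cder_cts] := dH N w w2 wn0 wna.
(* Origin of the constant 8: on this circle [|h w - h a| <= 2 M] and [|w - a| >= 1 / 4]. *)
have bH N w : cabs w = 1 / 2 -> cabs (H N w) <= (8 * M) ^+ N.
  move=> w2; have wa4 : 1 / 4 <= cabs (w - a) by have := cabs_dist_le w a; lra.
  have wa1 : cabs (w - a) <= 1 by apply: (le_trans (cabsB _ _)); lra.
  rewrite HE -[leRHS]mulr1 ler_pM ?exprn_ge0 ?mulr_ge0 ?cabs_ge0//; last first.
    by rewrite w2; lra.
  have M8 : 0 <= 8 * M by rewrite mulr_ge0// ltW.
  rewrite lerXn2r ?nnegrE ?cabs_ge0// qE ler_pdivrMr; last by lra.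
  have := hdiff w; rewrite w2 => /(_ _)/le_trans; apply; first by lra.
  have : 8 * M * (1 / 4) <= 8 * M * cabs (w - a) by rewrite ler_wpM2l.
  by lra.
have key N : cabs (H N w0) <= (8 * M) ^+ N.
  apply: (@maximum_principle _ (H N) (1 / 2)) => //; rewrite ?exprn_ge0 ?mulr_ge0 ?ltW//.
  - exact: ctsH.
  - move=> c c2 Hc0.
    have cn0 : c != 0 by apply: contraNneq Hc0 => ->; rewrite H0.
    have cna : c != a by apply: contraNneq Hc0 => ->; rewrite Ha.
    pose s := Num.min (1 / 2 - cabs c) (Num.min (cabs c) (cabs (c - a))) / 2.
    have m0 : 0 < Num.min (1 / 2 - cabs c) (Num.min (cabs c) (cabs (c - a))).
      by rewrite !lt_min subr_gt0 c2 !cabs_gt0 cn0 subr_eq0.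
    exists s; first by rewrite divr_gt0.
    move=> w ws; have lt_s : cabs (w - c) < Num.min (1 / 2 - cabs c) (Num.min (cabs c)
      (cabs (c - a))).
      by apply: (le_lt_trans ws); rewrite /s ltr_pdivrMr// ltr_pMr// ltr1n.
    move: lt_s; rewrite !lt_min => /and3P[l1 l2 l3]; apply: dH.
    + by have := cabsD (w - c) c; rewrite subrK; lra.
    + by apply: contraTneq l2 => ->; rewrite sub0r cabsN ltxx.
    + by apply: contraTneq l3 => ->; rewrite cabsC ltxx.
  - exact: bH.
have wa0 : 0 < cabs (w0 - a) by rewrite cabs_gt0 subr_eq0.
have : cabs (q w0) <= 8 * M.
  apply: (@le_of_exprn_le _ _ _ (cabs w0 * cabs (w0 - a))); rewrite ?mulr_gt0//.
  by move=> N; rewrite -HE; exact: key.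
by rewrite qE ler_pdivrMr.
Qed.

(** The Lipschitz bound makes [h] Cauchy along a real sequence tending to 0; its limit [b] is the
    value that removes the singularity. *)
Lemma punctured_disc_limit h M : 0 < M -> bounded_on_punctured_disc h M ->
  exists b, cabs b <= M /\ forall w, 0 < cabs w < 1 -> cabs (h w - b) <= 8 * M * cabs w.
Proof.
move=> M0 hM; have lip := punctured_disc_lipschitz M0 hM.
(* The shift by 5 puts every term below 1/4, the range of [punctured_disc_lipschitz]. *)
pose a (n : nat) : R := (n + 5)%:R^-1.
have a0 n : 0 < a n by rewrite invr_gt0 ltr0n addnC.
have a4 n : a n < 1 / 4.
  by rewrite div1r ltf_pV2 ?posrE ?ltr0n ?addnS// ltr_nat !ltnS leq_addl.
have aS n : a n.+1 <= a n by rewrite lef_pV2 ?posrE ?ltr0n ?addnS// ler_nat.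
have na n : cabs (a n)%:C%C = a n by rewrite cabsR gtr0_norm.
pose hn n := h (a n)%:C%C.
have hS n : cabs (hn n.+1 - hn n) <= 8 * M * (a n - a n.+1).
  have aS2 : a n.+1 <= 1 / 2 by have := a4 n.+1; lra.
  have := lip (a n)%:C%C (a n.+1)%:C%C; rewrite !na !a0 a4 aS2 => /(_ isT isT).
  congr (_ <= _ * _).
  have -> : (a n.+1)%:C%C - (a n)%:C%C = (a n.+1 - a n)%:C%C by rewrite rmorphB.
  by rewrite cabsR distrC ger0_norm// subr_ge0.
(* For [p] the real or the imaginary part, the segments of radius [8 M a n] around [p (hn n)] are
   nested, because consecutive values differ by at most [8 M (a n - a n.+1)]. *)
have part (p : R[i] -> R) : (forall z w, p (z - w) = p z - p w) ->
    (forall z, `|p z| <= cabs z) ->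
    exists x, forall n, `|p (hn n) - x| <= 8 * M * a n.
  move=> pB pn.
  have [|||x hx] := @nested_segments _ (fun n => p (hn n) - 8 * M * a n)
     (fun n => p (hn n) + 8 * M * a n).
  - by move=> n; have := le_trans (pn _) (hS n); rewrite pB ler_norml; lra.
  - by move=> n; have := le_trans (pn _) (hS n); rewrite pB ler_norml; lra.
  - by move=> n; have := mulr_gt0 M0 (a0 n); lra.
  by exists x => n; have := hx n; rewrite ler_norml; lra.
have [x hx] := part (@complex.Re R) (fun z w => etrans (ReD z (- w)) (congr1 _ (ReN w)))
  (@abs_Re_le R).
have [y hy] := part (@complex.Im R) (fun z w => etrans (ImD z (- w)) (congr1 _ (ImN w)))
  (@abs_Im_le R).
pose b := (x +i* y)%C.
have hb n : cabs (hn n - b) <= 16 * M * a n.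
  apply: (le_trans (cabs_le_ReIm _)); rewrite ReD ImD ReN ImN /=.
  by have := hx n; have := hy n; lra.
have arb (u v K : R) : 0 < K -> (forall n, u <= v + K * a n) -> u <= v.
  move=> K0 h'; apply/ler_addgt0Pr => e e0.
  have K1 : 0 <= K / e by rewrite divr_ge0// ltW.
  have := archi_boundP K1; set n := Num.bound _ => Ke.
  apply: (le_trans (h' n)); rewrite lerD2l /a ler_pdivrMr; last by rewrite ltr0n addnS.
  rewrite ltr_pdivrMr// in Ke; apply: (le_trans (ltW Ke)).
  by rewrite mulrC ler_wpM2l ?(ltW e0)// ler_nat leq_addr.
have bM : cabs b <= M.
  apply: (@arb _ _ (16 * M)); first by rewrite mulr_gt0.
  move=> n; have [|_ hnM] := hM (a n)%:C%C; first by rewrite na a0; have := a4 n; lra.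
  have := cabs_dist_le b (hn n); rewrite cabsC; have := hb n; rewrite -/(hn n) in hnM; lra.
exists b; split => // w /andP[w0 w1].
(* Beyond radius 1/2 the trivial bound [2 M] already lies below [8 M |w|]. *)
have [w2|w2] := leP (cabs w) (1 / 2); last first.
  apply: (le_trans (cabsB _ _)); have [|_ ?] := hM w; first by rewrite w0.
  have : 8 * M * (1 / 2) <= 8 * M * cabs w by rewrite ler_wpM2l ?mulr_ge0 ?ltW.
  lra.
apply: (@arb _ _ (24 * M)); first by rewrite mulr_gt0.
move=> n; have := lip (a n)%:C%C w; rewrite na a0 a4 w0 w2 => /(_ isT isT) hl.
have -> : h w - b = (h w - hn n) + (hn n - b) by ring.
apply: (le_trans (cabsD _ _)); have := hb n.
have : 8 * M * cabs (w - (a n)%:C%C) <= 8 * M * (cabs w + a n).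
  by rewrite ler_wpM2l ?mulr_ge0 ?(ltW M0)// (le_trans (cabsB _ _))// na.
rewrite -/(hn n) in hl; lra.
Qed.

(** Subtracting the limit and dividing by [w] stays in the same class, so the Taylor coefficients
    can be peeled off one at a time, at the cost of a factor 8 each. *)
Lemma punctured_disc_step h M : 0 < M -> bounded_on_punctured_disc h M ->
  exists b, cabs b <= M /\ bounded_on_punctured_disc (fun w => (h w - b) * w^-1) (8 * M).
Proof.
move=> M0 hM; have [b [bM hb]] := punctured_disc_limit M0 hM; exists b; split => // w w01.
have w0 : 0 < cabs w by case/andP: w01.
have wn0 : w != 0 by rewrite -cabs_gt0.
split; last by rewrite cabsM cabsV ler_pdivrMr// hb.
have [[D hD] _] := hM w w01; eexists.
have := cderM (cderB hD (cder_cst b w)) (cder_invB wn0).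
have -> : (fun z => (h z - b) * (z - 0)^-1) = (fun z => (h z - b) * z^-1).
  by apply/funext => z; rewrite subr0.
by apply.
Qed.

Lemma le0_of_le_linear (x L : R) : (forall t : R, 0 < t < 1 -> x <= L * t) -> x <= 0.
Proof.
  move=> hx; rewrite leNgt; apply/negP => x0.
  have L1 : 0 < `|L| + 1 by rewrite ltr_wpDl.
  pose t := Num.min (1 / 2) (x / (2 * (`|L| + 1))).
  have t0 : 0 < t by rewrite lt_min divr_gt0// divr_gt0// mulr_gt0.
  have t1 : t < 1 by rewrite gt_min; apply/orP; left; lra.
  have tL : t * (2 * (`|L| + 1)) <= x by rewrite -ler_pdivlMr ?mulr_gt0// ge_min lexx orbT.
  have := hx t; rewrite t0 t1 => /(_ isT).
  have : L * t <= `|L| * t by rewrite ler_wpM2r ?ler_norm// ltW.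
  have := mulr_ge0 (normr_ge0 L) (ltW t0); lra.
Qed.

(** Three peelings bound the successive quotients by [8 M], [64 M] and [512 M]; these serve as
    Cauchy estimates for the coefficients and the remainder. *)
Lemma disc_taylor (F : R[i] -> R[i]) (M : R) (D : R[i]) : 0 < M ->
  (forall w, cabs w < 1 -> (exists D, cder F w D) /\ cabs (F w) <= M) ->
  cder F 0 D ->
  cabs D <= 8 * M /\ exists2 b, cabs b <= 64 * M &
    forall w, cabs w < 1 ->
      cabs (F w - F 0 - D * w - b * w ^+ 2) <= 512 * M * cabs w ^+ 3.
Proof.
move=> M0 hF hD.
have h0 : bounded_on_punctured_disc F M by move=> w /andP[_ /hF].
have M8 : 0 < 8 * M by rewrite mulr_gt0.
have M64 : 0 < 8 * (8 * M) by rewrite mulr_gt0.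
have [b0 [_ h1]] := punctured_disc_step M0 h0.
have [b1 [b1M h2]] := punctured_disc_step M8 h1.
have [b2 [b2M h3]] := punctured_disc_step M64 h2.
have expand w : 0 < cabs w < 1 ->
    cabs (F w - b0 - b1 * w - b2 * w ^+ 2) <= 512 * M * cabs w ^+ 3.
  move=> w01; have [_] := h3 w w01.
  have w0 : 0 < cabs w by case/andP: w01.
  have wn0 : w != 0 by rewrite -cabs_gt0.
  have -> : F w - b0 - b1 * w - b2 * w ^+ 2 =
     ((((F w - b0) / w - b1) / w - b2) / w) * w ^+ 3 by field.
  rewrite [in X in _ -> X]cabsM cabsX => h; rewrite ler_wpM2r ?exprn_ge0 ?cabs_ge0//.
  by apply: (le_trans h); lra.
pose K := cabs b1 + cabs b2 + 512 * M.
have C0 : 0 <= 512 * M by apply: mulr_ge0; [exact: ler0n|exact: ltW].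
have K0 : 0 <= K by apply: addr_ge0 => //; apply: addr_ge0; exact: cabs_ge0.
have [dl dl0 hdl] := cder_lip hD.
have ct (t : R) : 0 < t -> cabs t%:C%C = t by move=> t0; rewrite cabsR gtr0_norm.
(* The peeling sees only the punctured disc; continuity of [F] at 0 identifies its first coefficient
   with the value there. *)
have e0 : F 0 = b0.
  apply/eqP; rewrite -subr_eq0 -cabs_eq0; apply/eqP/le_anti; rewrite cabs_ge0 andbT.
  apply: (@le0_of_le_linear _ ((cabs D + 1) * Num.min 1 dl + K * Num.min 1 dl)) => t
    /andP[t0 t1].
  pose m := Num.min 1 dl; have m0 : 0 < m by rewrite lt_min ltr01.
  have m1 : m <= 1 by rewrite ge_min lexx.
  have mdl : m <= dl by rewrite ge_min lexx orbT.
  have s0 : 0 < m * t by rewrite mulr_gt0.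
  have s1 : m * t < 1 by apply: le_lt_trans t1; rewrite ler_piMl// ltW.
  have := hdl (m * t)%:C%C; rewrite ct// add0r => h4.
  have {}h4 : cabs (F (m * t)%:C%C - F 0) <= (cabs D + 1) * (m * t).
    by apply: h4; apply: lt_le_trans mdl; rewrite gtr_pMr.
  have := expand (m * t)%:C%C; rewrite ct// s0 s1 => /(_ isT); set w := (m * t)%:C%C => h5.
  have -> : F 0 - b0 = - (F w - F 0) + (F w - b0 - b1 * w - b2 * w ^+ 2) + b1 * w + b2 * w
    ^+ 2 by ring.
  apply: (le_trans (cabsD _ _)); apply: (le_trans (lerD (cabsD _ _) (lexx _))).
  apply: (le_trans (lerD (lerD (cabsD _ _) (lexx _)) (lexx _))).
  rewrite cabsN [cabs (b1 * w)]cabsM [cabs (b2 * _)]cabsM cabsX ct// -/m.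
  set s := m * t in s0 s1 h4 h5 *; have s2 : s ^+ 2 <= s by rewrite expr2 ler_piMl ?ltW.
  have s3 : s ^+ 3 <= s by apply: le_trans s2; rewrite exprS ler_piMl ?sqr_ge0// ltW.
  have -> : ((cabs D + 1) * m + K * m) * t = (cabs D + 1) * s + K * s by rewrite /s; ring.
  have := ler_wpM2l (cabs_ge0 b2) s2.
  have : 512 * M * s ^+ 3 <= 512 * M * s by exact: ler_wpM2l.
  rewrite /K; lra.
(* Likewise, comparing the two first order expansions at the points [m t] and letting [t] tend to 0
   identifies the derivative. *)
have e1 : D = b1.
  apply/eqP; rewrite -subr_eq0 -cabs_eq0; apply/eqP/le_anti; rewrite cabs_ge0 andbT.
  apply/ler_addgt0Pr => e eps0; rewrite add0r.
  rewrite -subr_le0.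
  have [d d0 hd] := hD e eps0.
  pose m := Num.min 1 d; have m0 : 0 < m by rewrite lt_min ltr01.
  have m1 : m <= 1 by rewrite ge_min lexx.
  have md : m <= d by rewrite ge_min lexx orbT.
  apply: (@le0_of_le_linear _ (K * m)) => t /andP[t0 t1].
  have s0 : 0 < m * t by rewrite mulr_gt0.
  have s1 : m * t < 1 by apply: le_lt_trans t1; rewrite ler_piMl// ltW.
  have := hd (m * t)%:C%C; rewrite ct// add0r => h4.
  have {}h4 : cabs (F (m * t)%:C%C - F 0 - D * (m * t)%:C%C) <= e * (m * t).
    by apply: h4; apply: lt_le_trans md; rewrite gtr_pMr.
  have := expand (m * t)%:C%C; rewrite ct// s0 s1 => /(_ isT); rewrite -e0.
  have ctw := ct _ s0; set w := (m * t)%:C%C in h4 ctw * => h5.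
  rewrite -mulrA; set s := m * t in s0 s1 h4 h5 ctw *.
  have s3 : s ^+ 3 <= s ^+ 2 by rewrite [s ^+ 3]exprS ler_piMl ?sqr_ge0// ltW.
  rewrite -(ler_pM2r s0) mulrBl -{1}ctw -cabsM.
  have -> : (D - b1) * w = - (F w - F 0 - D * w) + (F w - F 0 - b1 * w - b2 * w ^+ 2) + b2
    * w ^+ 2 by ring.
  rewrite lerBlDr; apply: (le_trans (cabsD _ _)).
  apply: (le_trans (lerD (cabsD _ _) (lexx _))).
  rewrite cabsN [cabs (b2 * _)]cabsM cabsX ctw.
  have : 512 * M * s ^+ 3 <= 512 * M * s ^+ 2 by exact: ler_wpM2l.
  have : 0 <= cabs b1 * s ^+ 2 by rewrite mulr_ge0 ?cabs_ge0 ?sqr_ge0.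
  rewrite -[K * s * s]mulrA -expr2 /K; lra.
split; first by rewrite e1.
exists b2; first by apply: (le_trans b2M); lra.
move=> w w1; have [->|wn0] := eqVneq w 0.
  rewrite (expr2 0) !mulr0 !subr0 subrr cabs0; exact: mulr_ge0.
by rewrite e0 e1; apply: expand; rewrite cabs_gt0 wn0.
Qed.

End Removable.

(** * The l1 norm and topologies *)

(** A real-valued norm, the sum of the absolute values of the [2 n] real coordinates. It is the
    length of the path that follows the coordinate directions one after the other, hence suits
    estimates from partial derivatives. *)
Definition l1 {R : realType} {n : nat} (u : 'rV[R[i]]_n) : R :=
  \sum_(j < n) (`|complex.Re (u 0 j)| + `|complex.Im (u 0 j)|).

Section L1.
Variables (R : realType) (n : nat).
Implicit Types u v : 'rV[R[i]]_n.

Lemma l1_ge0 u : 0 <= l1 u.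
Proof. by apply: sumr_ge0 => j _; rewrite addr_ge0. Qed.

Lemma l1D u v : l1 (u + v) <= l1 u + l1 v.
Proof.
rewrite -big_split /=; apply: ler_sum => j _; rewrite !mxE ReD ImD addrACA.
by rewrite lerD ?ler_normD.
Qed.

Lemma l1N u : l1 (- u) = l1 u.
Proof. by apply: eq_bigr => j _; rewrite !mxE ReN ImN !normrN. Qed.

Lemma l1B u v : l1 (u - v) <= l1 u + l1 v.
Proof. by rewrite -[l1 v]l1N; exact: l1D. Qed.

Lemma l10 : l1 (0 : 'rV[R[i]]_n) = 0.
Proof. by apply: big1 => j _; rewrite !mxE /= normr0 addr0. Qed.

Lemma l1C u v : l1 (u - v) = l1 (v - u).
Proof. by rewrite -l1N opprB. Qed.

(** A complex scalar mixes real and imaginary parts, whence the factor 2; equality without it holds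
    for real scalars and for ['i]. *)
Lemma l1Z (c : R[i]) u : l1 (c *: u) <= 2 * cabs c * l1 u.
Proof.
rewrite /l1 mulr_sumr; apply: ler_sum => j _.
have -> : (c *: u) 0 j = c * u 0 j by rewrite mxE.
rewrite cReM cImM.
set a := complex.Re c; set b := complex.Im c.
set x := complex.Re (u 0 j); set y := complex.Im (u 0 j).
have ha : `|a| <= cabs c by exact: abs_Re_le.
have hb : `|b| <= cabs c by exact: abs_Im_le.
have h1 : `|a * x - b * y| <= cabs c * `|x| + cabs c * `|y|.
  by apply: (le_trans (ler_normB _ _)); rewrite !normrM lerD// ler_wpM2r.
have h2 : `|a * y + b * x| <= cabs c * `|y| + cabs c * `|x|.
  by apply: (le_trans (ler_normD _ _)); rewrite !normrM lerD// ler_wpM2r.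
by lra.
Qed.

Lemma l1ZR (t : R) u : l1 (t%:C%C *: u) = `|t| * l1 u.
Proof.
rewrite /l1 mulr_sumr; apply: eq_bigr => j _; rewrite !mxE.
by case: (u 0 j) => a b /=; rewrite !mul0r addr0 subr0 mulrDr !normrM.
Qed.

Lemma l1_i u : l1 ('i%C *: u) = l1 u.
Proof.
apply: eq_bigr => j _; rewrite !mxE; case: (u 0 j) => a b /=.
by rewrite !mul0r !mul1r !add0r normrN addrC.
Qed.

Lemma cabs_le_l1 u j : cabs (u 0 j) <= l1 u.
Proof.
apply: (le_trans (cabs_le_ReIm _)); rewrite /l1 (bigD1 j)//= lerDl.
by apply: sumr_ge0 => k _; rewrite addr_ge0.
Qed.

Lemma l1_le_cabs u (K : R) : (forall j, cabs (u 0 j) <= K) -> l1 u <= n%:R * (2 * K).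
Proof.
move=> h; apply: (@le_trans _ _ (\sum_(j < n) 2 * K)); last first.
  by rewrite sumr_const card_ord (mulr_natl (2 * K) n).
apply: ler_sum => j _; have := abs_Re_le (u 0 j); have := abs_Im_le (u 0 j).
by have := h j; lra.
Qed.

End L1.

Lemma normC_lt (R : realType) (z : R[i]) (e : R) : (`|z| < e%:C%C) = (cabs z < e).
Proof. by rewrite -ltcR. Qed.

Lemma cabs_lt1 (R : realType) (w : R[i]) : (`|w| < 1) = (cabs w < 1).
Proof. by rewrite -[1]/(1%:C%C) normC_lt. Qed.

(** Radii of balls over [R[i]] are elements of [R[i]]; positivity forces them to be real. This is
    the bridge to neighbourhoods described by [cabs] and [l1]. *)
Lemma pos_complex (R : realType) (e : R[i]) : 0 < e -> e = (complex.Re e)%:C%C /\ 0 <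
  complex.Re e.
Proof. by rewrite ltcE; case: e => a b /= /andP[/eqP -> ->]. Qed.

Lemma nbhs_cabsP (R : realType) (z : R[i]) (A : set R[i]) :
  nbhs z A <-> exists2 d : R, 0 < d & forall w, cabs (w - z) < d -> A w.
Proof.
split.
  move=> /nbhs_ballP[e /= e0 h]; have [ee e'0] := pos_complex e0.
  exists (complex.Re e) => // w wz; apply: h; rewrite /ball /= ee normC_lt.
  by rewrite cabsC.
move=> [d d0 h]; apply/nbhs_ballP; exists d%:C%C; first by rewrite /= ltcR.
by move=> w; rewrite /ball /= normC_lt cabsC; exact: h.
Qed.

Lemma nbhs_l1P (R : realType) (n : nat) (z : 'rV[R[i]]_n) (A : set 'rV[R[i]]_n) :
  nbhs z A <-> exists2 d : R, 0 < d & forall w, l1 (w - z) < d -> A w.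
Proof.
split.
  move=> /nbhs_ballP[e /= e0 h]; have [ee e'0] := pos_complex e0.
  exists (complex.Re e) => // w wz; apply: h; split => // i j; rewrite /ball /= ee normC_lt.
  rewrite cabsC ord1; apply: le_lt_trans wz.
  by have := cabs_le_l1 (w - z) j; rewrite !mxE.
move=> [d d0 h]; apply/nbhs_ballP.
have e0 : 0 < d / (2 * n%:R + 1) by rewrite divr_gt0// ltr_wpDl// mulr_ge0.
exists (d / (2 * n%:R + 1))%:C%C; first by rewrite /= ltcR.
move=> w [_ hw]; apply: h.
apply: (@le_lt_trans _ _ (n%:R * (2 * (d / (2 * n%:R + 1))))).
  apply: l1_le_cabs => j; have := hw 0 j; rewrite /ball /= normC_lt cabsC => /ltW.
  by rewrite !mxE.
have -> : n%:R * (2 * (d / (2 * n%:R + 1))) = d * (2 * n%:R) / (2 * n%:R + 1) by ring.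
by rewrite ltr_pdivrMr ?ltr_wpDl// ?mulr_ge0// ltr_pM2l// ltrDl.
Qed.

Lemma derivable_l1P (R : realType) (n : nat) (f : R[i] -> 'rV[R[i]]_n) (w : R[i])
    (l : 'rV[R[i]]_n) :
  h^-1 *: (f (h *: 1 + w) - f w) @[h --> 0^'] --> l <->
  forall e : R, 0 < e -> exists2 d : R, 0 < d & forall h, cabs h < d ->
    l1 (f (w + h) - f w - h *: l) <= e * cabs h.
Proof.
split.
  move=> hc e e0; have e2 : 0 < e / 2 by rewrite divr_gt0.
  have /hc : nbhs l [set v | l1 (v - l) < e / 2] by apply/nbhs_l1P; exists (e / 2).
  move=> /nbhs_cabsP[d d0 hd]; exists d => // h hh.
  have [->|h0] := eqVneq h 0; first by rewrite addr0 subrr scale0r subrr l10 cabs0 mulr0.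
  have := hd h; rewrite subr0 => /(_ hh h0) /= {}hd.
  have -> : f (w + h) - f w - h *: l = h *: (h^-1 *: (f (h *: 1 + w) - f w) - l).
    by rewrite scalerBr scalerA mulfV// scale1r [h *: 1]mulr1 (addrC h).
  apply: (le_trans (l1Z _ _)); rewrite mulrAC; apply: ler_wpM2r; first exact: cabs_ge0.
  by rewrite mulrC -ler_pdivlMr// ltW.
move=> hf A /nbhs_l1P[d d0 hA].
have d4 : 0 < d / 4 by rewrite divr_gt0.
have [r r0 hr] := hf _ d4; apply/nbhs_cabsP; exists r => // h; rewrite subr0 => hh h0.
apply: hA.
have -> : h^-1 *: (f (h *: 1 + w) - f w) - l = h^-1 *: (f (w + h) - f w - h *: l).
  by rewrite [in RHS]scalerBr scalerA mulVf// scale1r [h *: 1]mulr1 (addrC h).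
apply: (le_lt_trans (l1Z _ _)); have ch : 0 < cabs h by rewrite cabs_gt0.
apply: (@le_lt_trans _ _ (2 * cabs h^-1 * (d / 4 * cabs h))).
  by rewrite ler_wpM2l ?mulr_ge0 ?cabs_ge0// hr.
rewrite cabsV; have -> : 2 * (cabs h)^-1 * (d / 4 * cabs h) = d / 2 by field; rewrite gt_eqF.
by rewrite ltr_pdivrMr// ltr_pMr// ltr1n.
Qed.

(** * Taylor expansion of functions of class C^2 *)

(** The [2 n] real directions of the space are indexed by pairs, the boolean selecting the imaginary
    axis; [co] gives the matching real coordinates. *)
Definition dirv {R : realType} {n : nat} (a : 'I_n * bool) : 'rV[R[i]]_n :=
  if a.2 then ydir a.1 else xdir a.1.

Definition co {R : realType} {n : nat} (u : 'rV[R[i]]_n) (a : 'I_n * bool) : R :=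
  if a.2 then complex.Im (u 0 a.1) else complex.Re (u 0 a.1).

Definition D1 {R : realType} {n : nat} (r : 'rV[R[i]]_n -> R) (z u : 'rV[R[i]]_n) : R :=
  \sum_a co u a * pderiv r (dirv a) z.

(** The real Hessian as a bilinear form. The order of differentiation is kept and symmetry is never
    assumed. *)
Definition D2 {R : realType} {n : nat} (r : 'rV[R[i]]_n -> R) (z u v : 'rV[R[i]]_n) : R :=
  \sum_a \sum_b co u a * co v b * pderiv (pderiv r (dirv b)) (dirv a) z.

Section Coordinates.
Variables (R : realType) (n : nat).
Implicit Types (u v z : 'rV[R[i]]_n) (r : 'rV[R[i]]_n -> R).

Lemma sum_pair_bool (V : nmodType) (F : 'I_n * bool -> V) :
  \sum_a F a = \sum_j (F (j, false) + F (j, true)).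
Proof.
transitivity (\sum_a F (a.1, a.2)); first by apply: eq_bigr => -[].
rewrite -(pair_bigA _ (fun j b => F (j, b))) /=.
by apply: eq_bigr => j _; rewrite big_bool /= addrC.
Qed.

Lemma l1_co u : l1 u = \sum_a `|co u a|.
Proof. by rewrite sum_pair_bool. Qed.

Lemma coD u v a : co (u + v) a = co u a + co v a.
Proof. by rewrite /co !mxE; case: a.2; case: (u _ _) => ? ?; case: (v _ _). Qed.

Lemma coZ (t : R) u a : co (t%:C%C *: u) a = t * co u a.
Proof.
by rewrite /co !mxE; case: a.2; case: (u _ _) => x y /=; rewrite mul0r ?subr0 ?addr0.
Qed.

Lemma coN u a : co (- u) a = - co u a.
Proof. by rewrite /co !mxE; case: a.2; case: (u _ _). Qed.

Lemma l1_dirv (a : 'I_n * bool) : l1 (dirv a : 'rV[R[i]]_n) = 1.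
Proof.
case: a => j b; rewrite /l1 (bigD1 j)//= big1 ?addr0; last first.
  by move=> k kj; case: b; rewrite /dirv /xdir /ydir !mxE (negbTE kj) /= normr0 addr0.
by case: b; rewrite /dirv /xdir /ydir !mxE eqxx /= normr0 normr1 ?addr0 ?add0r.
Qed.

Lemma dirv_coord_dir (a : 'I_n * bool) : coord_dir (dirv a : 'rV[R[i]]_n).
Proof. by case: a => j [] /=; exists j; [right|left]. Qed.

Lemma dirv_decomp u : u = \sum_a (co u a)%:C%C *: dirv a.
Proof.
apply/rowP => k; rewrite sum_pair_bool summxE (bigD1 k)//= big1 ?addr0; last first.
  move=> j jk; rewrite /dirv /xdir /ydir /= !mxE eq_sym (negbTE jk).
  by rewrite !mulr0 addr0.
rewrite /dirv /co /xdir /ydir /= !mxE eqxx mulr1; case: (u 0 k) => a b.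
by apply/eqP; rewrite eq_complex /= !mul0r !mulr0 !mulr1 ?subr0 ?add0r ?addr0 !eqxx.
Qed.

Lemma along_shift r v z (t h : R) :
  along r v (z + t%:C%C *: v) h = along r v z (h + t).
Proof. by rewrite /along rmorphD /= scalerDl addrA addrAC. Qed.

Lemma along_is_derive r v z (t : R) :
  derivable (along r v (z + t%:C%C *: v)) 0 1 ->
  is_derive t 1 (along r v z) (pderiv r v (z + t%:C%C *: v)).
Proof.
move=> hd.
have E : (fun h : R => h^-1 *: (along r v z (h *: 1 + t) - along r v z t)) =
  (fun h : R => h^-1 *: (along r v (z + t%:C%C *: v) (h *: 1 + 0) - along r v (z + t%:C%C
    *: v) 0)).
  by apply/funext => h; rewrite !along_shift addr0 add0r.
by split; rewrite /derivable /derive /pderiv E.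
Qed.

Lemma MVT_approx (f df : R -> R) (t c e : R) :
  (forall s : R, `|s| <= `|t| -> is_derive s (1 : R) f (df s)) ->
  (forall s, `|s| <= `|t| -> `|df s - c| <= e) ->
  `|f t - f 0 - t * c| <= e * `|t|.
Proof.
move=> hf hdf.
have cont s : `|s| <= `|t| -> {for s, continuous f}.
  move=> st; apply: differentiable_continuous; apply/derivable1_diffP.
  by have [] := hf s st.
suff [x xt ->] : exists2 x, `|x| <= `|t| & f t - f 0 = df x * t.
  by rewrite [t * c]mulrC -mulrBl normrM ler_wpM2r// hdf.
have [t0|t0] := leP 0 t.
  have [x| |x] := @MVT_segment R f df 0 t t0.
  - by rewrite in_itv /= => /andP[? ?]; apply: hf; rewrite !ger0_norm// ltW.
  - apply: continuous_in_subspaceT => x; rewrite inE /= in_itv /= => /andP[? ?].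
    by apply: cont; rewrite !ger0_norm.
  rewrite in_itv /= => /andP[? ?] ->; rewrite subr0; exists x => //.
  by rewrite !ger0_norm.
have [x| |x] := @MVT_segment R f df t 0 (ltW t0).
- by rewrite in_itv /= => /andP[? ?]; apply: hf; rewrite !ler0_norm ?lerN2// ltW.
- apply: continuous_in_subspaceT => x; rewrite inE /= in_itv /= => /andP[? ?].
  by apply: cont; rewrite !ler0_norm ?lerN2// ltW.
rewrite in_itv /= => /andP[? ?] h; exists x; first by rewrite !ler0_norm ?lerN2// ltW.
by move: h; rewrite sub0r mulrN => /eqP; rewrite subr_eq addrC -subr_eq => /eqP; lra.
Qed.

(* Telescoping along the coordinate directions. *)
Lemma partial_approx r z (c : 'I_n * bool -> R) (e : R) u :
  (forall a w, derivable (along r (dirv a) w) 0 1) ->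
  (forall a w, l1 (w - z) <= l1 u -> `|pderiv r (dirv a) w - c a| <= e) ->
  `|r (z + u) - r z - \sum_a co u a * c a| <= e * l1 u.
Proof.
move=> hd hc.
have key (s : seq ('I_n * bool)) : \sum_(a <- s) `|co u a| <= l1 u ->
    `|r (z + \sum_(a <- s) (co u a)%:C%C *: dirv a) - r z - \sum_(a <- s) co u a * c a|
      <= e * \sum_(a <- s) `|co u a|.
  elim: s => [|a s IH]; first by rewrite !big_nil addr0 !subrr normr0 mulr0.
  rewrite !big_cons => hs.
  have hs' : \sum_(b <- s) `|co u b| <= l1 u by apply: le_trans hs; rewrite lerDr.
  have {}IH := IH hs'.
  set y := \sum_(b <- s) (co u b)%:C%C *: dirv b in IH *.
  have l1y : l1 y <= \sum_(b <- s) `|co u b|.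
    rewrite /y; elim: (s) => [|b s' IHs]; first by rewrite !big_nil l10.
    rewrite !big_cons; apply: (le_trans (l1D _ _)); apply: lerD => //.
    by rewrite l1ZR l1_dirv mulr1.
  have := @MVT_approx (along r (dirv a) (z + y)) (fun t => pderiv r (dirv a) (z + y +
    t%:C%C *: dirv a))
     (co u a) (c a) e.
  move=> /(_ (fun s' _ => along_is_derive (hd a _))) hm.
  have {}hm : `|along r (dirv a) (z + y) (co u a) - along r (dirv a) (z + y) 0 - co u a * c
    a| <= e * `|co u a|.
    apply: hm => t ht; apply: hc.
    have -> : z + y + t%:C%C *: dirv a - z = y + t%:C%C *: dirv a.
      by rewrite addrAC (addrC z) addrK.
    apply: (le_trans (l1D _ _)); apply: le_trans hs.
    by rewrite addrC l1ZR l1_dirv mulr1 lerD.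
  move: hm; rewrite /along scale0r addr0.
  have -> : z + ((co u a)%:C%C *: dirv a + y) = z + y + (co u a)%:C%C *: dirv a.
    by rewrite -addrA [_ + y]addrC.
  move=> hm; rewrite mulrDr; apply: le_trans (lerD hm IH).
  by apply: le_trans (ler_normD _ _); rewrite le_eqVlt; apply/orP; left; apply/eqP; congr
    `| _ |; ring.
by have := key (index_enum _); rewrite -dirv_decomp -l1_co; exact.
Qed.

Lemma approx_is_derive (f : R -> R) (t l : R) :
  (forall e, 0 < e -> exists2 d, 0 < d &
     forall s, `|s| < d -> `|f (t + s) - f t - s * l| <= e * `|s|) ->
  is_derive t 1 f l.
Proof.
move=> hf.
suff hl : h^-1 *: (f (h *: 1 + t) - f t) @[h --> 0^'] --> l.
  by split; [apply: cvgP hl|exact/cvg_lim].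
apply/cvgrPdist_le => e /hf[d d0 hd]; rewrite /dnbhs /within /=.
apply/nbhs_ballP; exists d => // h; rewrite /ball /= sub0r normrN => hh h0.
rewrite distrC -(ler_pM2l (_ : 0 < `|h|)) ?normr_gt0// [leRHS]mulrC.
have := hd h hh; congr (_ <= _); rewrite -normrM; congr `| _ |.
by rewrite /GRing.scale /= mulr1 (addrC h); field.
Qed.

End Coordinates.

Lemma fin_radius (R : realType) (I : finType) (P : I -> R -> Prop) :
  (forall i, exists2 d, 0 < d & P i d) ->
  (forall i d d', 0 < d' -> d' <= d -> P i d -> P i d') ->
  exists2 d, 0 < d & forall i, P i d.
Proof.
move=> hP mon; have [d hd] := choice (fun i => let: ex_intro2 d h1 h2 := hP i in
  ex_intro (fun d => 0 < d /\ P i d) d (conj h1 h2)).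
suff [e e0 he] : exists2 e : R, 0 < e & forall i, i \in enum I -> e <= d i.
  by exists e => // i; apply: (mon i (d i)) => //; [apply: he; rewrite mem_enum|have [] :=
    hd i].
elim: (enum I) => [|i s [e e0 he]]; first by exists 1.
exists (Num.min (d i) e); first by rewrite lt_min e0 andbT; have [] := hd i.
move=> j; rewrite in_cons => /orP[/eqP ->|/he]; first by rewrite ge_min lexx.
by move=> h; rewrite ge_min h orbT.
Qed.


Lemma is_derive_sumZ (R : realType) (I : Type) (s : seq I) (c : I -> R) (f : I -> R -> R)
    (l : I -> R) (t : R) : (forall a, is_derive t (1 : R) (f a) (l a)) ->
  is_derive t (1 : R) (fun x => \sum_(a <- s) c a * f a x) (\sum_(a <- s) c a * l a).
Proof.
move=> hf; elim: s => [|a s IH].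
  have -> : (fun x => \sum_(a <- [::]) c a * f a x) = cst 0 by apply/funext => x; rewrite
    big_nil.
  by rewrite big_nil; exact: is_derive_cst.
have -> : (fun x => \sum_(b <- a :: s) c b * f b x) =
    (c a *: f a) + (fun x => \sum_(b <- s) c b * f b x).
  by apply/funext => x; rewrite big_cons.
by rewrite big_cons; apply: is_deriveD => //; exact: is_deriveZ.
Qed.

Lemma is_derive_subquad (R : realType) (f : R -> R) (a b c t l : R) :
  is_derive t (1 : R) f l ->
  is_derive t (1 : R) (fun x => f x - a - x * b - x ^+ 2 * c) (l - b - 2 * t * c).
Proof.
move=> hf; apply: approx_is_derive => e e0.
have e2 : 0 < e / 2 by rewrite divr_gt0.
have [d d0 hd] := is_derive_approx hf e2.
have c1 : 0 < `|c| + 1 by rewrite ltr_wpDl.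
exists (Num.min d (e / 2 / (`|c| + 1))); first by rewrite lt_min d0 divr_gt0.
move=> s; rewrite lt_min => /andP[/hd hs1]; rewrite ltr_pdivlMr// => hs2.
have -> : f (t + s) - a - (t + s) * b - (t + s) ^+ 2 * c - (f t - a - t * b - t ^+ 2 * c) -
  s * (l - b - 2 * t * c) = (f (t + s) - f t - s * l) - s * (s * c) by ring.
apply: (le_trans (ler_normB _ _)); rewrite [`|s * (s * c)|]normrM.
have : `|s| * `|s * c| <= `|s| * (e / 2).
  by rewrite ler_wpM2l// normrM (le_trans _ (ltW hs2))// ler_wpM2l// lerDl.
by move: hs1; rewrite /GRing.scale /=; lra.
Qed.

Lemma taylor_lagrange2 (R : realType) (g g1 g2 : R -> R) :
  (forall t : R, is_derive t (1 : R) g (g1 t)) ->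
  (forall t : R, is_derive t (1 : R) g1 (g2 t)) ->
  exists2 x : R, 0 <= x <= 1 & g 1 = g 0 + g1 0 + g2 x / 2.
Proof.
move=> dg dg1.
(* Chosen so that [h 1 = h 0]; the mean value theorem for [h], then for its derivative, yields a
   point where [g2] equals [2 K]. *)
pose K := g 1 - g 0 - g1 0.
pose h t := g t - g 0 - t * g1 0 - t ^+ 2 * K.
pose h1 t := g1 t - g1 0 - 2 * t * K.
have dh (t : R) : is_derive t (1 : R) h (h1 t) := is_derive_subquad (g 0) (g1 0) K (dg t).
have dh1 (t : R) : is_derive t (1 : R) h1 (g2 t - 2 * K).
  have -> : h1 = fun x => g1 x - g1 0 - x * (2 * K) - x ^+ 2 * 0.
    by apply/funext => x; rewrite /h1; ring.
  have -> : g2 t - 2 * K = g2 t - 2 * K - 2 * t * 0 by ring.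
  exact: (is_derive_subquad (g1 0) (2 * K) 0 (dg1 t)).
have cts (f df : R -> R) : (forall t : R, is_derive t (1 : R) f (df t)) -> forall A,
  {within A, continuous f}.
  move=> hf A; apply: continuous_subspaceT => x; apply: differentiable_continuous.
  by apply/derivable1_diffP; have [] := hf x.
have [|c c01] := @MVT R h h1 0 1 ltr01 (fun x _ => dh x); first exact: cts.
have h01 : h 1 = h 0 by rewrite /h /K; ring.
rewrite h01 subrr subr0 mulr1 => /esym hc.
move: c01; rewrite in_itv /= => /andP[c0 c1].
have [|x x0c] := @MVT R h1 (fun t => g2 t - 2 * K) 0 c c0 (fun x _ => dh1 x); first exact: cts.
rewrite hc /h1 mulr0 mul0r !subr0 subrr ?subr0 => /esym/eqP; rewrite mulf_eq0 (gt_eqF c0)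
  orbF => /eqP hx.
move: x0c; rewrite in_itv /= => /andP[x0 xc].
exists x; first by rewrite (ltW x0) (ltW (lt_trans xc c1)).
move: hx; rewrite /K => /subr0_eq ->.
by field.
Qed.

(** * Differentials, Lipschitz bounds and the second order Taylor formula *)

Section Calculus.
Variables (R : realType) (n : nat).
Implicit Types (u v z p : 'rV[R[i]]_n) (r : 'rV[R[i]]_n -> R).

Lemma Ck_continuous k r : Ck k r -> continuous r.
Proof. by case: k => [//|k []]. Qed.

Lemma Ck_pred k r : Ck k.+1 r -> Ck k r.
Proof.
elim: k r => [|k IH] r; first by move=> [].
move=> [cr hr]; split => // v hv; have [hd /IH] := hr v hv.
by split.
Qed.

Lemma Ck_pderiv k r a : Ck k.+1 r -> Ck k (pderiv r (dirv a)).
Proof. by move=> [_ /(_ _ (dirv_coord_dir R a))[]]. Qed.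

Lemma Ck_derivable k r a z : Ck k.+1 r -> derivable (along r (dirv a) z) 0 1.
Proof. by move=> [_ /(_ _ (dirv_coord_dir R a))[]]. Qed.

Lemma continuous_l1 r p : continuous r -> forall e : R, 0 < e ->
  exists2 d : R, 0 < d & forall w, l1 (w - p) < d -> `|r w - r p| <= e.
Proof.
move=> cr e e0; have /cvgrPdist_le /(_ _ e0) /nbhs_l1P[d d0 hd] := cr p.
by exists d => // w /hd; rewrite distrC.
Qed.

Lemma D1D r z u v : D1 r z (u + v) = D1 r z u + D1 r z v.
Proof. by rewrite -big_split; apply: eq_bigr => a _; rewrite coD mulrDl. Qed.

Lemma D1ZR r z (t : R) u : D1 r z (t%:C%C *: u) = t * D1 r z u.
Proof. by rewrite mulr_sumr; apply: eq_bigr => a _; rewrite coZ mulrA. Qed.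

Lemma D1N r z u : D1 r z (- u) = - D1 r z u.
Proof. by rewrite -sumrN; apply: eq_bigr => a _; rewrite coN mulNr. Qed.

Lemma D1_close r z r' w (e : R) u :
  (forall a, `|pderiv r (dirv a) z - pderiv r' (dirv a) w| <= e) ->
  `|D1 r z u - D1 r' w u| <= e * l1 u.
Proof.
move=> h; rewrite -sumrB l1_co mulr_sumr; apply: (le_trans (ler_norm_sum _ _ _)).
by apply: ler_sum => a _; rewrite -mulrBr normrM mulrC ler_wpM2r.
Qed.

Lemma D1_bound r z (K : R) u : (forall a, `|pderiv r (dirv a) z| <= K) ->
  `|D1 r z u| <= K * l1 u.
Proof.
move=> h; rewrite l1_co mulr_sumr; apply: (le_trans (ler_norm_sum _ _ _)).
by apply: ler_sum => a _; rewrite normrM mulrC ler_wpM2r.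
Qed.

Lemma D2_close r z w (e : R) u v :
  (forall a b, `|pderiv (pderiv r (dirv b)) (dirv a) z - pderiv (pderiv r (dirv b)) (dirv
    a) w| <= e) ->
  `|D2 r z u v - D2 r w u v| <= e * (l1 u * l1 v).
Proof.
move=> h; rewrite -sumrB !l1_co mulr_suml mulr_sumr; apply: (le_trans (ler_norm_sum _ _ _)).
apply: ler_sum => a _; rewrite -sumrB mulr_sumr mulr_sumr.
apply: (le_trans (ler_norm_sum _ _ _)); apply: ler_sum => b _.
by rewrite -mulrBr normrM mulrC normrM ler_wpM2r// mulr_ge0.
Qed.

Lemma D2_bound r z (K : R) u v :
  (forall a b, `|pderiv (pderiv r (dirv b)) (dirv a) z| <= K) ->
  `|D2 r z u v| <= K * (l1 u * l1 v).
Proof.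
move=> h; rewrite !l1_co mulr_suml mulr_sumr; apply: (le_trans (ler_norm_sum _ _ _)).
apply: ler_sum => a _; rewrite mulr_sumr mulr_sumr.
apply: (le_trans (ler_norm_sum _ _ _)); apply: ler_sum => b _.
by rewrite normrM mulrC normrM ler_wpM2r// mulr_ge0.
Qed.

Lemma D2Dl r z u u' v : D2 r z (u + u') v = D2 r z u v + D2 r z u' v.
Proof.
rewrite -big_split; apply: eq_bigr => a _; rewrite -big_split /=.
by apply: eq_bigr => b _; rewrite coD; ring.
Qed.

Lemma D2Dr r z u v v' : D2 r z u (v + v') = D2 r z u v + D2 r z u v'.
Proof.
rewrite -big_split; apply: eq_bigr => a _; rewrite -big_split /=.
by apply: eq_bigr => b _; rewrite coD; ring.
Qed.

Lemma D2ZlR r z (t : R) u v : D2 r z (t%:C%C *: u) v = t * D2 r z u v.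
Proof.
rewrite mulr_sumr; apply: eq_bigr => a _; rewrite mulr_sumr.
by apply: eq_bigr => b _; rewrite coZ; ring.
Qed.

Lemma D2ZrR r z (t : R) u v : D2 r z u (t%:C%C *: v) = t * D2 r z u v.
Proof.
rewrite mulr_sumr; apply: eq_bigr => a _; rewrite mulr_sumr.
by apply: eq_bigr => b _; rewrite coZ; ring.
Qed.

Lemma D2Nl r z u v : D2 r z (- u) v = - D2 r z u v.
Proof.
rewrite -sumrN; apply: eq_bigr => a _; rewrite -sumrN.
by apply: eq_bigr => b _; rewrite coN; ring.
Qed.

Lemma D2Nr r z u v : D2 r z u (- v) = - D2 r z u v.
Proof.
rewrite -sumrN; apply: eq_bigr => a _; rewrite -sumrN.
by apply: eq_bigr => b _; rewrite coN; ring.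
Qed.

Lemma D2_diff r z (K : R) u v :
  (forall a b, `|pderiv (pderiv r (dirv b)) (dirv a) z| <= K) ->
  `|D2 r z u u - D2 r z v v| <= K * (l1 (u - v) * (l1 u + l1 v)).
Proof.
move=> h.
have -> : D2 r z u u - D2 r z v v = D2 r z (u - v) u + D2 r z v (u - v).
  by rewrite D2Dl D2Dr D2Nl D2Nr; ring.
apply: (le_trans (ler_normD _ _)).
apply: (le_trans (lerD (D2_bound _ _ h) (D2_bound _ _ h))).
by rewrite -mulrDr [l1 v * _]mulrC -mulrDr.
Qed.

Lemma pderivs_near k r p : Ck k.+1 r -> forall e : R, 0 < e ->
  exists2 d : R, 0 < d & forall w, l1 (w - p) < d ->
    forall a, `|pderiv r (dirv a) w - pderiv r (dirv a) p| <= e.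
Proof.
move=> Cr e e0.
have [|a d d' d0 dd' h w wp|d d0 hd] := @fin_radius R _ (fun a d => forall w, l1 (w - p) < d ->
  `|pderiv r (dirv a) w - pderiv r (dirv a) p| <= e).
- by move=> a; apply: continuous_l1 => //; apply: (@Ck_continuous k); exact: Ck_pderiv.
- by apply: h; exact: lt_le_trans dd'.
- by exists d => // w wp a; exact: hd.
Qed.

Lemma pderiv2s_near k r p : Ck k.+2 r -> forall e : R, 0 < e ->
  exists2 d : R, 0 < d & forall w, l1 (w - p) < d -> forall a b,
    `|pderiv (pderiv r (dirv b)) (dirv a) w - pderiv (pderiv r (dirv b)) (dirv a) p| <= e.
Proof.
move=> Cr e e0.
have [b|b d d' d0 dd' h w wp|d d0 hd] := @fin_radius R _ (fun b d => forall w, l1 (w - p) <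
  d ->
  forall a, `|pderiv (pderiv r (dirv b)) (dirv a) w - pderiv (pderiv r (dirv b)) (dirv a)
    p| <= e).
- by apply: (@pderivs_near k) => //; exact: Ck_pderiv.
- by apply: h; exact: lt_le_trans dd'.
- by exists d => // w wp a b; exact: hd.
Qed.

Lemma pderivs_bounded k r p : Ck k.+1 r ->
  exists K : R, 0 < K /\ exists2 d : R, 0 < d & forall w, l1 (w - p) < d ->
    forall a, `|pderiv r (dirv a) w| <= K.
Proof.
move=> Cr; have [d d0 hd] := pderivs_near p Cr ltr01.
exists (1 + \sum_a `|pderiv r (dirv a) p|); split.
  by rewrite ltr_pwDl// sumr_ge0.
exists d => // w /hd h a; have := h a.
have : `|pderiv r (dirv a) p| <= \sum_b `|pderiv r (dirv b) p|.
  by rewrite (bigD1 a)//= lerDl sumr_ge0.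
have := ler_normD (pderiv r (dirv a) w - pderiv r (dirv a) p) (pderiv r (dirv a) p).
rewrite subrK; lra.
Qed.

Lemma C1_lip k r p : Ck k.+1 r ->
  exists K : R, 0 < K /\ exists2 d : R, 0 < d & forall z w,
    l1 (z - p) < d -> l1 (w - p) < d -> `|r z - r w| <= K * l1 (z - w).
Proof.
move=> Cr; have [K [K0 [d d0 hd]]] := pderivs_bounded p Cr.
(* A point at distance at most [l1 (z - w)] from [w] is within three times [d / 3] of [p].
   Telescoping against the zero differential then gives the Lipschitz bound. *)
exists K; split => //; exists (d / 3); first by rewrite divr_gt0.
move=> z w hz hw.
have := @partial_approx R n r w (fun=> 0) K (z - w) (fun a w' => Ck_derivable Cr).
rewrite big1 ?subr0; last by move=> a _; rewrite mulr0.
rewrite [w + _]addrC subrK; apply => a x hx; rewrite subr0; apply: hd.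
have -> : x - p = (x - w) + (w - p) by rewrite addrA subrK.
have hzw : l1 (z - w) <= l1 (z - p) + l1 (w - p).
  by rewrite -(subrKA p) -[p - w]opprB; exact: l1B.
by apply: (le_lt_trans (l1D _ _)); lra.
Qed.

Lemma pderivs_lip k r p : Ck k.+2 r ->
  exists K : R, 0 < K /\ exists2 d : R, 0 < d & forall z w,
    l1 (z - p) < d -> l1 (w - p) < d ->
    forall a, `|pderiv r (dirv a) z - pderiv r (dirv a) w| <= K * l1 (z - w).
Proof.
move=> Cr; have [K hK] := choice (fun a => C1_lip p (Ck_pderiv a Cr)).
exists (1 + \sum_a K a).
have K0 : 0 <= \sum_a K a by apply: sumr_ge0 => a _; have [/ltW] := hK a.
split; first by rewrite ltr_pwDl.
have [a|a d d' d0 dd' h z w hz hw|d d0 hd] := @fin_radius R _ (fun a d => forall z w,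
  l1 (z - p) < d -> l1 (w - p) < d ->
  `|pderiv r (dirv a) z - pderiv r (dirv a) w| <= K a * l1 (z - w)).
- by have [_] := hK a.
- by apply: h; exact: lt_le_trans dd'.
exists d => // z w hz hw a; apply: (le_trans (hd a z w hz hw)).
rewrite ler_wpM2r ?l1_ge0// (bigD1 a)//= addrCA lerDl addr_ge0// sumr_ge0// => b _.
by have [/ltW] := hK b.
Qed.

Lemma pderiv2s_lip k r p : Ck k.+3 r ->
  exists K : R, 0 < K /\ exists2 d : R, 0 < d & forall z w,
    l1 (z - p) < d -> l1 (w - p) < d -> forall a b,
    `|pderiv (pderiv r (dirv b)) (dirv a) z - pderiv (pderiv r (dirv b)) (dirv a) w|
      <= K * l1 (z - w).
Proof.
move=> Cr; have [K hK] := choice (fun b => pderivs_lip p (Ck_pderiv b Cr)).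
exists (1 + \sum_b K b).
have K0 : 0 <= \sum_b K b by apply: sumr_ge0 => b _; have [/ltW] := hK b.
split; first by rewrite ltr_pwDl.
have [b|b d d' d0 dd' h z w hz hw|d d0 hd] := @fin_radius R _ (fun b d => forall z w,
  l1 (z - p) < d -> l1 (w - p) < d -> forall a,
  `|pderiv (pderiv r (dirv b)) (dirv a) z - pderiv (pderiv r (dirv b)) (dirv a) w| <= K b *
    l1 (z - w)).
- by have [_] := hK b.
- by apply: h; exact: lt_le_trans dd'.
exists d => // z w hz hw a b; apply: (le_trans (hd b z w hz hw a)).
rewrite ler_wpM2r ?l1_ge0// (bigD1 b)//= addrCA lerDl addr_ge0// sumr_ge0// => c _.
by have [/ltW] := hK c.
Qed.

(** [Ck] provides derivatives along coordinate directions only; continuity of the partials gives the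
    derivative along every [u]. *)
Lemma along_is_derive_D1 k r z u (t : R) : Ck k.+1 r ->
  is_derive t (1 : R) (along r u z) (D1 r (z + t%:C%C *: u) u).
Proof.
move=> Cr; apply: approx_is_derive => e e0.
have e' : 0 < e / (l1 u + 1) by rewrite divr_gt0// ltr_wpDl ?l1_ge0.
have [d d0 hd] := pderivs_near (z + t%:C%C *: u) Cr e'.
exists (d / (l1 u + 1)); first by rewrite divr_gt0// ltr_wpDl ?l1_ge0.
move=> s; rewrite ltr_pdivlMr ?ltr_wpDl ?l1_ge0// => hs.
have hs' : l1 (s%:C%C *: u) < d.
  by rewrite l1ZR; apply: le_lt_trans hs; rewrite ler_wpM2l// lerDl.
have := @partial_approx R n r (z + t%:C%C *: u)
  (fun a => pderiv r (dirv a) (z + t%:C%C *: u)) _ (s%:C%C *: u)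
  (fun a w' => Ck_derivable Cr).
move=> /(_ (e / (l1 u + 1)) (fun a w hw => hd w (le_lt_trans hw hs') a)).
rewrite -/(D1 r _ _) D1ZR /along rmorphD /= scalerDl addrA => /le_trans; apply.
rewrite l1ZR mulrCA [leRHS]mulrC ler_wpM2l// mulrAC ler_pdivrMr ?ltr_wpDl ?l1_ge0//.
by rewrite ler_wpM2l ?(ltW e0)// lerDl.
Qed.

Lemma pderivE k r v z : Ck k.+1 r -> pderiv r v z = D1 r z v.
Proof.
move=> Cr; rewrite /pderiv; have [_ ->] := along_is_derive_D1 z v 0 Cr.
by rewrite scale0r addr0.
Qed.

Lemma taylor2 k r z u : Ck k.+2 r ->
  exists2 x : R, 0 <= x <= 1 & r (z + u) = r z + D1 r z u + D2 r (z + x%:C%C *: u) u u / 2.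
Proof.
move=> Cr.
pose g t := r (z + t%:C%C *: u).
pose g1 t := D1 r (z + t%:C%C *: u) u.
pose g2 t := D2 r (z + t%:C%C *: u) u u.
have dg (t : R) : is_derive t (1 : R) g (g1 t) by exact: (along_is_derive_D1 z u t Cr).
have dg1 (t : R) : is_derive t (1 : R) g1 (g2 t).
  have -> : g2 t = \sum_a co u a * D1 (pderiv r (dirv a)) (z + t%:C%C *: u) u.
    rewrite /g2 /D2 exchange_big /=; apply: eq_bigr => a _.
    by rewrite mulr_sumr; apply: eq_bigr => b _; ring.
  apply: (@is_derive_sumZ R _ _ (co u) (fun a => along (pderiv r (dirv a)) u z)) => a.
  exact: (along_is_derive_D1 z u t (Ck_pderiv a Cr)).
have [x x01] := taylor_lagrange2 dg dg1; rewrite /g /g1 scale0r addr0 scale1r => ->.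
by exists x.
Qed.

End Calculus.

(** * Levi form *)

(* Four times the real part of the Levi form (see [Lv_levi_form]), which avoids
   any use of the symmetry of second derivatives. *)
Definition Lv {R : realType} {n : nat} (r : 'rV[R[i]]_n -> R) (z u : 'rV[R[i]]_n) : R :=
  D2 r z u u + D2 r z ('i%C *: u) ('i%C *: u).

Section Levi.
Variables (R : realType) (n : nat).
Implicit Types (u v z : 'rV[R[i]]_n) (r : 'rV[R[i]]_n -> R).

Lemma Re_sum (I : finType) (F : I -> R[i]) :
  complex.Re (\sum_i F i) = \sum_i complex.Re (F i).
Proof. by apply: (big_morph (@complex.Re R)) => // x y; exact: ReD. Qed.

Lemma complex_divn (x y : R) (k : nat) :
  (x%:C + 'i * y%:C)%C / k%:R = ((x / k%:R) +i* (y / k%:R))%C :> R[i].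
Proof.
have -> : (k%:R : R[i])^-1 = ((k%:R : R)^-1)%:C%C by rewrite -(rmorph_nat (real_complex R))
  -fmorphV.
by apply/eqP; rewrite eq_complex /=; apply/andP; split; apply/eqP; ring.
Qed.

Lemma dr_pairD r z u v : dr_pair r z (u + v) = dr_pair r z u + dr_pair r z v.
Proof. by rewrite -big_split; apply: eq_bigr => j _; rewrite !mxE mulrDr. Qed.

Lemma dr_pairZ r z (c : R[i]) u : dr_pair r z (c *: u) = c * dr_pair r z u.
Proof. by rewrite mulr_sumr; apply: eq_bigr => j _; rewrite !mxE mulrCA. Qed.

Lemma D1_dr_pair r z u : D1 r z u = 2 * complex.Re (dr_pair r z u).
Proof.
rewrite /D1 sum_pair_bool Re_sum mulr_sumr; apply: eq_bigr => j _.
rewrite /dz_r /co /dirv /=; set a := pderiv _ _ _; set b := pderiv _ _ _.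
have -> : (a%:C - 'i * b%:C)%C / 2%:R = ((a / 2%:R) +i* ((- b) / 2%:R))%C :> R[i].
  by rewrite -complex_divn rmorphN /= mulrN.
by case: (u 0 j) => x y /=; field.
Qed.

Lemma D1_i_dr_pair r z u : D1 r z ('i%C *: u) = - 2 * complex.Im (dr_pair r z u).
Proof. by rewrite D1_dr_pair dr_pairZ; case: (dr_pair _ _ _) => a b /=; ring. Qed.

(** The complex tangent space is the maximal complex subspace of the real one: [D1] sees the real
    part of the pairing, and rotation by ['i] its imaginary part. *)
Lemma dr_pair_eq0 r z u : dr_pair r z u = 0 <-> D1 r z u = 0 /\ D1 r z ('i%C *: u) = 0.
Proof.
rewrite D1_i_dr_pair D1_dr_pair; case: (dr_pair r z u) => a b /=; split.
  by case=> -> ->; rewrite !mulr0.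
by move=> [h1 h2]; congr Complex; lra.
Qed.

Lemma dr_pair_close r r' z w u (e : R) :
  (forall a, `|pderiv r (dirv a) z - pderiv r' (dirv a) w| <= e) ->
  cabs (dr_pair r z u - dr_pair r' w u) <= e * l1 u.
Proof.
move=> h; apply: (le_trans (cabs_le_ReIm _)); rewrite ReD ImD ReN ImN.
have := D1_close u h; have := D1_close ('i%C *: u) h.
rewrite l1_i !D1_i_dr_pair !D1_dr_pair.
have -> (x y : R) : - 2 * x - - 2 * y = - (2 * (x - y)) by ring.
have -> (x y : R) : 2 * x - 2 * y = 2 * (x - y) by ring.
by rewrite normrN !normrM ger0_norm//; lra.
Qed.

Lemma dr_pair_bound r z u (K : R) :
  (forall a, `|pderiv r (dirv a) z| <= K) -> cabs (dr_pair r z u) <= K * l1 u.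
Proof.
move=> h; apply: (le_trans (cabs_le_ReIm _)).
have := D1_bound u h; have := D1_bound ('i%C *: u) h.
rewrite l1_i !D1_i_dr_pair !D1_dr_pair mulNr normrN !normrM ger0_norm//; lra.
Qed.

Lemma D2_coords r z u v : D2 r z u v = \sum_j \sum_k
  ((complex.Re (u 0 j) * complex.Re (v 0 k) * pderiv (pderiv r (xdir k)) (xdir j) z +
    complex.Im (u 0 j) * complex.Re (v 0 k) * pderiv (pderiv r (xdir k)) (ydir j) z) +
   (complex.Re (u 0 j) * complex.Im (v 0 k) * pderiv (pderiv r (ydir k)) (xdir j) z +
    complex.Im (u 0 j) * complex.Im (v 0 k) * pderiv (pderiv r (ydir k)) (ydir j) z)).
Proof.
by rewrite /D2 sum_pair_bool; apply: eq_bigr => j _; rewrite -big_split sum_pair_bool.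
Qed.

Lemma levi_term (p q : R[i]) (xx yy xy yx : R) :
  (complex.Re p * complex.Re q * xx + complex.Im p * complex.Re q * yx +
    (complex.Re p * complex.Im q * xy + complex.Im p * complex.Im q * yy)) +
  (complex.Re ('i%C * p) * complex.Re ('i%C * q) * xx + complex.Im ('i%C * p) * complex.Re
    ('i%C * q) * yx +
    (complex.Re ('i%C * p) * complex.Im ('i%C * q) * xy + complex.Im ('i%C * p) *
      complex.Im ('i%C * q) * yy)) =
  4 * complex.Re (((xx + yy)%:C + 'i * (xy - yx)%:C)%C / 4%:R * p * (q^*)%C).
Proof. by rewrite complex_divn; case: p q => a b [c d] /=; field. Qed.

Lemma Lv_levi_form r z u : Lv r z u = 4 * complex.Re (levi_form r z u).
Proof.
rewrite /Lv !D2_coords -big_split /levi_form Re_sum mulr_sumr; apply: eq_bigr => j _.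
rewrite -big_split Re_sum mulr_sumr; apply: eq_bigr => k _.
by rewrite /levi_coef /= -levi_term !mxE.
Qed.

Lemma LvZ r z (c : R[i]) u : Lv r z (c *: u) = cabs c ^+ 2 * Lv r z u.
Proof.
rewrite !Lv_levi_form mulrCA; congr (_ * _).
have -> : levi_form r z (c *: u) = (cabs c ^+ 2)%:C%C * levi_form r z u.
  rewrite mulr_sumr; apply: eq_bigr => j _; rewrite mulr_sumr; apply: eq_bigr => k _.
  rewrite !mxE; move: (levi_coef r j k z) (u 0 j) (u 0 k) => l p q.
  rewrite sqr_cabs; case: c l p q => [c1 c2] [l1 l2] [p1 p2] [q1 q2] /=.
  by apply/eqP; rewrite eq_complex /=; apply/andP; split; apply/eqP; ring.
by case: (levi_form r z u) => a b /=; ring.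
Qed.

Lemma Lv_diff r z (K : R) u v :
  (forall a b, `|pderiv (pderiv r (dirv b)) (dirv a) z| <= K) ->
  `|Lv r z u - Lv r z v| <= 2 * K * (l1 (u - v) * (l1 u + l1 v)).
Proof.
move=> h; have := D2_diff u v h; have := D2_diff ('i%C *: u) ('i%C *: v) h.
rewrite -scalerBr !l1_i /Lv opprD addrACA => h1 h2.
apply: (le_trans (ler_normD _ _)); apply: (le_trans (lerD h2 h1)).
by rewrite -mulrA mulr_natl mulr2n.
Qed.

Lemma Lv_close r z w (e : R) u :
  (forall a b, `|pderiv (pderiv r (dirv b)) (dirv a) z - pderiv (pderiv r (dirv b)) (dirv
    a) w| <= e) ->
  `|Lv r z u - Lv r w u| <= 2 * e * l1 u ^+ 2.
Proof.
move=> h; have := D2_close u u h; have := D2_close ('i%C *: u) ('i%C *: u) h.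
rewrite !l1_i -expr2 /Lv opprD addrACA => h1 h2.
apply: (le_trans (ler_normD _ _)); apply: (le_trans (lerD h2 h1)).
by rewrite -mulrA mulr_natl mulr2n.
Qed.

Lemma Lv_bound r z (K : R) u :
  (forall a b, `|pderiv (pderiv r (dirv b)) (dirv a) z| <= K) ->
  `|Lv r z u| <= 2 * K * l1 u ^+ 2.
Proof.
move=> h; have := D2_bound u u h; have := D2_bound ('i%C *: u) ('i%C *: u) h.
rewrite !l1_i -expr2 /Lv => h1 h2.
apply: (le_trans (ler_normD _ _)); apply: (le_trans (lerD h2 h1)).
by rewrite -mulrA mulr_natl mulr2n.
Qed.

End Levi.

(** * Boundary points and quadratic discs *)

Section BoundaryPoints.
Variables (R : realType) (n : nat).
Implicit Types (u v z p X : 'rV[R[i]]_n) (r : 'rV[R[i]]_n -> R).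

Lemma closure_l1 (A : set 'rV[R[i]]_n) p : closure A p ->
  forall d : R, 0 < d -> exists2 z, A z & l1 (z - p) < d.
Proof.
move=> cp d d0; have [|z [Az zd]] := cp [set w | l1 (w - p) < d].
  by apply/nbhs_l1P; exists d.
by exists z.
Qed.

Lemma bdry_eq0 r p : continuous r -> bdry [set z | r z < 0] p -> r p = 0.
Proof.
move=> cr [cp /negP]; rewrite -leNgt => r0; apply/le_anti; rewrite r0 andbT.
rewrite leNgt; apply/negP => rp; have rp2 : 0 < r p / 2 by rewrite divr_gt0.
have [d d0 hd] := continuous_l1 p cr rp2.
have [z /= z0 /hd] := closure_l1 cp d0; rewrite ler_norml; lra.
Qed.

Lemma bdry_approach r p : continuous r -> bdry [set z | r z < 0] p ->
  forall d : R, 0 < d -> exists z, [/\ l1 (z - p) < d, - d < r z & r z < 0].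
Proof.
move=> cr bp d d0; have rp := bdry_eq0 cr bp; have d2 : 0 < d / 2 by rewrite divr_gt0.
have [d' d'0 hd] := continuous_l1 p cr d2.
have [|z z0 zp] := closure_l1 bp.1 (d := Num.min d d'); first by rewrite lt_min d0.
move: zp; rewrite lt_min => /andP[zd /hd]; rewrite rp subr0 => h.
by exists z; split => //; move: h; rewrite ler_norml; lra.
Qed.

Lemma quadratic_disc_approx z (A B : 'rV[R[i]]_n) (w : R[i]) :
  let f := fun w : R[i] => z + w *: A + w ^+ 2 *: B in
  h^-1 *: (f (h *: 1 + w) - f w) @[h --> 0^'] --> (A + (2 * w) *: B).
Proof.
move=> f; apply/derivable_l1P => e e0.
have B0 : 0 < 2 * (l1 B + 1) by rewrite mulr_gt0// ltr_wpDl ?l1_ge0.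
exists (e / (2 * (l1 B + 1))); first by rewrite divr_gt0.
move=> h; rewrite ltr_pdivlMr// => hh.
have -> : f (w + h) - f w - h *: (A + (2 * w) *: B) = h ^+ 2 *: B.
  by apply/rowP => j; rewrite /f !mxE; ring.
apply: (le_trans (l1Z _ _)); rewrite cabsX.
have -> : 2 * cabs h ^+ 2 * l1 B = (cabs h * (2 * l1 B)) * cabs h by ring.
rewrite ler_wpM2r ?cabs_ge0// (le_trans _ (ltW hh))// ler_wpM2l ?cabs_ge0//; lra.
Qed.

Lemma quadratic_disc z (A B : 'rV[R[i]]_n) :
  let f := fun w : R[i] => z + w *: A + w ^+ 2 *: B in
  [/\ holo_disc f, f 0 = z & 'D_1 f 0 = A].
Proof.
move=> f; split; last 1 first.
- have h := @quadratic_disc_approx z A B 0.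
  have E : A + (2 * 0) *: B = A by rewrite mulr0 scale0r addr0.
  by rewrite E in h; apply: (cvg_lim _ h); exact: norm_hausdorff.
- by move=> w _; apply/cvg_ex; exists (A + (2 * w) *: B); exact: quadratic_disc_approx.
- by rewrite /f expr0n /= !scale0r !addr0.
Qed.

Lemma kobayashi_le1 (Om : set 'rV[R[i]]_n) (f : R[i] -> 'rV[R[i]]_n) z X :
  holo_disc f -> (forall w : R[i], `|w| < 1 -> Om (f w)) -> f 0 = z -> 'D_1 f 0 = X ->
  (kobayashi Om z X <= 1%:E)%E.
Proof.
move=> h1 h2 h3 h4; apply: ereal_inf_lbound; exists 1; last by rewrite invr1.
by split=> //; exists f; split => //; rewrite h4 scale1r.
Qed.

(* [D2 (w X, w X) = |w|^2 Lv X / 2 + Re (w^2 hol_quad X)] splits the real Hessian into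
   its Hermitian and pluriharmonic parts. *)
Definition hol_quad r z X : R[i] :=
  (((D2 r z X X - D2 r z ('i%C *: X) ('i%C *: X)) / 2) +i*
   (- (D2 r z X ('i%C *: X) + D2 r z ('i%C *: X) X) / 2))%C.

Lemma D2_complex_line r z X (w : R[i]) :
  D2 r z (w *: X) (w *: X) = cabs w ^+ 2 / 2 * Lv r z X + complex.Re (w ^+ 2 * hol_quad r z X).
Proof.
have -> : w *: X = (complex.Re w)%:C%C *: X + (complex.Im w)%:C%C *: ('i%C *: X).
  rewrite scalerA -scalerDl; congr (_ *: _); case: w => a b /=.
  by apply/eqP; rewrite eq_complex /=; apply/andP; split; apply/eqP; ring.
rewrite sqr_cabs /Lv /hol_quad !(D2Dl, D2Dr, D2ZlR, D2ZrR).
move: (D2 r z X X) (D2 r z X ('i%C *: X)) (D2 r z ('i%C *: X) X) (D2 r z ('i%C *: X) ('i%C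
  *: X)).
by move=> p q s t; case: w => a b /=; rewrite expr2 /=; field.
Qed.

Lemma le_sum_term (I : finType) (F : I -> R) i : (forall j, 0 <= F j) -> F i <= \sum_j F j.
Proof. by move=> F0; rewrite (bigD1 i)//= lerDl sumr_ge0. Qed.

Lemma pderiv2s_bound r p : exists2 K : R, 0 < K &
  forall a b, `|pderiv (pderiv r (dirv b)) (dirv a) p| <= K.
Proof.
pose F a b := `|pderiv (pderiv r (dirv b)) (dirv a) p|.
have F0 a b : 0 <= F a b by exact: normr_ge0.
have G0 a : 0 <= \sum_b F a b by apply: sumr_ge0 => b _; exact: F0.
exists (1 + \sum_a \sum_b F a b).
  by rewrite ltr_pwDl//; apply: sumr_ge0 => a _; exact: G0.
move=> a b; rewrite -/(F a b); have h1 := le_sum_term b (F0 a).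
have h2 := le_sum_term a G0; apply: (le_trans h1); apply: (le_trans h2).
by rewrite lerDr.
Qed.

End BoundaryPoints.

(** * Discs with large normal speed near a boundary point of negative Levi form *)

Section NegativeLevi.
Variables (R : realType) (n : nat).
Implicit Types (u v z p X V : 'rV[R[i]]_n) (r : 'rV[R[i]]_n -> R).

Lemma two_inv_le (a x : R) : 0 < a -> a / 2 <= x -> 2 * x^-1 <= 4 / a.
Proof.
move=> a0 ax; have x0 : 0 < x by apply: lt_le_trans ax; rewrite divr_gt0.
by rewrite ler_pdivrMr// mulrAC ler_pdivlMr//; lra.
Qed.

(** Completing the square: the value [s^2 = d k / 2] is half of the threshold [d k] at which the
    maximum over [t] would reach 0. *)
Lemma quadratic_neg (d k s t : R) : 0 < d -> 0 < k -> s ^+ 2 = d * k / 2 ->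
  - d + 2 * s * t - k * t ^+ 2 < 0.
Proof.
move=> d0 k0 hs; have h := sqr_ge0 (k * t - s).
rewrite -(pmulr_rlt0 _ k0).
have -> : k * (- d + 2 * s * t - k * t ^+ 2) = - (d * k) - (k * t - s) ^+ 2 + s ^+ 2 by ring.
rewrite hs; have := mulr_gt0 d0 k0; lra.
Qed.

(* The quadratic term of the disc cancels the pluriharmonic part of the Hessian,
   leaving the negative Levi form, which allows a normal speed [s ~ |r z|^(1/2)]. *)
Lemma neg_levi_disc r p X v : Ck 2 r -> dr_pair r p v != 0 -> dr_pair r p X = 0 ->
  Lv r p X < 0 ->
  exists k d : R, [/\ 0 < k, 0 < d & forall z, l1 (z - p) < d -> - d < r z -> r z < 0 ->
    exists f : R[i] -> 'rV[R[i]]_n,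
      [/\ holo_disc f, (forall w : R[i], `|w| < 1 -> r (f w) < 0), f 0 = z &
          cabs (dr_pair r z ('D_1 f 0)) = k * Num.sqrt (- r z)]].
Proof.
move=> Cr dv dX LX.
pose m := - Lv r p X; have m0 : 0 < m by rewrite oppr_gt0.
pose a := cabs (dr_pair r p v); have a0 : 0 < a by rewrite cabs_gt0.
have [K K0 hK] := pderiv2s_bound r p.
pose L := l1 X; have L0 : 0 <= L by exact: l1_ge0.
pose B := 4 / a * l1 v; have B0 : 0 <= B by rewrite mulr_ge0 ?l1_ge0// divr_ge0// ltW.
pose hq := hol_quad r p X; pose H := cabs hq.
have H0 : 0 <= H by exact: cabs_ge0.
(* The disc deviates from the line [w c X] by at most [2 t c^2 G]: the summands account for the
   tangential correction, the normal speed and the quadratic term. *)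
pose G := 1 + B + H * B; have G0 : 0 < G by apply: ltr_pwDl; [exact: ltr_pwDl|exact: mulr_ge0].
(* Admissible oscillation of the Hessian. Together with the deviation from [w c X] it may use up
   half of the negative term [- m c^2 t^2 / 4] in the second order part of [r]. *)
pose e := m / (32 * ((L + G) ^+ 2 + 1)).
have LG : 0 < (L + G) ^+ 2 + 1 by rewrite ltr_wpDl ?sqr_ge0.
have e0 : 0 < e by rewrite divr_gt0// mulr_gt0.
have he : 2 * e * (L + G) ^+ 2 <= m / 16.
  have -> : m / 16 = 2 * e * ((L + G) ^+ 2 + 1) by rewrite /e; field; rewrite gt_eqF.
  by apply: ler_wpM2l; [apply: mulr_ge0 => //; exact: ltW|rewrite lerDl].
clearbody e.
have [d1 d10 hd1] := pderiv2s_near p Cr e0.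
pose KG := K * G * (2 * L + G).
have KG0 : 0 <= KG.
  by apply: mulr_ge0; [apply: mulr_ge0; exact: ltW|apply: addr_ge0; [exact: mulr_ge0|exact:
    ltW]].
(* The scale [c] of the disc makes the deviation error, of relative order [c], small against [m],
   and keeps the disc where the Hessian oscillates by at most [e]. *)
have [c [c0 c1 cK cd]] : exists c : R, [/\ 0 < c, c <= 1, 2 * c * KG <= m / 16 & 4 * c * (L
  + G) <= d1].
  have q1 : 0 < 32 * (KG + 1) by rewrite mulr_gt0// ltr_wpDl.
  have q2 : 0 < 4 * (L + G) by rewrite mulr_gt0// ltr_wpDl.
  exists (Num.min 1 (Num.min (m / (32 * (KG + 1))) (d1 / (4 * (L + G))))); split.
  - by rewrite !lt_min ltr01 !divr_gt0.
  - by rewrite ge_min lexx.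
  - set c := Num.min _ _; have : c * (32 * (KG + 1)) <= m.
      by rewrite -ler_pdivlMr// !ge_min lexx !orbT.
    have : 0 <= c by rewrite !le_min ler01 !divr_ge0 ?ltW.
    lra.
  - by rewrite mulrAC mulrC -ler_pdivlMr// !ge_min lexx !orbT.
have cc0 : 0 < c ^+ 2 by rewrite exprn_gt0.
pose B1 := 2 * B * L + 1; have B10 : 0 < B1.
  by apply: ltr_wpDl => //; apply: mulr_ge0 => //; exact: mulr_ge0.
have ea0 : 0 < Num.min (a / (2 * (l1 v + 1))) (c / B1).
  by rewrite lt_min !divr_gt0// mulr_gt0// ltr_wpDl ?l1_ge0.
have [d2 d20 hd2] := pderivs_near p Cr ea0.
pose k := c * Num.sqrt m / 4.
have k0 : 0 < k by rewrite !(divr_gt0, mulr_gt0)// sqrtr_gt0.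
(* The last radius bounds [- r z] and guarantees that the normal speed [s] is at most [c^2]. *)
exists k, (Num.min (d1 / 2) (Num.min d2 (16 * c ^+ 2 / m))).
split => //; first by rewrite !lt_min d20 !divr_gt0// mulr_gt0.
move=> z; rewrite !lt_min => /and3P[zd1 zd2 _].
rewrite -ltrNl lt_min => /andP[_]; rewrite lt_min => /andP[_ rzd] rz.
pose dl := - r z; have dl0 : 0 < dl by rewrite oppr_gt0.
have {}hd2 := hd2 z zd2.
have dzv : a / 2 <= cabs (dr_pair r z v).
  have /= h : cabs (dr_pair r z v - dr_pair r p v) <= a / (2 * (l1 v + 1)) * l1 v.
    by apply: dr_pair_close => b; apply: (le_trans (hd2 b)); rewrite ge_min lexx.
  have h2 := cabs_dist_le (dr_pair r p v) (dr_pair r z v); rewrite cabsC in h2.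
  have : a / (2 * (l1 v + 1)) * l1 v <= a / 2.
    rewrite mulrAC ler_pdivrMr ?mulr_gt0 ?ltr_wpDl ?l1_ge0//.
    have -> : a / 2 * (2 * (l1 v + 1)) = a * (l1 v + 1) by field.
    by rewrite ler_wpM2l ?(ltW a0)// lerDl.
  rewrite -/a in h2; clear -h h2; lra.
have dzv0 : 0 < cabs (dr_pair r z v) by apply: lt_le_trans dzv; rewrite divr_gt0.
have dzvn0 : dr_pair r z v != 0 by rewrite -cabs_gt0.
pose V := (dr_pair r z v)^-1 *: v.
have dV : dr_pair r z V = 1 by rewrite dr_pairZ mulVf.
have lV : l1 V <= B.
  apply: (le_trans (l1Z _ _)); rewrite cabsV; apply: ler_wpM2r; first exact: l1_ge0.
  exact: two_inv_le.
(* Tangency is restored at [z] itself, so that the first order term of [r] along the disc comes only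
   from the normal speed and from [Q]. *)
pose Xz := X - dr_pair r z X *: V.
have dXz : dr_pair r z Xz = 0 by rewrite dr_pairD -scaleNr dr_pairZ dV mulr1 subrr.
have lXz : l1 (Xz - X) <= c.
  have -> : Xz - X = - (dr_pair r z X *: V) by rewrite /Xz addrAC subrr add0r.
  rewrite l1N; apply: (le_trans (l1Z _ _)).
  have : cabs (dr_pair r z X - dr_pair r p X) <= c / B1 * L.
    by apply: dr_pair_close => b; apply: (le_trans (hd2 b)); rewrite ge_min lexx orbT.
  rewrite dX subr0 => h; apply: (@le_trans _ _ (2 * (c / B1 * L) * B)).
    by rewrite ler_pM ?mulr_ge0 ?cabs_ge0 ?l1_ge0// ler_wpM2l.
  have -> : 2 * (c / B1 * L) * B = c * (2 * B * L) / B1 by ring.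
  by rewrite ler_pdivrMr// ler_wpM2l ?(ltW c0)// lerDl.
clearbody Xz V.
pose s := k * Num.sqrt dl.
have s0 : 0 <= s by rewrite mulr_ge0 ?sqrtr_ge0 ?ltW.
have sqs : s ^+ 2 = dl * (m * c ^+ 2 / 8) / 2.
  by rewrite /s /k !(exprMn, expr_div_n) !sqr_sqrtr ?(ltW m0) ?(ltW dl0)//; field.
have sc : s <= c ^+ 2.
  rewrite -ler_sqr ?nnegrE ?(ltW cc0)// sqs.
  have : dl * m <= 16 * c ^+ 2 by rewrite -ler_pdivlMr// ltW.
  move=> h; have -> : dl * (m * c ^+ 2 / 8) / 2 = (dl * m) * (c ^+ 2 / 16) by field.
  apply: (@le_trans _ _ ((16 * c ^+ 2) * (c ^+ 2 / 16))); last first.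
    by rewrite le_eqVlt; apply/orP; left; apply/eqP; field.
  by rewrite ler_wpM2r// divr_ge0// ltW.
(* Twice the real part of [Q w^2] is the opposite of the pluriharmonic half-Hessian term
   [c^2 Re (w^2 hq) / 2]. *)
pose Q := - (c ^+ 2 / 4)%:C%C * hq.
have nQ : cabs Q <= c ^+ 2 * H.
  rewrite /Q cabsM cabsN cabsR ger0_norm ?divr_ge0 ?(ltW cc0)// ler_wpM2r//.
  by rewrite ler_pdivrMr// ler_peMr ?(ltW cc0)// ler1n.
pose A := c%:C%C *: Xz + s%:C%C *: V.
have [hf f0 df] := quadratic_disc z A (Q *: V).
exists (fun w => z + w *: A + w ^+ 2 *: (Q *: V)); split => //; last first.
  rewrite df /A dr_pairD !dr_pairZ dXz dV mulr0 add0r mulr1 cabsR ger0_norm//.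
move=> w; rewrite -[1]/(1%:C%C) normC_lt; set t := cabs w => t1.
have t0 : 0 <= t by exact: cabs_ge0.
pose u := w *: A + w ^+ 2 *: (Q *: V).
rewrite -addrA -/u.
have du : dr_pair r z u = s%:C%C * w + Q * w ^+ 2.
  by rewrite /u /A !(dr_pairD, dr_pairZ) dXz dV; ring.
have lu1 : l1 (u - (c%:C%C * w) *: X) <= 2 * t * c ^+ 2 * G.
  have -> : u - (c%:C%C * w) *: X = (c%:C%C * w) *: (Xz - X) + (s%:C%C * w) *: V + (w ^+ 2
    * Q) *: V.
    by apply/rowP => j; rewrite /u /A !mxE; ring.
  apply: (le_trans (l1D _ _)); apply: (le_trans (lerD (l1D _ _) (lexx _))).
  have b1 : l1 ((c%:C%C * w) *: (Xz - X)) <= 2 * (c * t) * c.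
    apply: (le_trans (l1Z _ _)); rewrite cabsM cabsR (ger0_norm (ltW c0)) -/t.
    by rewrite ler_wpM2l// !mulr_ge0// ltW.
  have b2 : l1 ((s%:C%C * w) *: V) <= 2 * (c ^+ 2 * t) * B.
    apply: (le_trans (l1Z _ _)); rewrite cabsM cabsR (ger0_norm s0) -/t.
    apply: ler_pM => //; [by apply: mulr_ge0 => //; exact: mulr_ge0|exact: l1_ge0|].
    by rewrite ler_wpM2l// ler_wpM2r.
  have b3 : l1 ((w ^+ 2 * Q) *: V) <= 2 * (t * (c ^+ 2 * H)) * B.
    apply: (le_trans (l1Z _ _)); rewrite cabsM cabsX -/t.
    have tQ : 0 <= t ^+ 2 * cabs Q by rewrite mulr_ge0 ?sqr_ge0 ?cabs_ge0.
    apply: ler_pM => //; [exact: mulr_ge0|exact: l1_ge0|rewrite ler_wpM2l//].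
    apply: ler_pM => //; [exact: sqr_ge0|exact: cabs_ge0|].
    by rewrite expr2 ler_piMl// ltW.
  apply: (le_trans (lerD (lerD b1 b2) b3)); rewrite /G le_eqVlt; apply/orP; left;
    apply/eqP; ring.
have lcX : l1 ((c%:C%C * w) *: X) <= 2 * (c * t) * L.
  by apply: (le_trans (l1Z _ _)); rewrite cabsM cabsR (ger0_norm (ltW c0)).
have ccc : c ^+ 2 <= c by rewrite expr2 ler_piMl// ltW.
have lu : l1 u <= 2 * (c * t) * (L + G).
  have -> : u = (u - (c%:C%C * w) *: X) + (c%:C%C * w) *: X by rewrite subrK.
  apply: (le_trans (l1D _ _)); apply: (le_trans (lerD lu1 lcX)).
  have h : 2 * t * c ^+ 2 * G <= 2 * t * c * G.
    by rewrite ler_wpM2r ?(ltW G0)// ler_wpM2l// mulr_ge0.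
  by clear -h; lra.
have [x /andP[x0 x1] ->] := taylor2 z u Cr.
have near_x : l1 (z + x%:C%C *: u - p) < d1.
  rewrite addrAC; apply: (le_lt_trans (l1D _ _)); rewrite l1ZR ger0_norm//.
  have xu : x * l1 u <= 1 * l1 u by rewrite ler_wpM2r ?l1_ge0.
  have h : 2 * (c * t) * (L + G) <= 2 * (c * 1) * (L + G).
    apply: ler_wpM2r; first by apply: addr_ge0 => //; exact: ltW.
    by apply: ler_wpM2l => //; apply: ler_wpM2l; exact: ltW.
  by clear -h xu lu cd zd1; lra.
have E1 : `|D2 r (z + x%:C%C *: u) u u - D2 r p u u| <= e * (2 * (c * t) * (L + G)) ^+ 2.
  apply: (le_trans (D2_close u u (hd1 _ near_x))); rewrite ler_wpM2l ?(ltW e0)// -expr2.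
  by rewrite lerXn2r ?nnegrE ?l1_ge0// (le_trans _ lu) ?l1_ge0.
have E2 : `|D2 r p u u - D2 r p ((c%:C%C * w) *: X) ((c%:C%C * w) *: X)| <=
    K * ((2 * t * c ^+ 2 * G) * (2 * (c * t) * (2 * L + G))).
  apply: (le_trans (D2_diff u _ hK)); rewrite ler_wpM2l ?(ltW K0)//.
  rewrite ler_pM ?l1_ge0 ?addr_ge0 ?l1_ge0//; apply: (le_trans (lerD lu lcX)).
  by rewrite -mulrDr; have -> : L + G + L = 2 * L + G by ring.
have E3 := D2_complex_line r p X (c%:C%C * w).
have E4 : D1 r z u = 2 * (s * complex.Re w) - c ^+ 2 / 2 * complex.Re (w ^+ 2 * hq).
  rewrite D1_dr_pair du /Q; case: (hq) => h1 h2; case: (w) => y1 y2.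
  by rewrite !expr2 /=; field.
have E5 : complex.Re ((c%:C%C * w) ^+ 2 * hq) = c ^+ 2 * complex.Re (w ^+ 2 * hq).
  by case: (hq) => h1 h2; case: (w) => y1 y2; rewrite !expr2 /=; ring.
have E6 : cabs (c%:C%C * w) ^+ 2 = c ^+ 2 * t ^+ 2.
  by rewrite cabsM cabsR (ger0_norm (ltW c0)) exprMn.
rewrite -/hq E5 E6 in E3; rewrite E3 in E2; rewrite E4.
have Lm : Lv r p X = - m by rewrite opprK.
rewrite Lm in E2.
have rE : r z = - dl by rewrite opprK.
have rew : s * complex.Re w <= s * t.
  by rewrite ler_wpM2l// (le_trans (ler_norm _)) ?abs_Re_le.
have t2 : 0 <= c ^+ 2 * t ^+ 2 by rewrite mulr_ge0 ?sqr_ge0.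
have e1 : e * (2 * (c * t) * (L + G)) ^+ 2 <= m / 8 * (c ^+ 2 * t ^+ 2).
  have -> : e * (2 * (c * t) * (L + G)) ^+ 2 = (2 * e * (L + G) ^+ 2) * 2 * (c ^+ 2 * t ^+
    2) by ring.
  by rewrite ler_wpM2r//; clear -he; lra.
have e2 : K * ((2 * t * c ^+ 2 * G) * (2 * (c * t) * (2 * L + G))) <= m / 8 * (c ^+ 2 * t
  ^+ 2).
  have -> : K * ((2 * t * c ^+ 2 * G) * (2 * (c * t) * (2 * L + G))) = (2 * c * KG) * 2 *
    (c ^+ 2 * t ^+ 2).
    by rewrite /KG; ring.
  by rewrite ler_wpM2r//; clear -cK; lra.
(* What remains of the Levi term is [- (m c^2 / 8) t^2], with the coefficient for which [s] was
   calibrated. *)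
apply: le_lt_trans (quadratic_neg t dl0 _ sqs); last by rewrite divr_gt0// mulr_gt0.
rewrite rE; move: E1 E2 e1 e2; set D := D2 r (z + _) u u; set D' := D2 r p u u.
set W := c ^+ 2 * complex.Re _ in E3 *; rewrite -mulrA.
have -> : c ^+ 2 / 2 * complex.Re (w ^+ 2 * hq) = W / 2 by rewrite /W; ring.
move: (e * _) (K * _) => q1 q2; rewrite !ler_norml => /andP[E1a E1b] /andP[E2a E2b] e1 e2.
lra.
Qed.

End NegativeLevi.

(** * The lower bound with exponent above 1/2 implies pseudoconvexity *)

Section PartOne.
Variables (R : realType) (n : nat).
Implicit Types (u v z p X V : 'rV[R[i]]_n) (r : 'rV[R[i]]_n -> R).

(** The [Re] in the definition of pseudoconvexity takes values in [R[i]]; this turns the condition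
    into a real inequality. *)
Lemma Re_levi_ge0 r p X : (0 <= 'Re (levi_form r p X)) = (0 <= Lv r p X).
Proof. by rewrite -complexRe ler0c Lv_levi_form pmulr_rge0. Qed.

Lemma defining_dr_pair_neq0 k Om r p : defining_function k.+1 Om r -> bdry Om p ->
  exists v, dr_pair r p v != 0.
Proof.
move=> [Cr _ nd] /nd[v vn0]; exists v; apply: contraNneq vn0 => h.
by rewrite (pderivE v p Cr) D1_dr_pair h /= mulr0.
Qed.

Lemma powR_lt_of_small (y b d : R) : 0 < y -> 0 < b -> 0 < d -> d < y `^ b^-1 -> d `^ b < y.
Proof.
move=> y0 b0 d0 h; have := gt0_ltr_powR b0.
move=> /(_ d (y `^ b^-1)); rewrite !nnegrE powR_ge0 (ltW d0) => /(_ isT isT h).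
by rewrite -powRrM mulVf ?gt_eqF// powRr1// ltW.
Qed.

Lemma kobayashi_normal_pseudoconvex (Om : set 'rV[R[i]]_n) r (C alpha : R) :
  defining_function 2 Om r -> 0 < C -> 1 / 2 < alpha ->
  (forall z X, Om z ->
    ((C * cabs (dr_pair r z X) / (`|r z| `^ alpha))%:E <= kobayashi Om z X)%E) ->
  pseudoconvex Om.
Proof.
move=> defr C0 al hK; have [Cr OmE _] := defr.
exists r; split => // p bp X dX; rewrite Re_levi_ge0 leNgt; apply/negP => LX.
have [v vn0] := defining_dr_pair_neq0 defr bp.
have [k [d [k0 d0 hf]]] := neg_levi_disc Cr vn0 dX LX.
(* The disc has derivative of metric length at most 1 and normal speed [k |r z|^(1/2)], so the
   hypothesis reads [C k <= |r z|^b]; it fails once [|r z| < (C k)^(1/b)]. *)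
pose b := alpha - 1 / 2; have b0 : 0 < b by rewrite subr_gt0.
pose y := C * k; have y0 : 0 < y by rewrite mulr_gt0.
rewrite OmE in bp.
have [|z [zp rzd rz]] := bdry_approach (Ck_continuous Cr) bp (d := Num.min d (y `^ b^-1)).
  by rewrite lt_min d0 powR_gt0.
have {zp} zp : l1 (z - p) < d by apply: lt_le_trans zp _; rewrite ge_min lexx.
have rzd1 : - d < r z by apply: le_lt_trans rzd; rewrite lerN2 ge_min lexx.
have rzd2 : - r z < y `^ b^-1 by rewrite ltrNl; apply: le_lt_trans rzd; rewrite lerN2
  ge_min lexx orbT.
have dl0 : 0 < - r z by rewrite oppr_gt0.
have [f [hd hO f0 nf]] := hf z zp rzd1 rz.
have Omz : Om z by rewrite OmE.
have := hK z ('D_1 f 0) Omz.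
have hO' (w : R[i]) : `|w| < 1 -> Om (f w) by rewrite OmE; exact: hO.
move=> /le_trans /(_ (kobayashi_le1 hd hO' f0 erefl)); rewrite lee_fin nf.
rewrite ltr0_norm// ler_pdivrMr ?powR_gt0// mul1r mulrA -/y -powR12_sqrt ?(ltW dl0)//.
have -> : alpha = 2^-1 + b by rewrite /b; field.
rewrite powRD; last by rewrite (gt_eqF dl0) implybT.
rewrite mulrC ler_pM2l ?powR_gt0//; apply/negP; rewrite -ltNge.
exact: powR_lt_of_small.
Qed.

End PartOne.

(** * Independence of the Levi condition of the defining function *)

Section Transfer.
Variables (R : realType) (n : nat).
Implicit Types (u v z p X Y nu : 'rV[R[i]]_n) (r : 'rV[R[i]]_n -> R).

Lemma expand2 r p : Ck 2 r -> forall e : R, 0 < e -> exists2 d : R, 0 < d &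
  forall u, l1 u < d -> `|r (p + u) - r p - D1 r p u - D2 r p u u / 2| <= e * l1 u ^+ 2.
Proof.
move=> Cr e e0; have [d d0 hd] := pderiv2s_near p Cr e0.
exists d => // u ud; have [x /andP[x0 x1] ->] := taylor2 p u Cr.
have hx : l1 (p + x%:C%C *: u - p) < d.
  rewrite addrAC subrr add0r l1ZR ger0_norm//; apply: le_lt_trans ud.
  by rewrite ler_piMl ?l1_ge0.
have := D2_close u u (hd _ hx); rewrite -expr2 => h.
have e2 : 0 <= e * l1 u ^+ 2 by rewrite mulr_ge0 ?sqr_ge0 ?ltW.
move: h; move: (D2 r (p + _) u u) (D2 r p u u) (D1 r p u) => q q' q''.
rewrite !ler_norml => /andP[h1 h2]; apply/andP; split; lra.
Qed.

(** Along a parabola tangent to the boundary, the transversal coefficient [b] shifts the second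
    order coefficient of [r] at will. *)
Lemma curve2 r p Y nu (b : R) : Ck 2 r -> r p = 0 -> D1 r p Y = 0 ->
  forall e : R, 0 < e -> exists2 t0 : R, 0 < t0 & forall t : R, 0 < t < t0 ->
    `|r (p + (t%:C%C *: Y + (t ^+ 2 * b)%:C%C *: nu)) -
      t ^+ 2 * (b * D1 r p nu + D2 r p Y Y / 2)| <= e * t ^+ 2.
Proof.
move=> Cr rp dY e e0.
have [K K0 hK] := pderiv2s_bound r p.
pose S := l1 Y + `|b| * l1 nu.
have S0 : 0 <= S by rewrite addr_ge0 ?mulr_ge0 ?l1_ge0.
have e10 : 0 < e / (2 * (S ^+ 2 + 1)) by rewrite divr_gt0// mulr_gt0// ltr_wpDl ?sqr_ge0.
have [d d0 hd] := expand2 p Cr e10.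
have KS0 : 0 <= K * S ^+ 2 by rewrite mulr_ge0 ?sqr_ge0 ?ltW.
have KS1 : 0 < 2 * (K * S ^+ 2 + 1) by rewrite mulr_gt0// ltr_wpDl.
exists (Num.min 1 (Num.min (d / (S + 1)) (e / (2 * (K * S ^+ 2 + 1))))).
  by rewrite !lt_min ltr01 !divr_gt0// ltr_wpDl.
move=> t /andP[t0]; rewrite !lt_min => /and3P[t1 td te].
set u := t%:C%C *: Y + (t ^+ 2 * b)%:C%C *: nu.
have lY : l1 (t%:C%C *: Y) = t * l1 Y by rewrite l1ZR gtr0_norm.
have lnu : l1 ((t ^+ 2 * b)%:C%C *: nu) = t ^+ 2 * (`|b| * l1 nu).
  by rewrite l1ZR normrM ger0_norm ?sqr_ge0// mulrA.
have bn : 0 <= `|b| * l1 nu by rewrite mulr_ge0 ?l1_ge0.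
have tt : t ^+ 2 <= t by rewrite expr2 ler_piMl// ltW.
have lu : l1 u <= t * S.
  apply: (le_trans (l1D _ _)); rewrite lY lnu /S mulrDr lerD2l.
  by rewrite ler_wpM2r.
have ud : l1 u < d.
  apply: (le_lt_trans lu); apply: (@le_lt_trans _ _ (t * (S + 1))).
    by rewrite ler_wpM2l ?(ltW t0)// lerDl.
  by rewrite -ltr_pdivlMr// ltr_wpDl.
have D1u : D1 r p u = t ^+ 2 * b * D1 r p nu by rewrite /u D1D !D1ZR dY mulr0 add0r.
have h1 := hd u ud; rewrite rp subr0 D1u in h1.
have h2 : `|D2 r p u u - D2 r p (t%:C%C *: Y) (t%:C%C *: Y)| <= K * ((t ^+ 2 * S) * (2 * (t
  * S))).
  apply: (le_trans (D2_diff u _ hK)); rewrite ler_wpM2l ?(ltW K0)//.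
  apply: ler_pM; [exact: l1_ge0|by rewrite addr_ge0 ?l1_ge0| |].
    have -> : u - t%:C%C *: Y = (t ^+ 2 * b)%:C%C *: nu by rewrite /u addrAC subrr add0r.
    by rewrite lnu ler_wpM2l ?sqr_ge0// /S lerDr l1_ge0.
  have : l1 (t%:C%C *: Y) <= t * S by rewrite lY ler_wpM2l ?(ltW t0)// /S lerDl.
  by move=> h; have := lerD lu h; lra.
rewrite D2ZlR D2ZrR in h2.
have h3 : e / (2 * (S ^+ 2 + 1)) * l1 u ^+ 2 <= e / 2 * t ^+ 2.
  apply: (@le_trans _ _ (e / (2 * (S ^+ 2 + 1)) * (t * S) ^+ 2)).
    by rewrite ler_wpM2l ?(ltW e10)// lerXn2r ?nnegrE ?l1_ge0// (le_trans _ lu) ?l1_ge0.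
  have -> : e / (2 * (S ^+ 2 + 1)) * (t * S) ^+ 2 = (e / 2 * t ^+ 2) * (S ^+ 2 / (S ^+ 2 + 1)).
    by field; rewrite gt_eqF// ltr_wpDl ?sqr_ge0.
  apply: ler_piMr; first by apply: mulr_ge0; [apply: divr_ge0 => //; exact: ltW|exact:
    sqr_ge0].
  by rewrite ler_pdivrMr ?ltr_wpDl ?sqr_ge0// mul1r lerDl.
have h4 : K * ((t ^+ 2 * S) * (2 * (t * S))) <= e * t ^+ 2.
  have -> : K * ((t ^+ 2 * S) * (2 * (t * S))) = (t * (2 * (K * S ^+ 2))) * t ^+ 2 by ring.
  rewrite ler_wpM2r ?sqr_ge0//; rewrite ltr_pdivlMr// in te.
  by apply: le_trans (ltW te); rewrite ler_wpM2l ?(ltW t0)//; lra.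
move: h1 h2 h3 h4; move: (D2 r p u u) (D2 r p Y Y) (D1 r p nu) (r (p + u)) => q q' q'' ru.
move: (e / _ * l1 u ^+ 2) (K * _) => c1 c2; rewrite !ler_norml.
by move=> /andP[? ?] /andP[? ?] ? ?; apply/andP; split; lra.
Qed.

Section TwoDefiningFunctions.
Variables (r r0 : 'rV[R[i]]_n -> R) (p nu v0 : 'rV[R[i]]_n).
Hypotheses (Cr : Ck 2 r) (Cr0 : Ck 2 r0) (rp : r p = 0) (r0p : r0 p = 0).
Hypothesis same_domain : forall z, r z < 0 -> r0 z < 0.
Hypotheses (nu_out : 0 < D1 r p nu) (nondeg : D1 r0 p v0 != 0).

(** Otherwise a short move along [u] would enter the domain of [r] while making [r0] positive. *)
Lemma D1_le0_transfer u : D1 r p u < 0 -> D1 r0 p u <= 0.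
Proof.
move=> du; rewrite leNgt; apply/negP => du0.
have z0 q : D1 q p (0 : 'rV[R[i]]_n) = 0.
  by rewrite -(scale0r u) -[0]/(0%:C%C) D1ZR mul0r.
have [K K0 hK] := pderiv2s_bound r p; have [K' K'0 hK'] := pderiv2s_bound r0 p.
have [d d0 hd] := expand2 p Cr ltr01; have [d' d'0 hd'] := expand2 p Cr0 ltr01.
pose L := l1 u; have L0 : 0 <= L by exact: l1_ge0.
pose M := (1 + K + K') * L ^+ 2 + 1.
have M0 : 0 < M.
  apply: ltr_wpDl => //; apply: mulr_ge0; last exact: sqr_ge0.
  by apply: addr_ge0; [apply: addr_ge0 => //; exact: ltW|exact: ltW].
pose g := Num.min (- D1 r p u) (D1 r0 p u).
have g0 : 0 < g by rewrite lt_min oppr_gt0 du du0.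
have g1 : g <= - D1 r p u by rewrite ge_min lexx.
have g2 : g <= D1 r0 p u by rewrite ge_min lexx orbT.
pose t := Num.min (Num.min (d / (L + 1)) (d' / (L + 1))) (g / M) / 2.
have m0 : 0 < Num.min (Num.min (d / (L + 1)) (d' / (L + 1))) (g / M).
  by rewrite !lt_min !divr_gt0//; exact: ltr_wpDl.
have t0 : 0 < t by rewrite divr_gt0.
have : t < Num.min (Num.min (d / (L + 1)) (d' / (L + 1))) (g / M).
  by rewrite ltr_pdivrMr// ltr_pMr// ltr1n.
have L1 : 0 < L + 1 by exact: ltr_wpDl.
clearbody t g; rewrite !lt_min !(ltr_pdivlMr _ _ L1) (ltr_pdivlMr _ _ M0) => /andP[/andP[td
  td'] tg].
have lu : l1 (t%:C%C *: u) = t * L by rewrite l1ZR gtr0_norm.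
have tL : t * L <= t * (L + 1) by rewrite ler_wpM2l ?(ltW t0)// lerDl.
have := hd (t%:C%C *: u); rewrite lu => /(_ (le_lt_trans tL td)).
have := hd' (t%:C%C *: u); rewrite lu => /(_ (le_lt_trans tL td')).
rewrite !D1ZR !D2ZlR !D2ZrR rp r0p !subr0 !mul1r.
have := D2_bound u u hK; have := D2_bound u u hK'; rewrite -/L -!expr2.
have := @same_domain (p + t%:C%C *: u).
have tM : t * t * M <= t * g by rewrite -mulrA ler_wpM2l ?(ltW t0)// ltW.
have tg1 : t * g <= t * - D1 r p u by rewrite ler_wpM2l ?(ltW t0).
have tg2 : t * g <= t * D1 r0 p u by rewrite ler_wpM2l ?(ltW t0).
have tg0 : 0 < t * g by rewrite mulr_gt0.
have tt0 : 0 < t * t by rewrite mulr_gt0.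
move: tg1 tg2; move: (D2 r p u u) (D2 r0 p u u) (D1 r p u) (D1 r0 p u) (r (p + _)) (r0 (p +
  _)).
move=> q q' a a' rr rr0 tg1 tg2 sd; rewrite !ler_norml => /andP[q1 q2] /andP[q3 q4]
  /andP[w1 w2] /andP[w3 w4].
have k1 : t * t * q <= t * t * (K * L ^+ 2) by rewrite ler_wpM2l ?(ltW tt0).
have k2 : t * t * - q' <= t * t * (K' * L ^+ 2) by rewrite ler_wpM2l ?(ltW tt0)//; lra.
have n1 : 0 <= t * t * (K * L ^+ 2) by rewrite mulr_ge0 ?(ltW tt0)// mulr_ge0 ?sqr_ge0 ?ltW.
have n2 : 0 <= t * t * (K' * L ^+ 2) by rewrite mulr_ge0 ?(ltW tt0)// mulr_ge0 ?sqr_ge0 ?ltW.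
have : rr < 0 by move: tM; rewrite /M; lra.
move=> /sd; move: tM; rewrite /M; lra.
Qed.

(** A tangent vector tilted by [- t nu] points inward for [r]; letting [t] tend to 0 gives one
    inequality for [r0], and the opposite vector gives the other. *)
Lemma D1_eq0_transfer u : D1 r p u = 0 -> D1 r0 p u = 0.
Proof.
have half w : D1 r p w = 0 -> D1 r0 p w <= 0.
  move=> dw; apply: (@le0_of_le_linear _ _ (D1 r0 p nu)) => t /andP[t0 _].
  rewrite -subr_le0 mulrC -mulNr.
  have := @D1_le0_transfer (w + (- t)%:C%C *: nu); rewrite !D1D !D1ZR dw add0r; apply.
  by rewrite mulNr oppr_lt0 mulr_gt0.
move=> du; apply/le_anti; rewrite half//= -oppr_le0 -D1N half// D1N du oppr0.
by [].
Qed.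

(** If [D1 r0 p nu] vanished, so would the whole differential of [r0], because every vector is the
    sum of a tangent one and a multiple of [nu]. *)
Lemma D1_outward_transfer : 0 < D1 r0 p nu.
Proof.
rewrite lt_def; apply/andP; split.
  apply: contra_neq nondeg => h.
  have := @D1_eq0_transfer (v0 - (D1 r p v0 / D1 r p nu)%:C%C *: nu).
  rewrite !D1D !D1N !D1ZR divfK ?gt_eqF// subrr h mulr0 subr0; exact.
by rewrite -oppr_le0 -D1N; apply: D1_le0_transfer; rewrite D1N oppr_lt0.
Qed.

(** If [Lv r p X < 0], two parabolas with velocities [X] and ['i X] and suitable transversal
    accelerations both enter the domain, so [r0] is negative on both. The sum of the second order
    coefficients of [r0] on them is nevertheless positive. *)
Lemma Lv_ge0_transfer X : D1 r p X = 0 -> D1 r p ('i%C *: X) = 0 ->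
  0 <= Lv r0 p X -> 0 <= Lv r p X.
Proof.
have neg (w T m : R) : `|w - T * - (m / 8)| <= m / 16 * T -> 0 < m * T -> w < 0.
  by rewrite ler_norml => /andP[_ ?] ?; lra.
have pos (q q' w w' T eta kap g0 : R) :
    `|w - T * ((eta - kap) * g0 + q / 2)| <= eta * g0 / 2 * T ->
    `|w' - T * ((eta + kap) * g0 + q' / 2)| <= eta * g0 / 2 * T ->
    0 <= T * (q + q') -> 0 < T * (eta * g0) -> w < 0 -> w' < 0 -> False.
  by rewrite !ler_norml => /andP[? _] /andP[? _] ? ? ? ?; lra.
move=> dX diX L0; rewrite leNgt; apply/negP => Ln.
pose g := D1 r p nu; pose g0 := D1 r0 p nu.
have g00 : 0 < g0 by exact: D1_outward_transfer.
pose m := - Lv r p X; have m0 : 0 < m by rewrite oppr_gt0.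
(* The shift [kap] equalises the second order coefficients of [r] along [X] and ['i X], and the
   outward push [eta] still leaves both equal to [- m / 8]. For [r0] the shifts cancel in the sum,
   which is [2 eta g0 + Lv r0 p X / 2]. *)
pose eta := m / (8 * g); have eta0 : 0 < eta by rewrite divr_gt0// mulr_gt0.
pose kap := (D2 r p X X - D2 r p ('i%C *: X) ('i%C *: X)) / (4 * g).
have m16 : 0 < m / 16 by rewrite divr_gt0.
have ee : 0 < eta * g0 / 2 by rewrite divr_gt0// mulr_gt0.
have [t1 t10 h1] := @curve2 r p X nu (eta - kap) Cr rp dX _ m16.
have [t2 t20 h2] := @curve2 r p ('i%C *: X) nu (eta + kap) Cr rp diX _ m16.
have [t3 t30 h3] := @curve2 r0 p X nu (eta - kap) Cr0 r0p (D1_eq0_transfer dX) _ ee.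
have [t4 t40 h4] := @curve2 r0 p ('i%C *: X) nu (eta + kap) Cr0 r0p (D1_eq0_transfer diX) _ ee.
pose t := Num.min (Num.min t1 t2) (Num.min t3 t4) / 2.
have mt0 : 0 < Num.min (Num.min t1 t2) (Num.min t3 t4) by rewrite !lt_min t10 t20 t30 t40.
have t0 : 0 < t by rewrite divr_gt0.
have : t < Num.min (Num.min t1 t2) (Num.min t3 t4) by rewrite ltr_pdivrMr// ltr_pMr// ltr1n.
clearbody t; rewrite !lt_min => /andP[/andP[a1 a2] /andP[a3 a4]].
have {}h1 := h1 t; have {}h2 := h2 t; have {}h3 := h3 t; have {}h4 := h4 t.
rewrite t0 a1 /= in h1; rewrite t0 a2 /= in h2; rewrite t0 a3 /= in h3; rewrite t0 a4 /= in h4.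
have {h1}h1 := h1 isT; have {h2}h2 := h2 isT; have {h3}h3 := h3 isT; have {h4}h4 := h4 isT.
set z1 := p + _ in h1 h3; set z2 := p + _ in h2 h4.
have tt : 0 < t ^+ 2 by rewrite exprn_gt0.
have e1 : (eta - kap) * D1 r p nu + D2 r p X X / 2 = - (m / 8).
  by rewrite /eta /kap -/g /m /Lv; field; rewrite gt_eqF.
have e2 : (eta + kap) * D1 r p nu + D2 r p ('i%C *: X) ('i%C *: X) / 2 = - (m / 8).
  by rewrite /eta /kap -/g /m /Lv; field; rewrite gt_eqF.
rewrite e1 in h1; rewrite e2 in h2.
clearbody z1 z2 m.
have mt : 0 < m * t ^+ 2 by rewrite mulr_gt0.
have n1 := same_domain (neg _ _ _ h1 mt); have n2 := same_domain (neg _ _ _ h2 mt).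
apply: (pos _ _ _ _ _ _ _ _ h3 h4 _ _ n1 n2); last first.
  by apply: mulr_gt0 => //; exact: mulr_gt0.
by apply: mulr_ge0 => //; exact: ltW.
Qed.

End TwoDefiningFunctions.
End Transfer.

(** * Levi form at interior points *)

Section LeviLower.
Variables (R : realType) (n : nat).
Implicit Types (u v z p X Y nu : 'rV[R[i]]_n) (r : 'rV[R[i]]_n -> R).

Lemma norm_le_close (x y e K : R) : `|x - y| <= e -> `|y| <= K -> `|x| <= K + e.
Proof. by rewrite !ler_norml => /andP[? ?] /andP[? ?]; apply/andP; split; lra. Qed.

Lemma pderiv2s_bounded k r p : Ck k.+2 r ->
  exists K : R, 0 < K /\ exists2 d : R, 0 < d & forall w, l1 (w - p) < d ->
    forall a b, `|pderiv (pderiv r (dirv b)) (dirv a) w| <= K.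
Proof.
move=> Cr; have [K K0 hK] := pderiv2s_bound r p.
have [d d0 hd] := pderiv2s_near p Cr ltr01.
exists (K + 1); split; first by rewrite addr_gt0.
exists d => // w /hd h a b; exact: norm_le_close (h a b) (hK a b).
Qed.

Lemma l1_shift z p nu (t : R) : 0 <= t ->
  l1 (z + t%:C%C *: nu - p) <= l1 (z - p) + t * l1 nu.
Proof. by move=> t0; rewrite addrAC (le_trans (l1D _ _))// l1ZR ger0_norm. Qed.

Lemma MVT_dir k r z nu (g s t : R) : Ck k.+1 r -> s <= t ->
  (forall x, s <= x <= t -> g <= D1 r (z + x%:C%C *: nu) nu) ->
  g * (t - s) <= r (z + t%:C%C *: nu) - r (z + s%:C%C *: nu).
Proof.
move=> Cr st hg.
have [x _| |x] := @MVT_segment R (along r nu z) (fun x => D1 r (z + x%:C%C *: nu) nu) s t st.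
- exact: along_is_derive_D1 Cr.
- apply: continuous_subspaceT => x; apply: differentiable_continuous.
  by apply/derivable1_diffP; have [] := along_is_derive_D1 z nu x Cr.
by rewrite in_itv /= => xst; rewrite /along => ->; rewrite ler_wpM2r ?subr_ge0// hg.
Qed.

(** Along [nu] the function grows at rate at least [g / 2], so it reaches 0 before time
    [2 (- r z) / g]. Strict growth also makes it negative just before, which puts the zero in the
    closure of the domain. *)
Lemma boundary_projection k r p0 nu (g D : R) z : Ck k.+1 r -> 0 < g ->
  (forall w, l1 (w - p0) < D -> g / 2 <= D1 r w nu) ->
  r z < 0 -> l1 (z - p0) + (2 * - r z / g) * l1 nu < D ->
  exists2 t : R, 0 <= t <= 2 * - r z / g &
    bdry [set w | r w < 0] (z + t%:C%C *: nu).
Proof.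
move=> Cr g0 hg rz hD; pose T := 2 * - r z / g.
have T0 : 0 < T by rewrite divr_gt0// mulr_gt0// oppr_gt0.
have near_seg x : 0 <= x <= T -> l1 (z + x%:C%C *: nu - p0) < D.
  move=> /andP[x0 xT]; apply: le_lt_trans hD; apply: (le_trans (l1_shift _ _ _ x0)).
  by rewrite lerD2l ler_wpM2r ?l1_ge0.
have slope s t : 0 <= s -> s <= t -> t <= T ->
    g / 2 * (t - s) <= r (z + t%:C%C *: nu) - r (z + s%:C%C *: nu).
  move=> s0 st tT; apply: (MVT_dir Cr st) => x /andP[sx xt]; apply: hg; apply: near_seg.
  by rewrite (le_trans s0 sx) (le_trans xt tT).
have E0 : z + (0 : R)%:C%C *: nu = z by rewrite scale0r addr0.
have rT : 0 <= r (z + T%:C%C *: nu).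
  have := slope 0 T (lexx _) (ltW T0) (lexx _); rewrite E0 subr0.
  have -> : g / 2 * T = - r z by rewrite /T; field; rewrite gt_eqF.
  lra.
have [||t] := @IVT R (along r nu z) 0 T 0 (ltW T0).
- apply: continuous_subspaceT => x; apply: differentiable_continuous.
  by apply/derivable1_diffP; have [] := along_is_derive_D1 z nu x Cr.
- by rewrite /along E0 ge_min (ltW rz) le_max rT orbT.
rewrite in_itv /= => /andP[t0 tT] rt; rewrite /along in rt.
exists t; first by rewrite t0.
have tp : 0 < t.
  by rewrite lt_def t0 andbT; apply: contraTneq rz => tE; rewrite -rt tE E0 ltxx.
split; last by rewrite /= rt ltxx.
move=> A /nbhs_l1P[d d0 hA].
have l1p : 0 < l1 nu + 1 by rewrite ltr_wpDl ?l1_ge0.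
(* A slightly earlier time, at which the point is in the domain and still in the given
   neighbourhood. *)
pose s := Num.max 0 (t - d / (l1 nu + 1)).
have s0 : 0 <= s by rewrite le_max lexx.
have st : s < t by rewrite gt_max tp gtrDl oppr_lt0 divr_gt0.
have sd : t - s <= d / (l1 nu + 1) by rewrite lerBlDr -lerBlDl le_max lexx orbT.
exists (z + s%:C%C *: nu); split.
  have := slope s t s0 (ltW st) tT; rewrite rt /= sub0r lerNr => /le_lt_trans; apply.
  by rewrite oppr_lt0 mulr_gt0 ?divr_gt0 ?subr_gt0.
apply: hA; have -> : z + s%:C%C *: nu - (z + t%:C%C *: nu) = (s - t)%:C%C *: nu.
  by rewrite rmorphB /= scalerBl opprD addrACA subrr add0r.
rewrite l1ZR distrC ger0_norm ?subr_ge0 ?(ltW st)//.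
apply: (@lt_le_trans _ _ (d / (l1 nu + 1) * (l1 nu + 1))); last by rewrite divfK// gt_eqF.
apply: (@le_lt_trans _ _ ((d / (l1 nu + 1)) * l1 nu)); first by rewrite ler_wpM2r ?l1_ge0.
by rewrite ltr_pM2l ?divr_gt0// ltrDl.
Qed.

(** Near an interior point [- r z] is at least half of [- r p0], so a bound on the second
    derivatives is absorbed by the first term. *)
Lemma levi_lower_interior r p0 : Ck 3 r -> r p0 < 0 ->
  exists K d : R, [/\ 0 < K, 0 < d & forall z, r z < 0 -> l1 (z - p0) < d -> forall X,
    - (K * (- r z * l1 X ^+ 2 + cabs (dr_pair r z X) * l1 X)) <= Lv r z X].
Proof.
move=> Cr rp; pose dl := - r p0; have dl0 : 0 < dl by rewrite oppr_gt0.
have [K [K0 [d d0 hd]]] := pderiv2s_bounded p0 Cr.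
have dl2 : 0 < dl / 2 by rewrite divr_gt0.
have [d' d'0 hd'] := continuous_l1 p0 (Ck_continuous Cr) dl2.
exists (4 * K / dl), (Num.min d d'); split.
- by rewrite divr_gt0// mulr_gt0.
- by rewrite lt_min d0.
move=> z rz; rewrite lt_min => /andP[/hd h1 /hd' h2] X.
have {h2}h2 : dl / 2 <= - r z by move: h2; rewrite ler_norml /dl; lra.
have := Lv_bound X h1; rewrite ler_norml => /andP[+ _]; apply: le_trans; rewrite lerN2.
have -> : 2 * K * l1 X ^+ 2 = 4 * K / dl * (dl / 2 * l1 X ^+ 2) by field; rewrite gt_eqF.
rewrite ler_wpM2l//; first by rewrite divr_ge0 ?mulr_ge0 ?ltW.
have : 0 <= cabs (dr_pair r z X) * l1 X by rewrite mulr_ge0 ?cabs_ge0 ?l1_ge0.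
have : dl / 2 * l1 X ^+ 2 <= - r z * l1 X ^+ 2 by rewrite ler_wpM2r ?sqr_ge0.
lra.
Qed.

(** Compare [z] with a boundary point [p] at distance [O(- r z)], and [X] with its projection [X']
    to the complex tangent space at [p]. The first change costs [O(- r z)] by Lipschitz second
    derivatives; the second is controlled by the pairing at [p], which differs from the one at [z]
    by [O(- r z) l1 X]. *)
Lemma levi_lower_bdry r p0 : Ck 3 r -> bdry [set w | r w < 0] p0 ->
  (exists v, dr_pair r p0 v != 0) ->
  (forall p, bdry [set w | r w < 0] p -> forall X, dr_pair r p X = 0 -> 0 <= Lv r p X) ->
  exists K d : R, [/\ 0 < K, 0 < d & forall z, r z < 0 -> l1 (z - p0) < d -> forall X,
    - (K * (- r z * l1 X ^+ 2 + cabs (dr_pair r z X) * l1 X)) <= Lv r z X].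
Proof.
move=> Cr bp0 [v vn0] hL; have rp0 := bdry_eq0 (Ck_continuous Cr) bp0.
(* One of [v], ['i v] and their opposites increases [r] to first order, since the complex pairing
   with [v] is not zero. *)
have [nu nu0] : exists nu, 0 < D1 r p0 nu.
  have [[h1 h2]|] := pselect (D1 r p0 v = 0 /\ D1 r p0 ('i%C *: v) = 0).
    by move: vn0; rewrite (iffRL (dr_pair_eq0 r p0 v) (conj h1 h2)) eqxx.
  have pos w : D1 r p0 w != 0 -> exists nu, 0 < D1 r p0 nu.
    rewrite neq_lt => /orP[h|h]; last by exists w.
    by exists (- w); rewrite D1N oppr_gt0.
  move=> h; have [h1|] := eqVneq (D1 r p0 v) 0; last exact: pos.
  have [h2|] := eqVneq (D1 r p0 ('i%C *: v)) 0; last exact: pos.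
  by case: h.
pose g := D1 r p0 nu; pose N := l1 nu; have N0 : 0 <= N by exact: l1_ge0.
have N1 : 0 < N + 1 by exact: ltr_wpDl.
have e1 : 0 < g / (2 * (N + 1)) by rewrite divr_gt0// mulr_gt0.
have [d1 d10 hd1] := pderivs_near p0 Cr e1.
have [K1 [K10 [d2 d20 hd2]]] := pderivs_lip p0 Cr.
have [K2 [K20 [d3 d30 hd3]]] := pderiv2s_lip p0 Cr.
have [K3 [K30 [d4 d40 hd4]]] := pderiv2s_bounded p0 Cr.
have [K4 [K40 [d5 d50 hd5]]] := pderivs_bounded p0 Cr.
have [D [D0 [D1' D2' D3' D4' D5']]] : exists D : R, 0 < D /\ [/\ D <= d1, D <= d2, D <= d3,
  D <= d4 & D <= d5].
  exists (Num.min d1 (Num.min d2 (Num.min d3 (Num.min d4 d5)))).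
  by rewrite !lt_min d10 d20 d30 d40 d50; split => //; split; rewrite !ge_min lexx ?orbT.
have slope w : l1 (w - p0) < D -> g / 2 <= D1 r w nu.
  move=> wD; have := D1_close nu (hd1 w (lt_le_trans wD D1')); rewrite -/N -/g.
  have : g / (2 * (N + 1)) * N <= g / 2.
    rewrite mulrAC ler_pdivrMr ?mulr_gt0//.
    have -> : g / 2 * (2 * (N + 1)) = g * (N + 1) by field.
    by rewrite ler_wpM2l ?(ltW nu0)// lerDl.
  rewrite ler_norml; lra.
have e2 : 0 < g * D / (8 * (N + 1)) by rewrite divr_gt0 ?mulr_gt0.
have [d6 d60 hd6] := continuous_l1 p0 (Ck_continuous Cr) e2.
(* In units of [- r z], [c1] bounds the distance from [z] to [p]; [c2] bounds [X - X'] relative to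
   the pairing at [p]; [c3] is the resulting factor in the change of the Levi form. *)
pose c1 := 2 * N / g; pose c2 := 8 * N / g; pose c3 := 2 * K3 * (c2 * (2 + c2 * K4)).
have g0 : 0 < g by [].
have c10 : 0 <= c1 by rewrite divr_ge0 ?mulr_ge0 ?(ltW g0).
have c20 : 0 <= c2 by rewrite divr_ge0 ?mulr_ge0 ?(ltW g0).
have c40 : 0 <= c2 * K4 by rewrite mulr_ge0 ?(ltW K40).
have c30 : 0 <= c3.
  by apply: mulr_ge0; [apply: mulr_ge0 => //; exact: ltW|apply: mulr_ge0 => //; exact:
    addr_ge0].
exists (c3 + c3 * (K1 * c1) + 2 * (K2 * c1) + 1), (Num.min (D / 2) d6); split.
- have k1 : 0 <= K1 * c1 by rewrite mulr_ge0 ?(ltW K10).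
  have k2 : 0 <= K2 * c1 by rewrite mulr_ge0 ?(ltW K20).
  have := mulr_ge0 c30 k1; lra.
- by rewrite lt_min d60 divr_gt0.
move=> z rz; rewrite lt_min => /andP[zD /hd6 hz] X.
pose dl := - r z; have dl0 : 0 < dl by rewrite oppr_gt0.
have dle : dl <= g * D / (8 * (N + 1)) by move: hz; rewrite rp0 subr0 ltr0_norm.
have TD : (2 * dl / g) * N < D / 2.
  have : 2 * dl / g * (N + 1) <= D / 4.
    rewrite mulrAC ler_pdivrMr//; rewrite ler_pdivlMr ?mulr_gt0// in dle.
    lra.
  have : 0 <= 2 * dl / g by rewrite divr_ge0 ?mulr_ge0 ?(ltW dl0) ?(ltW g0).
  lra.
have [|t /andP[t0 tT] bp] := boundary_projection Cr g0 slope rz; first by rewrite -/dl -/N;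
  lra.
set p := z + t%:C%C *: nu in bp.
have pz : l1 (z - p) <= c1 * dl.
  rewrite l1C /p addrAC subrr add0r l1ZR ger0_norm// /c1 -/N.
  have -> : 2 * N / g * dl = 2 * dl / g * N by ring.
  by rewrite ler_wpM2r.
have pD : l1 (p - p0) < D.
  apply: (le_lt_trans (l1_shift _ _ _ t0)); rewrite -/N.
  have h : t * N <= 2 * dl / g * N by rewrite ler_wpM2r.
  by clear -h TD zD; lra.
have zD' : l1 (z - p0) < D by apply: (lt_le_trans zD); rewrite ler_pdivrMr// ler_peMr
  ?ler1n ?ltW.
clearbody p.
pose L := l1 X; have L0 : 0 <= L by exact: l1_ge0.
pose A := cabs (dr_pair r z X); have A0 : 0 <= A by exact: cabs_ge0.
have dnu : g / 4 <= cabs (dr_pair r p nu).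
  have := slope p pD; rewrite D1_dr_pair => h1.
  by have h2 := le_trans (ler_norm _) (abs_Re_le (dr_pair r p nu)); clear -h1 h2; lra.
have dnu0 : 0 < cabs (dr_pair r p nu) by apply: lt_le_trans dnu; rewrite divr_gt0.
have dnun0 : dr_pair r p nu != 0 by rewrite -cabs_gt0.
pose a := dr_pair r p X / dr_pair r p nu.
pose X' := X - a *: nu.
have dX' : dr_pair r p X' = 0 by rewrite dr_pairD -scaleNr dr_pairZ mulNr divfK// subrr.
have dpX : cabs (dr_pair r p X) <= A + K1 * (c1 * dl) * L.
  have h : cabs (dr_pair r p X - dr_pair r z X) <= K1 * l1 (p - z) * L.
    by apply: dr_pair_close => b; apply: hd2; [exact: lt_le_trans D2'|exact: lt_le_trans D2'].
  have := cabs_dist_le (dr_pair r p X) (dr_pair r z X); rewrite -/A => h'.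
  have h'' : K1 * l1 (p - z) * L <= K1 * (c1 * dl) * L.
    by rewrite l1C ler_wpM2r// ler_wpM2l ?(ltW K10).
  by clear -h h' h''; lra.
have dpX2 : cabs (dr_pair r p X) <= K4 * L.
  by apply: dr_pair_bound; apply: hd5; exact: lt_le_trans D5'.
have XX' : l1 (X - X') <= c2 * cabs (dr_pair r p X).
  have -> : X - X' = a *: nu by rewrite /X' opprB addrC subrK.
  apply: (le_trans (l1Z _ _)); rewrite /a cabsM cabsV -/N.
  have -> : 2 * (cabs (dr_pair r p X) / cabs (dr_pair r p nu)) * N =
    (2 * N * cabs (dr_pair r p X)) / cabs (dr_pair r p nu) by ring.
  rewrite ler_pdivrMr//.
  have -> : 2 * N * cabs (dr_pair r p X) = c2 * cabs (dr_pair r p X) * (g / 4).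
    by rewrite /c2; field; rewrite gt_eqF.
  by rewrite ler_wpM2l// mulr_ge0 ?cabs_ge0.
have lX' : l1 X' <= (1 + c2 * K4) * L.
  have -> : X' = X - (X - X') by rewrite opprB addrC subrK.
  apply: (le_trans (l1B _ _)).
  have h : c2 * cabs (dr_pair r p X) <= c2 * (K4 * L) by rewrite ler_wpM2l.
  by rewrite -/L; clear -XX' h; lra.
have b1 := Lv_close X (fun a b => hd3 z p (lt_le_trans zD' D3') (lt_le_trans pD D3') a b).
have b2 := Lv_diff X X' (hd4 p (lt_le_trans pD D4')).
have b3 := hL p bp X' dX'.
have q1 : 2 * (K2 * l1 (z - p)) * L ^+ 2 <= 2 * (K2 * c1) * (dl * L ^+ 2).
  have : l1 (z - p) * L ^+ 2 <= (c1 * dl) * L ^+ 2 by rewrite ler_wpM2r ?sqr_ge0.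
  by move=> h; have h' := ler_wpM2l (ltW K20) h; clear -h'; lra.
have q2 : 2 * K3 * (l1 (X - X') * (l1 X + l1 X')) <= c3 * (A * L + K1 * c1 * (dl * L ^+ 2)).
  have h : l1 (X - X') * (l1 X + l1 X') <= (c2 * (A + K1 * (c1 * dl) * L)) * ((2 + c2 * K4)
    * L).
    apply: ler_pM; [exact: l1_ge0|by rewrite addr_ge0 ?l1_ge0| |].
      by apply: (le_trans XX'); rewrite ler_wpM2l.
    by rewrite -/L; clear -lX'; lra.
  have K32 : 0 <= 2 * K3 by rewrite mulr_ge0 ?(ltW K30).
  apply: (le_trans (ler_wpM2l K32 h)); rewrite le_eqVlt; apply/orP; left; apply/eqP.
  by rewrite /c3; ring.
have pAL : 0 <= A * L by rewrite mulr_ge0.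
have pdL : 0 <= dl * L ^+ 2 by rewrite mulr_ge0 ?sqr_ge0 ?(ltW dl0).
have k1 : 0 <= K1 * c1 by rewrite mulr_ge0 ?(ltW K10).
have k2 : 0 <= K2 * c1 by rewrite mulr_ge0 ?(ltW K20).
have s1 := mulr_ge0 (mulr_ge0 c30 k1) pAL.
have s2 := mulr_ge0 k2 pAL.
have s3 := mulr_ge0 c30 pdL.
move: b1 b2 b3 q1 q2 s1 s2 s3 pAL pdL; rewrite -/dl -/A -/L.
move: (A * L) (dl * L ^+ 2) (Lv r z X) (Lv r p X) (Lv r p X') (K1 * c1) (K2 * c1).
move: (2 * (K2 * l1 (z - p)) * L ^+ 2) (2 * K3 * _) => w1 w2.
clearbody c3; clear; move=> AL dL l l' l'' y1 y2.
rewrite !ler_norml => /andP[? ?] /andP[? ?] ? ? ? ? ? ? ? ?; lra.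
Qed.

End LeviLower.

(** * Discs in pseudoconvex domains *)

Lemma coord_le_mx_norm (K : numDomainType) (m n : nat) (x : 'M[K]_(m, n)) i j :
  `|x i j| <= mx_norm x.
Proof.
rewrite mx_normE -[leLHS]nngE num_le.
exact: (le_bigmax _ (fun ij : 'I_m * 'I_n => `|x ij.1 ij.2|%:nng) (i, j)).
Qed.

Section PartTwo.
Variables (R : realType) (n : nat).
Implicit Types (u v z p X Y nu : 'rV[R[i]]_n) (r : 'rV[R[i]]_n -> R) (Om : set 'rV[R[i]]_n).

Lemma coord_le_norm u (j : 'I_n) : `|u 0 j| <= `|u|.
Proof. exact: (coord_le_mx_norm u 0 j). Qed.

Lemma bounded_coords Om : bounded_set Om ->
  exists M : R, 0 < M /\ forall u, Om u -> forall j, cabs (u 0 j) <= M.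
Proof.
move=> [M [Mr hM]]; have [x xE] : exists x : R, M = x%:C%C by exact/complex_realP.
exists (`|x| + 1); split; first by rewrite ltr_wpDl.
move=> u Ou j.
have : `|u| <= (`|x| + 1)%:C%C.
  by apply: (hM _ _ u Ou); rewrite xE ltcR (le_lt_trans (ler_norm _))// ltrDl.
by move=> /(le_trans (coord_le_norm u j)); rewrite -lecR.
Qed.

(** The closure lies in a product of squares of the complex plane, each of them the continuous image
    of a compact real square. *)
Lemma compact_closure Om : bounded_set Om -> compact (closure Om).
Proof.
move=> /bounded_coords[M [M0 hM]].
pose phi (q : R * R) : R[i] := (q.1 +i* q.2)%C.
pose Q := phi @` (`[- (M + 1), M + 1] `*` `[- (M + 1), M + 1]).
have cQ : compact Q.
  apply: continuous_compact; last by apply: compact_setX; exact: segment_compact.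
  apply: continuous_subspaceT => -[x y] A /nbhs_cabsP[d d0 hA].
  have d2 : 0 < d / 2 by rewrite divr_gt0.
  exists (ball x (d / 2), ball y (d / 2)).
    by split; apply/nbhs_ballP; exists (d / 2).
  move=> [x' y'] [/= xx' yy']; apply: hA.
  apply: (le_lt_trans (cabs_le_ReIm _)) => /=.
  by rewrite [`|x' - x|]distrC [`|y' - y|]distrC (splitr d) ltrD.
apply: (@subclosed_compact _ _ [set v : 'rV[R[i]]_n | forall i, Q (v ord0 i)]).
- exact: closed_closure.
- by apply: (@rV_compact _ n (fun=> Q)).
move=> u cu j.
have [w Ow wu] := closure_l1 cu ltr01.
have uM : cabs (u 0 j) <= M + 1.
  have := cabs_le_l1 (w - u) j; rewrite !mxE; have := hM w Ow j.
  have := cabs_dist_le (u 0 j) (w 0 j); rewrite cabsC; lra.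
exists (complex.Re (u 0 j), complex.Im (u 0 j)); last by rewrite /phi /=; case: (u 0 j).
by split; rewrite /= in_itv /= -ler_norml; [apply: le_trans (abs_Re_le _) _|apply: le_trans
  (abs_Im_le _) _].
Qed.

Lemma holo_disc_cder (f : R[i] -> 'rV[R[i]]_n) (w : R[i]) j : derivable f w 1 ->
  cder (fun x => f x 0 j) w ('D_1 f w 0 j).
Proof.
move=> hf; have /derivable_l1P hl : h^-1 *: (f (h *: 1 + w) - f w) @[h --> 0^'] --> 'D_1 f
  w by exact: hf.
move=> e /hl[d d0 hd]; exists d => // k /hd; apply: le_trans.
have := cabs_le_l1 (f (w + k) - f w - k *: 'D_1 f w) j.
by rewrite !mxE mulrC.
Qed.

Lemma holo_disc_taylor (f : R[i] -> 'rV[R[i]]_n) (M : R) : 0 < M -> holo_disc f ->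
  (forall w : R[i], `|w| < 1 -> forall j, cabs (f w 0 j) <= M) ->
  l1 ('D_1 f 0) <= n%:R * (2 * (8 * M)) /\
  exists2 b, l1 b <= n%:R * (2 * (64 * M)) & forall w, cabs w < 1 ->
    l1 (f w - f 0 - w *: 'D_1 f 0 - w ^+ 2 *: b) <= n%:R * (2 * (512 * M * cabs w ^+ 3)).
Proof.
move=> M0 hf hM.
have T j := @disc_taylor R (fun w => f w 0 j) M ('D_1 f 0 0 j) M0.
have {}T j : cabs ('D_1 f 0 0 j) <= 8 * M /\ exists b, cabs b <= 64 * M /\
    forall w, cabs w < 1 -> cabs (f w 0 j - f 0 0 j - 'D_1 f 0 0 j * w - b * w ^+ 2) <= 512
      * M * cabs w ^+ 3.
  have [w w1||h [b hb1 hb2]] := T j; last by split => //; exists b.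
    split; last by apply: hM; rewrite cabs_lt1.
    by exists ('D_1 f w 0 j); apply: holo_disc_cder; apply: hf; rewrite cabs_lt1.
  by apply: holo_disc_cder; apply: hf; rewrite normr0.
split; first by apply: l1_le_cabs => j; have [] := T j.
have [b hb] := choice (fun j => (T j).2).
exists (\row_j b j); first by apply: l1_le_cabs => j; rewrite mxE; have [] := hb j.
move=> w w1; apply: l1_le_cabs => j; have [_ /(_ w w1)] := hb j.
by rewrite !mxE [w * _]mulrC [w ^+ 2 * _]mulrC.
Qed.

(* Adding the second order expansions of [r] at [f w] and [f (i w)] cancels the
   quadratic term of [f] and the pluriharmonic part of the Hessian, leaving the
   Levi form. *)
Lemma two_point_expansion r p0 : Ck 3 r -> exists K D : R, [/\ 0 < K, 0 < D &
  forall z Y b S rho t w, l1 (z - p0) < D -> cabs w = t -> t <= 1 -> t * S < D ->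
    2 * l1 Y + 2 * l1 b + rho <= S -> 0 <= rho ->
    forall u1 u2, l1 (u1 - w *: Y - w ^+ 2 *: b) <= rho * t ^+ 3 ->
      l1 (u2 - ('i%C * w) *: Y - ('i%C * w) ^+ 2 *: b) <= rho * t ^+ 3 ->
    2 * r z + 2 * complex.Re ((1 + 'i%C) * w * dr_pair r z Y) + t ^+ 2 * Lv r z Y / 2 -
      K * (rho + S ^+ 2 + S ^+ 3) * t ^+ 3 <= r (z + u1) + r (z + u2)].
Proof.
move=> Cr.
have [K2 [K20 [d2 d20 hd2]]] := pderiv2s_lip p0 Cr.
have [K3 [K30 [d3 d30 hd3]]] := pderiv2s_bounded p0 Cr.
have [K1 [K10 [d1 d10 hd1]]] := pderivs_bounded p0 Cr.
have [D [D0 [D1' D2' D3']]] : exists D : R, 0 < D /\ [/\ 2 * D <= d1, 2 * D <= d2 & 2 * D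
  <= d3].
  exists (Num.min d1 (Num.min d2 d3) / 2).
  rewrite divr_gt0 ?lt_min ?d10 ?d20 ?d30//; split => //.
  by rewrite mulrC divfK//; split; rewrite !ge_min lexx ?orbT.
have Kpos : 0 < K1 + K2 + K3 by rewrite !addr_gt0.
exists (2 * (K1 + K2 + K3)), D; split => //; first by rewrite mulr_gt0.
move=> z Y b S rho t w zD wt t1 tS SS rho0.
have t0 : 0 <= t by rewrite -wt cabs_ge0.
have lY := l1_ge0 Y; have lb := l1_ge0 b.
have S0 : 0 <= S by lra.
have tt : t ^+ 2 <= t by rewrite expr2 ler_piMl.
have ttt : t ^+ 3 <= t ^+ 2 by rewrite exprS ler_piMl ?sqr_ge0.
have t30 : 0 <= t ^+ 3 by rewrite exprn_ge0.
(* Two third order errors enter: moving the Hessian from the intermediate point to [z] costs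
   [S^3 t^3], and replacing [u] by [x Y] inside it costs [S^2 t^3]. *)
have one (x : R[i]) u : cabs x = t -> l1 (u - x *: Y - x ^+ 2 *: b) <= rho * t ^+ 3 ->
    r z + D1 r z u + D2 r z (x *: Y) (x *: Y) / 2 - (K2 * S ^+ 3 + K3 * S ^+ 2) * t ^+ 3 <=
      r (z + u).
  move=> xt hu.
  have lxY : l1 (x *: Y) <= 2 * t * l1 Y by rewrite -xt; exact: l1Z.
  have lxb : l1 (x ^+ 2 *: b) <= 2 * t ^+ 2 * l1 b by rewrite -xt -cabsX; exact: l1Z.
  have rt : rho * t ^+ 3 <= rho * t ^+ 2 by rewrite ler_wpM2l.
  have dd : l1 (u - x *: Y) <= t ^+ 2 * S.
    have -> : u - x *: Y = (u - x *: Y - x ^+ 2 *: b) + x ^+ 2 *: b by rewrite subrK.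
    apply: (le_trans (l1D _ _)).
    have : t ^+ 2 * (2 * l1 b + rho) <= t ^+ 2 * S by rewrite ler_wpM2l ?sqr_ge0//; lra.
    lra.
  have lu : l1 u <= t * S.
    have -> : u = (u - x *: Y - x ^+ 2 *: b) + x ^+ 2 *: b + x *: Y by rewrite !subrK.
    apply: (le_trans (l1D _ _)); apply: (le_trans (lerD (l1D _ _) (lexx _))).
    have : t * (2 * l1 Y + 2 * l1 b + rho) <= t * S by rewrite ler_wpM2l.
    have : 2 * t ^+ 2 * l1 b <= 2 * t * l1 b by rewrite ler_wpM2r// ler_wpM2l.
    have : rho * t ^+ 2 <= rho * t by rewrite ler_wpM2l.
    lra.
  have [s /andP[s0 s1] ->] := taylor2 z u (Ck_pred Cr).
  have sS : s * l1 u <= t * S by apply: le_trans lu; rewrite ler_piMl ?l1_ge0.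
  have sD : l1 (z + s%:C%C *: u - p0) < d2.
    by apply: (le_lt_trans (l1_shift _ _ _ s0)); lra.
  have zd2 : l1 (z - p0) < d2 by lra.
  have zd3 : l1 (z - p0) < d3 by lra.
  have b1 := D2_close u u (hd2 _ _ sD zd2).
  have b2 := D2_diff u (x *: Y) (hd3 _ zd3).
  have q1 : K2 * l1 (z + s%:C%C *: u - z) * (l1 u * l1 u) <= K2 * S ^+ 3 * t ^+ 3.
    have -> : z + s%:C%C *: u - z = s%:C%C *: u by rewrite addrAC subrr add0r.
    rewrite l1ZR ger0_norm//.
    have lu2 : l1 u * l1 u <= (t * S) * (t * S) by apply: ler_pM; rewrite ?l1_ge0.
    have lu3 : (s * l1 u) * (l1 u * l1 u) <= (t * S) * ((t * S) * (t * S)).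
      by apply: ler_pM => //; apply: mulr_ge0 => //; exact: l1_ge0.
    have := ler_wpM2l (ltW K20) lu3; lra.
  have q2 : K3 * (l1 (u - x *: Y) * (l1 u + l1 (x *: Y))) <= 2 * K3 * S ^+ 2 * t ^+ 3.
    have -> : 2 * K3 * S ^+ 2 * t ^+ 3 = K3 * ((t ^+ 2 * S) * (2 * (t * S))) by ring.
    rewrite ler_wpM2l ?(ltW K30)//; apply: ler_pM => //; rewrite ?addr_ge0 ?l1_ge0//.
    have : t * (2 * l1 Y) <= t * S by rewrite ler_wpM2l//; lra.
    lra.
  move: b1 b2 q1 q2; move: (D2 r (z + _) u u) (D2 r z u u) (D2 r z _ _) (D1 r z u) => k1 k2
    k3 k4.
  move: (K2 * l1 _ * _) (K3 * _) => c1 c2; rewrite !ler_norml => /andP[? ?] /andP[? ?] ? ?.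
  lra.
move=> u1 u2 h1 h2.
have iw : cabs ('i%C * w) = t by rewrite cabsM -wt /cabs /= expr0n expr1n /= add0r sqrtr1
  mul1r.
have e1 := one w u1 wt h1; have e2 := one ('i%C * w) u2 iw h2.
have LE : D2 r z (w *: Y) (w *: Y) + D2 r z (('i%C * w) *: Y) (('i%C * w) *: Y) = t ^+ 2 *
  Lv r z Y.
  by rewrite -wt -LvZ /Lv scalerA.
have DE : 2 * complex.Re ((1 + 'i%C) * w * dr_pair r z Y) - K1 * (2 * (rho * t ^+ 3)) <= D1
  r z u1 + D1 r z u2.
  rewrite -dr_pairZ -D1_dr_pair -D1D.
  pose e := (u1 - w *: Y - w ^+ 2 *: b) + (u2 - ('i%C * w) *: Y - ('i%C * w) ^+ 2 *: b).
  have -> : u1 + u2 = ((1 + 'i%C) * w) *: Y + e.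
    apply/rowP => j; rewrite /e !mxE; have i2 : 'i%C * 'i%C = -1 :> R[i] by rewrite -expr2
      sqr_i.
    have -> : ('i%C * w) ^+ 2 = - (w ^+ 2) by rewrite exprMn sqr_i mulN1r.
    ring.
  rewrite D1D lerD2l lerNl.
  have zd1 : l1 (z - p0) < d1 by lra.
  have := D1_bound e (hd1 _ zd1); rewrite ler_norml => /andP[h _].
  have : K1 * l1 e <= K1 * (2 * (rho * t ^+ 3)).
    rewrite ler_wpM2l ?(ltW K10)//; apply: (le_trans (l1D _ _)); lra.
  lra.
have n1 : 0 <= S ^+ 3 * t ^+ 3 by rewrite mulr_ge0 ?exprn_ge0.
have n2 : 0 <= S ^+ 2 * t ^+ 3 by rewrite mulr_ge0 ?exprn_ge0.
have n3 : 0 <= rho * t ^+ 3 by rewrite mulr_ge0.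
have m1 := mulr_ge0 (ltW K10) n1; have m2 := mulr_ge0 (ltW K10) n2.
have m3 := mulr_ge0 (ltW K20) n1; have m4 := mulr_ge0 (ltW K20) n2.
have m5 := mulr_ge0 (ltW K20) n3; have m6 := mulr_ge0 (ltW K30) n1.
have m7 := mulr_ge0 (ltW K30) n2; have m8 := mulr_ge0 (ltW K30) n3.
move: e1 e2 LE DE; move: (D2 r z _ _) (D2 r z _ _) (D1 r z u1) (D1 r z u2) (Lv r z Y)
  (complex.Re _).
move: (r (z + u1)) (r (z + u2)) (r z) => ? ? ? ? ? ? ? ? ? ? ? ? ?.
lra.
Qed.

End PartTwo.

(** * The exponent 2/3, first near a point and then on the whole domain *)

Section NormalBound.
Variables (R : realType) (n : nat).
Implicit Types (u v z p X Y nu : 'rV[R[i]]_n) (r : 'rV[R[i]]_n -> R) (Om : set 'rV[R[i]]_n).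

(** The negative part of [L] is absorbed, one share in [dl] and one in [tau a], which leaves
    [a <= dl / tau + 3 E tau^2]. The choice of [tau] proportional to the cube root [s] of [dl] gives
    both terms the order [s^2], that is [dl^(2/3)]. *)
Lemma optimal_radius (a dl tau E L KB KB2 t s kap : R) : 0 < kap -> 0 < s ->
  dl = s ^+ 3 -> tau = kap * s -> 0 <= a -> 0 <= E -> 0 <= t -> t ^+ 2 = 2 * tau ^+ 2 ->
  t <= 2 * tau -> tau * KB <= 1 -> tau ^+ 2 * KB2 <= 1 -> - (KB2 * dl + KB * a) <= L ->
  - 2 * dl + 4 * tau * a + t ^+ 2 * L / 2 - E * t ^+ 3 <= 0 ->
  a <= (kap^-1 + 3 * E * kap ^+ 2) * s ^+ 2.
Proof.
move=> k0 s0 dlE tauE a0 E0 t0 t2 tt h1 h2 hL h.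
have tau0 : 0 < tau by rewrite tauE mulr_gt0.
have dl0 : 0 < dl by rewrite dlE exprn_gt0.
have t3 : t ^+ 3 <= 8 * tau ^+ 3.
  have -> : 8 * tau ^+ 3 = (2 * tau) ^+ 3 by ring.
  by rewrite lerXn2r// nnegrE mulr_ge0 ?ltW.
have g1 : E * t ^+ 3 <= E * (8 * tau ^+ 3) by rewrite ler_wpM2l.
have g2 : tau ^+ 2 * - (KB2 * dl + KB * a) <= tau ^+ 2 * L by rewrite ler_wpM2l ?sqr_ge0.
have g3 : tau ^+ 2 * KB2 * dl <= 1 * dl by rewrite ler_wpM2r ?(ltW dl0).
have g4 : (tau * KB) * (tau * a) <= 1 * (tau * a) by rewrite ler_wpM2r ?mulr_ge0 ?(ltW tau0).
rewrite t2 in h.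
have g5 : tau * a <= dl + 3 * E * tau ^+ 3.
  have : 0 <= E * tau ^+ 3 by rewrite mulr_ge0 ?exprn_ge0 ?(ltW tau0).
  lra.
rewrite -(ler_pM2l tau0); apply: (le_trans g5).
rewrite dlE tauE le_eqVlt; apply/orP; left; apply/eqP; field.
by rewrite gt_eqF.
Qed.

Lemma disc_normal_bound r p0 (K d M : R) : Ck 3 r -> 0 < K -> 0 < d -> 0 < M ->
  (forall z, r z < 0 -> l1 (z - p0) < d -> forall X,
    - (K * (- r z * l1 X ^+ 2 + cabs (dr_pair r z X) * l1 X)) <= Lv r z X) ->
  exists C d' : R, [/\ 0 < C, 0 < d' & forall z, r z < 0 -> l1 (z - p0) < d' ->
    forall f : R[i] -> 'rV[R[i]]_n, holo_disc f ->
      (forall w : R[i], `|w| < 1 -> r (f w) < 0) ->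
      (forall w : R[i], `|w| < 1 -> forall j, cabs (f w 0 j) <= M) -> f 0 = z ->
      cabs (dr_pair r z ('D_1 f 0)) <= C * (- r z) `^ (2 / 3)].
Proof.
move=> Cr K0 d0 M0 HL.
have [K' [D [K'0 D0 hexp]]] := two_point_expansion p0 Cr.
have [d6 d60 hd6] := continuous_l1 p0 (Ck_continuous Cr) ltr01.
pose B := n%:R * (2 * (8 * M)); pose B2 := n%:R * (2 * (64 * M)).
pose rho := n%:R * (2 * (512 * M)).
have nn c : 0 <= c -> 0 <= n%:R * (2 * (c * M)).
  by move=> c0; apply: mulr_ge0 => //; apply: mulr_ge0 => //; apply: mulr_ge0 => //; exact:
    ltW.
have B0 : 0 <= B by apply: nn; exact: ler0n.
have B20 : 0 <= B2 by apply: nn; exact: ler0n.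
have rho0 : 0 <= rho by apply: nn; exact: ler0n.
have taylor (f : R[i] -> 'rV[R[i]]_n) : holo_disc f ->
    (forall w : R[i], `|w| < 1 -> forall j, cabs (f w 0 j) <= M) ->
    l1 ('D_1 f 0) <= B /\ exists2 b, l1 b <= B2 & forall w, cabs w < 1 ->
    l1 (f w - f 0 - w *: 'D_1 f 0 - w ^+ 2 *: b) <= rho * cabs w ^+ 3.
  move=> hf hM; have [h1 [b hb h2]] := holo_disc_taylor M0 hf hM; split => //.
  exists b => // w /h2; rewrite /rho.
  by have -> : n%:R * (2 * (512 * M * cabs w ^+ 3)) = n%:R * (2 * (512 * M)) * cabs w ^+ 3
    by ring.
clearbody B B2 rho.
pose S := 2 * B + 2 * B2 + rho + 1; have S0 : 0 < S by rewrite /S; lra.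
pose E := K' * (rho + S ^+ 2 + S ^+ 3).
have E0 : 0 <= E.
  apply: mulr_ge0; first exact: ltW.
  by apply: addr_ge0; [apply: addr_ge0 => //; exact: sqr_ge0|apply: exprn_ge0; exact: ltW].
(* The largest admissible radius: it keeps [t <= 2 tau] below 1, the two absorptions of
   [optimal_radius] valid, and the disc where the expansion holds. *)
have [tau0 [tau00 ta tb tc td]] : exists tau0 : R, [/\ 0 < tau0, tau0 <= 1 / 4,
    tau0 * (K * B + 1) <= 1, tau0 * (K * B ^+ 2 + 1) <= 1 & tau0 * (4 * S) <= D].
  have q1 : 0 < K * B + 1 by apply: ltr_wpDl => //; apply: mulr_ge0 => //; exact: ltW.
  have q2 : 0 < K * B ^+ 2 + 1.
    by apply: ltr_wpDl => //; apply: mulr_ge0; [exact: ltW|exact: sqr_ge0].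
  have q3 : 0 < 4 * S by exact: mulr_gt0.
  exists (Num.min (1 / 4) (Num.min (1 / (K * B + 1)) (Num.min (1 / (K * B ^+ 2 + 1)) (D /
    (4 * S))))).
  split; first by rewrite !lt_min !divr_gt0.
  - by rewrite ge_min lexx.
  - by rewrite -ler_pdivlMr// !ge_min lexx !orbT.
  - by rewrite -ler_pdivlMr// !ge_min lexx !orbT.
  - by rewrite -ler_pdivlMr// !ge_min lexx !orbT.
(* [R0] dominates [- r z] for all [z] considered, so the ratio [kap = tau0 / s0] ensures
   [kap s <= tau0] whether or not [z] is close to the boundary. *)
pose R0 := `|r p0| + 1; have R00 : 0 < R0 by exact: ltr_wpDl.
pose s0 := R0 `^ 3^-1; have s00 : 0 < s0 by exact: powR_gt0.
pose kap := tau0 / s0; have kap0 : 0 < kap by exact: divr_gt0.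
exists (kap^-1 + 3 * E * kap ^+ 2), (Num.min d (Num.min D d6)); split.
- apply: ltr_pwDl; first by rewrite invr_gt0.
  by apply: mulr_ge0; [exact: mulr_ge0|exact: sqr_ge0].
- by rewrite !lt_min d0 D0 d60.
move=> z rz; rewrite !lt_min => /and3P[zd zD /hd6 zr] f hf fO fM f0.
pose dl := - r z; have dl0 : 0 < dl by rewrite oppr_gt0.
have dlR : dl <= R0.
  by move: zr; rewrite ler_norml /R0 /dl; have := ler_norm (- r p0); rewrite normrN; lra.
pose s := dl `^ 3^-1; have sp : 0 < s by exact: powR_gt0.
have s3 : dl = s ^+ 3.
  by rewrite -powR_mulrn ?powR_ge0// -powRrM mulVf// powRr1// ltW.
have s2 : dl `^ (2 / 3) = s ^+ 2.
  by rewrite -powR_mulrn ?powR_ge0// -powRrM mulrC.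
have ss0 : s <= s0 by apply: ge0_ler_powR; rewrite ?nnegrE ?invr_ge0// ltW.
rewrite -/dl s2.
pose tau := kap * s.
have tau_pos : 0 < tau by exact: mulr_gt0.
have tau_le : tau <= tau0.
  by rewrite /tau /kap mulrAC ler_pdivrMr// ler_wpM2l// ltW.
have tauE : tau = kap * s by [].
clearbody tau kap.
have [lY [b lb hT]] := taylor f hf fM.
set Y := 'D_1 f 0 in lY hT *.
pose al := dr_pair r z Y; rewrite -/al.
have [->|aln0] := eqVneq al 0.
  rewrite cabs0; apply: mulr_ge0; last exact: sqr_ge0.
  by apply: addr_ge0; [rewrite invr_ge0 ltW|apply: mulr_ge0; [exact: mulr_ge0|exact: sqr_ge0]].
pose a := cabs al; have a0 : 0 < a by rewrite cabs_gt0.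
(* The argument is chosen so that [(1 + i) w al] is the positive number [2 tau a]; the modulus is
   then [tau] times the square root of 2. *)
pose w : R[i] := (tau / a)%:C%C * (al^*)%C * (1 - 'i%C).
have i2 : cabs (1 - 'i%C : R[i]) ^+ 2 = 2 by rewrite sqr_cabs /=; ring.
have cal : cabs (al^*)%C = a.
  by apply/eqP; rewrite -(@eqrXn2 _ 2) ?cabs_ge0// !sqr_cabs; case: (al) => x y /=; rewrite
    sqrrN.
pose t := cabs w.
have t2 : t ^+ 2 = 2 * tau ^+ 2.
  rewrite /t /w !cabsM !exprMn i2 cal cabsR ger0_norm ?divr_ge0 ?ltW//.
  by field; rewrite gt_eqF.
have t0 : 0 <= t by exact: cabs_ge0.
have tt : t <= 2 * tau.
  rewrite -ler_sqr ?nnegrE ?mulr_ge0 ?(ltW tau_pos)// t2 exprMn.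
  by rewrite ler_wpM2r ?sqr_ge0// expr2 ler_peMr// ler1n.
have wal : 2 * complex.Re ((1 + 'i%C) * w * al) = 4 * tau * a.
  have -> : (1 + 'i%C) * w * al = (tau / a)%:C%C * ((al^*)%C * al) * ((1 + 'i%C) * (1 - 'i%C)).
    by rewrite /w; move: (tau / a)%:C%C (al^*)%C => x y; ring.
  have -> : (al^*)%C * al = (a ^+ 2)%:C%C.
    rewrite sqr_cabs; case: (al) => x y /=; apply/eqP; rewrite eq_complex /=.
    by apply/andP; split; apply/eqP; ring.
  have -> : (1 + 'i%C) * (1 - 'i%C) = (2%:R)%:C%C :> R[i].
    by apply/eqP; rewrite eq_complex /=; apply/andP; split; apply/eqP; ring.
  by rewrite -!rmorphM /=; field; rewrite gt_eqF.
have tlt1 : t < 1 by clear -tt tau_le ta; lra.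
have tSD : t * S < D.
  have h1 : t * S <= 2 * tau0 * S.
    by apply: ler_wpM2r; [exact: ltW|clear -tt tau_le; lra].
  by clear -h1 td D0; lra.
have iw : cabs ('i%C * w) = t.
  by rewrite cabsM /cabs /= expr0n expr1n /= add0r sqrtr1 mul1r.
have tl := hexp z Y b S rho t w zD erefl (ltW tlt1) tSD.
have {}tl := tl _ rho0 (f w - z) (f ('i%C * w) - z).
have SS : 2 * l1 Y + 2 * l1 b + rho <= S by rewrite /S; clear -lY lb; lra.
have T1 := hT w tlt1; have T2 := hT ('i%C * w); rewrite iw in T2; have {}T2 := T2 tlt1.
rewrite f0 in T1 T2; rewrite -/t in T1.
have := tl SS T1 T2; rewrite -/al wal -/E [z + _]addrC subrK [z + _]addrC subrK.
have r1 : r (f w) < 0 by apply: fO; rewrite cabs_lt1.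
have r2 : r (f ('i%C * w)) < 0 by apply: fO; rewrite cabs_lt1 iw.
have HLz := HL z rz zd Y; rewrite -/dl -/al -/a in HLz.
move=> hmain.
apply: (@optimal_radius a dl tau E (Lv r z Y) (K * B) (K * B ^+ 2) t s kap) => //.
- exact: ltW.
- apply: le_trans tb; apply: ler_pM => //; [exact: ltW| |by rewrite lerDl].
  by apply: mulr_ge0 => //; exact: ltW.
- have k1 : tau * (K * B ^+ 2) <= 1.
    apply: le_trans tc; apply: ler_pM => //; [exact: ltW| |by rewrite lerDl].
    by apply: mulr_ge0; [exact: ltW|exact: sqr_ge0].
  rewrite expr2 -mulrA; apply: (@le_trans _ _ (tau * 1)); first by apply: ler_wpM2l => //;
    exact: ltW.
  by rewrite mulr1 (le_trans tau_le)// (le_trans ta)// ler_pdivrMr// mul1r ler1n.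
- apply: le_trans HLz; rewrite lerN2 mulrDr lerD//.
    rewrite -mulrA [B ^+ 2 * _]mulrC; apply: ler_wpM2l; first exact: ltW.
    by apply: ler_wpM2l; [exact: ltW|rewrite lerXn2r ?nnegrE ?l1_ge0].
  rewrite -mulrA [B * _]mulrC; apply: ler_wpM2l; first exact: ltW.
  by apply: ler_wpM2l => //; exact: ltW.
have rE : r z = - dl by rewrite /dl opprK.
rewrite rE in hmain; move: r1 r2 hmain; move: (r _) (r _) (Lv r z Y) (E * _) => x y l e h1
  h2; clear -h1 h2; lra.
Qed.

(** The metric is an infimum over discs, so the claim is a bound on the normal speed of each disc,
    uniform in its centre. *)
Lemma kobayashi_lower Om r : bounded_set Om -> pseudoconvex Om -> defining_function 3 Om r ->
  exists C : R, 0 < C /\ forall z X, Om z ->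
    ((C * cabs (dr_pair r z X) / (`|r z| `^ (2 / 3)))%:E <= kobayashi Om z X)%E.
Proof.
move=> bO [q [defq hq]] defr; have [Cr OmE nd] := defr; have [Cq OmEq ndq] := defq.
have [M [M0 hM]] := bounded_coords bO.
have samer z : r z < 0 -> q z < 0.
  move=> rz; have Oz : Om z by rewrite OmE.
  by rewrite OmEq in Oz.
(* The Levi condition is known for the function [q] supplied by pseudoconvexity; it is carried over
   to [r]. *)
have hL p : bdry Om p -> forall X, dr_pair r p X = 0 -> 0 <= Lv r p X.
  move=> bp X dX; have [dX1 dX2] := iffLR (dr_pair_eq0 r p X) dX.
  have rp : r p = 0 by rewrite OmE in bp; exact: bdry_eq0 (Ck_continuous Cr) bp.
  have qp : q p = 0 by rewrite OmEq in bp; exact: bdry_eq0 (Ck_continuous Cq) bp.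
  have [v0 vn0] := ndq p bp; rewrite (pderivE v0 p Cq) in vn0.
  have [v vn] := nd p bp; rewrite (pderivE v p Cr) in vn.
  have [nu nu0] : exists nu, 0 < D1 r p nu.
    move: vn; rewrite neq_lt => /orP[h|h]; last by exists v.
    by exists (- v); rewrite D1N oppr_gt0.
  have Cr2 := Ck_pred Cr.
  apply: (Lv_ge0_transfer Cr2 Cq rp qp samer nu0 vn0 dX1 dX2).
  rewrite -Re_levi_ge0; apply: hq => //; apply/dr_pair_eq0.
  by split; apply: (D1_eq0_transfer Cr2 Cq rp qp samer nu0).
(* A bound that persists when [C] grows: near each point of the closure it holds for all large [C],
   and compactness turns this into one constant as [C] tends to [+oo]. *)
pose P (C : R) (z : 'rV[R[i]]_n) := r z < 0 -> forall f : R[i] -> 'rV[R[i]]_n, holo_disc f ->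
  (forall w : R[i], `|w| < 1 -> Om (f w)) -> f 0 = z ->
  cabs (dr_pair r z ('D_1 f 0)) <= C * (- r z) `^ (2 / 3).
have loc p0 : closure Om p0 -> exists C d : R, [/\ 0 < C, 0 < d & forall z, l1 (z - p0) < d
  -> P C z].
  move=> cp0.
  have [K [d [K0 d0 HL]]] : exists K d : R, [/\ 0 < K, 0 < d & forall z, r z < 0 -> l1 (z -
    p0) < d -> forall X,
      - (K * (- r z * l1 X ^+ 2 + cabs (dr_pair r z X) * l1 X)) <= Lv r z X].
    have [Op0|nOp0] := pselect (Om p0).
      by apply: levi_lower_interior => //; rewrite OmE in Op0.
    have bp0 : bdry Om p0 by [].
    have vn := defining_dr_pair_neq0 defr bp0.
    by apply: levi_lower_bdry; rewrite -?OmE.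
  have [C [d' [C0 d'0 h]]] := disc_normal_bound Cr K0 d0 M0 HL.
  exists C, d'; split => // z zp rz f hf fO f0; apply: h => // w w1.
    by have := fO w w1; rewrite OmE.
  by apply: hM; exact: fO.
have /compact_near_coveringP cov := compact_closure bO.
have [C [C0 hC]] : exists C : R, 0 < C /\ closure Om `<=` P C.
  have : \forall C \near +oo, closure Om `<=` P C.
    apply: cov => p0 /loc[C [d [C0 d0 h]]].
    exists ([set z | l1 (z - p0) < d], [set x | C < x]); first split => /=.
    - by apply/nbhs_l1P; exists d.
    - by exists C; split; [exact: num_real|].
    move=> [z x] [/= zp Cx] rz f hf fO f0; apply: (le_trans (h z zp rz f hf fO f0)).
    by rewrite ler_wpM2r ?powR_ge0 ?ltW.
  move=> [C [_ hC]]; exists (`|C| + 1); split; first by rewrite ltr_wpDl.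
  by apply: hC; rewrite (le_lt_trans (ler_norm _))// ltrDl.
(* For a candidate [1 / lam] the derivative of the disc is [lam X], so the speed bound reads
   [lam |<dr z, X>| <= C |r z|^(2/3)]. *)
exists C^-1; split; first by rewrite invr_gt0.
move=> z X Oz; apply: le_ereal_inf_tmp => _ [lam [lam0 [f [hf fO f0 df]]] <-].
have rz : r z < 0 by rewrite OmE in Oz.
have := hC z (subset_closure Oz) rz f hf fO f0.
rewrite df dr_pairZ cabsM cabsR gtr0_norm// lee_fin ltr0_norm// => h.
have pz : 0 < (- r z) `^ (2 / 3) by rewrite powR_gt0// oppr_gt0.
rewrite ler_pdivrMr// -(ler_pM2l lam0) mulVKf ?gt_eqF// mulrCA ler_pdivrMl//.
Qed.

End NormalBound.

Theorem theorem2p6 (R : realType) (n : nat) :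
  (forall (Om : set 'rV[R[i]]_n) (r : 'rV[R[i]]_n -> R),
      bounded_set Om -> Om !=set0 -> connected Om ->
      defining_function 2 Om r ->
      (exists (C alpha : R), [/\ 0 < C, 1 / 2 < alpha &
         forall z X : 'rV[R[i]]_n, Om z ->
           ((C * cabs (dr_pair r z X) / (`|r z| `^ alpha))%:E
              <= kobayashi Om z X)%E]) ->
      pseudoconvex Om)
  /\
  (forall (Om : set 'rV[R[i]]_n) (r : 'rV[R[i]]_n -> R),
      bounded_set Om -> Om !=set0 -> connected Om ->
      pseudoconvex Om ->
      defining_function 3 Om r ->
      exists C : R, 0 < C /\
        forall z X : 'rV[R[i]]_n, Om z ->
          ((C * cabs (dr_pair r z X) / (`|r z| `^ (2 / 3)))%:E
             <= kobayashi Om z X)%E).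
Proof.
split=> [Om r _ _ _ defr [C [alpha [C0 al hK]]]|Om r bO _ _ pO defr].
  exact: kobayashi_normal_pseudoconvex defr C0 al hK.
exact: kobayashi_lower bO pO defr.
Qed.
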